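(* Let $\mathfrak{g}$ be a simple complex Lie algebra of type $A_2$, $B_2$ or $G_2$, let $\mathfrak{h}$ be a Cartan subalgebra of $\mathfrak{g}$, and let $W$ be the Weyl group of $\mathfrak{g}$, acting diagonally on $\mathfrak{h}\oplus\mathfrak{h}^*$ and hence on the symmetric algebra $S=S(\mathfrak{h}\oplus\mathfrak{h}^* )$. Then the Poisson algebra of invariants $S^W$ is $1$-homogeneous, that is, for each positive integer $d$ there is, up to isomorphism, precisely one simple Poisson $S^W$-module of dimension $d$.
   Context: The base field is $\mathbb{C}$. A Poisson algebra is a commutative $\mathbb{C}$-algebra $A$ with a bilinear product $\{-,-\}$ making $A$ a Lie algebra and such that $\{a,-\}$ is a $\mathbb{C}$-derivation of $A$ for each $a\in A$. The symmetric algebra $S=S(\mathfrak{h}\oplus\mathfrak{h}^* )$ carries the Poisson bracket given by the standard symplectic structure on $\mathfrak{h}\oplus\mathfrak{h}^*$: $\{x,x'\}=0$ for $x,x'\in\mathfrak{h}$, $\{\xi,\xi'\}=0$ for $\xi,\xi'\in\mathfrak{h}^*$, and $\{x,\xi\}=\xi(x)$ for $x\in\mathfrak{h}$, $\xi\in\mathfrak{h}^*$. $W$ acts by Poisson automorphisms, so $S^W$ is a Poisson subalgebra. A Poisson $A$-module is an $A$-module $M$ with a bilinear product $\{-,-\}_M:A\times M\to M$ such that for all $a,b\in A$, $m\in M$: (1) $\{\{a,b\},m\}_M=\{a,\{b,m\}_M\}_M-\{b,\{a,m\}_M\}_M$; (2) $\{a,bm\}_M=\{a,b\}m+b\{a,m\}_M$;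 (3) $\{ab,m\}_M=a\{b,m\}_M+b\{a,m\}_M$. A Poisson submodule is an $A$-submodule $N$ with $\{a,n\}_M\in N$ for all $a\in A$, $n\in N$; a nonzero Poisson module $M$ is simple if its only Poisson submodules are $0$ and $M$. Isomorphisms of Poisson modules are bijective $A$-module homomorphisms commuting with the products $\{a,-\}$. Dimension means dimension over $\mathbb{C}$. *)

(* Defs.v *)
From HB Require Import structures.
From mathcomp Require Import all_boot all_order all_algebra.
From mathcomp Require Import boolp reals complex mpoly ring.

Set Implicit Arguments.
Unset Strict Implicit.
Unset Printing Implicit Defensive.

Import GRing.Theory.
Local Open Scope ring_scope.

HB.mixin Record Vector_isLie (K : fieldType) g of Vector K g := {
  lie : g -> g -> g;
  lieDl : forall (c : K) (x y z : g),
    lie (c *: x + y) z = c *: lie x z + lie y z;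
  lieDr : forall (c : K) (x y z : g),
    lie x (c *: y + z) = c *: lie x y + lie x z;
  lie_xx : forall x : g, lie x x = 0;
  lie_jacobi : forall x y z : g,
    lie x (lie y z) + lie y (lie z x) + lie z (lie x y) = 0
}.

#[short(type="lieAlgType")]
HB.structure Definition LieAlgebra (K : fieldType) :=
  {g of Vector K g & Vector_isLie K g}.

HB.mixin Record ComAlgebra_isPoisson (K : fieldType) A
    of GRing.ComAlgebra K A := {
  pbr : A -> A -> A;
  pbrDl : forall (c : K) (a b x : A),
    pbr (c *: a + b) x = c *: pbr a x + pbr b x;
  pbrDr : forall (c : K) (x a b : A),
    pbr x (c *: a + b) = c *: pbr x a + pbr x b;
  pbr_xx : forall a : A, pbr a a = 0;
  pbr_jacobi : forall a b c : A,
    pbr a (pbr b c) + pbr b (pbr c a) + pbr c (pbr a b) = 0;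
  pbr_leibniz : forall a b c : A, pbr a (b * c) = pbr a b * c + b * pbr a c
}.

#[short(type="poissonAlgType")]
HB.structure Definition PoissonAlgebra (K : fieldType) :=
  {A of GRing.ComAlgebra K A & ComAlgebra_isPoisson K A}.

(* The K-vector space structure of an A-module is restriction of scalars along
   c |-> c%:A. *)
HB.mixin Record Lmodule_isPoissonModule (K : fieldType) (A : poissonAlgType K) M
    of GRing.Lmodule A M := {
  pmod : A -> M -> M;
  pmodDl : forall (c : K) (a b : A) (m : M),
    pmod (c *: a + b) m = (c%:A : A) *: pmod a m + pmod b m;
  pmodDr : forall (c : K) (a : A) (m n : M),
    pmod a ((c%:A : A) *: m + n) = (c%:A : A) *: pmod a m + pmod a n;
  pmod_pbr : forall (a b : A) (m : M),
    pmod (pbr a b) m = pmod a (pmod b m) - pmod b (pmod a m);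
  pmod_scale : forall (a b : A) (m : M),
    pmod a (b *: m) = pbr a b *: m + b *: pmod a m;
  pmod_mul : forall (a b : A) (m : M),
    pmod (a * b) m = a *: pmod b m + b *: pmod a m
}.

#[short(type="poissonModType")]
HB.structure Definition PoissonModule (K : fieldType) (A : poissonAlgType K) :=
  {M of GRing.Lmodule A M & Lmodule_isPoissonModule K A M}.

Section PoissonModules.
Variables (K : fieldType) (A : poissonAlgType K).

Definition poisson_submodule (M : poissonModType A) (N : M -> Prop) : Prop :=
  [/\ N 0,
      forall m n : M, N m -> N n -> N (m + n),
      forall (a : A) (m : M), N m -> N (a *: m)
    & forall (a : A) (m : M), N m -> N (pmod a m)].

Definition simple_poisson_module (M : poissonModType A) : Prop :=
  (exists m : M, m <> 0) /\
  forall N : M -> Prop, poisson_submodule N ->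
    (forall m, N m <-> m = 0) \/ (forall m, N m).

Definition has_dim (M : poissonModType A) (d : nat) : Prop :=
  exists e : 'I_d -> M, forall m : M,
    exists! c : {ffun 'I_d -> K}, m = \sum_(i < d) ((c i)%:A : A) *: e i.

Definition poisson_module_iso (M N : poissonModType A) : Prop :=
  exists f : {linear M -> N},
    bijective f /\ forall (a : A) (m : M), f (pmod a m) = pmod a (f m).

Definition one_homogeneous : Prop :=
  forall d : nat, (0 < d)%N ->
    exists M : poissonModType A,
      [/\ simple_poisson_module M, has_dim M d
        & forall N : poissonModType A,
            simple_poisson_module N -> has_dim N d -> poisson_module_iso N M].

End PoissonModules.

Section MpolyBracket.
Variables (K : fieldType) (n : nat) (om : 'I_n -> 'I_n -> K).
Implicit Types p q r : {mpoly K[n]}.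

(* The biderivation with [mpoly_bracket 'X_i 'X_j = om i j]. *)
Definition mpoly_bracket p q : {mpoly K[n]} :=
  \sum_(i < n) \sum_(j < n) om i j *: (mderiv i p * mderiv j q).

Local Notation br := mpoly_bracket.

Lemma mpoly_gen_ind (P : {mpoly K[n]} -> Prop) :
  (forall c, P c%:MP) -> (forall i, P 'X_i) ->
  (forall p q, P p -> P q -> P (p + q)) ->
  (forall p q, P p -> P q -> P (p * q)) -> forall p, P p.
Proof.
move=> PC PX PD PM p; rewrite (mpolyE p); apply: big_ind.
- by rewrite -mpolyC0; apply: PC.
- exact: PD.
move=> m _; rewrite -mul_mpolyC; apply: (PM) => //; rewrite mpolyXE_id.
apply: big_ind => [|p1 p2 P1 P2|i _]; first by rewrite -mpolyC1; apply: PC.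
  exact: PM.
elim: (m i) => [|k IH]; first by rewrite expr0 -mpolyC1; apply: PC.
by rewrite exprS; apply: PM => //; apply: PX.
Qed.

Lemma mpoly_brDl c p q r : br (c *: p + q) r = c *: br p r + br q r.
Proof.
rewrite /mpoly_bracket scaler_sumr -big_split; apply: eq_bigr => i _ /=.
rewrite scaler_sumr -big_split; apply: eq_bigr => j _ /=.
by rewrite linearP /= mulrDl scalerDr -scalerAl !scalerA mulrC.
Qed.

Lemma mpoly_brDr c p q r : br r (c *: p + q) = c *: br r p + br r q.
Proof.
rewrite /mpoly_bracket scaler_sumr -big_split; apply: eq_bigr => i _ /=.
rewrite scaler_sumr -big_split; apply: eq_bigr => j _ /=.
by rewrite linearP /= mulrDr scalerDr -scalerAr !scalerA mulrC.
Qed.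

Lemma mpoly_br_mul p q r : br p (q * r) = br p q * r + q * br p r.
Proof.
rewrite /mpoly_bracket mulr_suml mulr_sumr -big_split; apply: eq_bigr => i _ /=.
rewrite mulr_suml mulr_sumr -big_split; apply: eq_bigr => j _ /=.
by rewrite mderivM -!mul_mpolyC; ring.
Qed.

Lemma mpoly_br_mull p q r : br (q * r) p = br q p * r + q * br r p.
Proof.
rewrite /mpoly_bracket mulr_suml mulr_sumr -big_split; apply: eq_bigr => i _ /=.
rewrite mulr_suml mulr_sumr -big_split; apply: eq_bigr => j _ /=.
by rewrite mderivM -!mul_mpolyC; ring.
Qed.

Lemma mpoly_br0 p : br p 0 = 0.
Proof. by have := mpoly_brDr (-1) 0 0 p; rewrite scaler0 addr0 scaleN1r addNr. Qed.

Lemma mpoly_brC p c : br p c%:MP = 0.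
Proof.
by rewrite /mpoly_bracket big1 // => i _; rewrite big1 // => j _;
   rewrite mderivC mulr0 scaler0.
Qed.

Lemma mpoly_brD p q r : br r (p + q) = br r p + br r q.
Proof. by rewrite -[p]scale1r mpoly_brDr !scale1r. Qed.

Lemma mpoly_brlD p q r : br (p + q) r = br p r + br q r.
Proof. by rewrite -[p]scale1r mpoly_brDl !scale1r. Qed.

Lemma mderivXU (i j : 'I_n) : mderiv i ('X_j : {mpoly K[n]}) = (i == j)%:R%:MP.
Proof.
rewrite mderivX mnm1E eq_sym; case: eqP => [->|_]; last by rewrite scale0r mpolyC0.
by rewrite scale1r -{1}[U_(j)%MM]add0m addmK mpolyX0 mpolyC1.
Qed.

Lemma mpoly_brX i j : br 'X_i 'X_j = (om i j)%:MP.
Proof.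
rewrite /mpoly_bracket (bigD1 i) //= (bigD1 j) //= !mderivXU !eqxx.
rewrite -mpolyCM mulr1 -mul_mpolyC -mpolyCM mulr1 !big1 ?addr0 //.
  move=> k ki; rewrite big1 // => l _.
  by rewrite !mderivXU (negbTE ki) mpolyC0 mul0r scaler0.
by move=> k kj; rewrite !mderivXU (negbTE kj) mpolyC0 mulr0 scaler0.
Qed.

Hypothesis om_xx : forall i, om i i = 0.
Hypothesis om_anti : forall i j, om i j = - om j i.

Lemma mpoly_br_anti p q : br p q = - br q p.
Proof.
rewrite /mpoly_bracket exchange_big /= -sumrN; apply: eq_bigr => i _.
rewrite -sumrN; apply: eq_bigr => j _.
by rewrite om_anti scaleNr mulrC.
Qed.

Lemma mpoly_br_xx p : br p p = 0.
Proof.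
elim/mpoly_gen_ind: p => [c|i|p q Hp Hq|p q Hp Hq].
- exact: mpoly_brC.
- by rewrite mpoly_brX om_xx mpolyC0.
- by rewrite mpoly_brlD !mpoly_brD Hp Hq (mpoly_br_anti p q); ring.
- by rewrite mpoly_br_mull !mpoly_br_mul Hp Hq (mpoly_br_anti p q); ring.
Qed.

Lemma mpoly_br_jacobi p q r : br p (br q r) + br q (br r p) + br r (br p q) = 0.
Proof.
(* unification and [ring] unfold the bracket unless it is made opaque *)
move: mpoly_bracket mpoly_brlD mpoly_brD mpoly_br_mull mpoly_br_mul
  mpoly_br_anti mpoly_brC mpoly_brX p q r.
move=> b brlD brrD brMl brMr anti brC brX.
pose J p q r := b p (b q r) + b q (b r p) + b r (b p q).
have JC u v w : J u v w = J v w u by rewrite /J; ring.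
have b0 u : b u 0 = 0 by rewrite -mpolyC0 brC.
have JK c v w : J c%:MP v w = 0.
  rewrite /J (anti c%:MP v) (anti c%:MP (b v w)) !brC.
  by rewrite !oppr0 !b0 !addr0.
have JD u v w t : J (u + v) w t = J u w t + J v w t.
  by rewrite /J !brlD !brrD; ring.
have JM u v w t : J (u * v) w t = J u w t * v + u * J v w t.
  rewrite /J !brMl !brMr !brrD !brMr (anti w u) (anti w v); ring.
have JX v w : (forall i, J 'X_i v w = 0) -> forall p, J p v w = 0.
  move=> HX; elim/mpoly_gen_ind => [c|//|s t Hs Ht|s t Hs Ht]; first exact: JK.
  - by rewrite JD Hs Ht addr0.
  - by rewrite JM Hs Ht mul0r mulr0 addr0.
move=> p q r; apply: (JX q r) => i.
rewrite JC; apply: (JX _ _) => j; rewrite JC; apply: (JX _ _) => k.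
by rewrite /J !brX !brC !addr0.
Qed.

End MpolyBracket.

Section SymmetricAlgebra.
Variables (K : fieldType) (H : vectType K).

Definition dual := 'Hom(H, K^o).

Local Notation V := (H * dual)%type.

Definition symplectic_form (u v : V) : K := v.2 u.1 - u.2 v.1.

Local Notation n := (\dim {: V}).
Local Notation e i := ((vbasis {: V})`_i).

(* The symmetric algebra of H (+) H^*, as polynomials in the vectors of the
   basis [vbasis {: V}]. *)
Definition sym_cotangent := {mpoly K[n]}.
HB.instance Definition _ := GRing.ComAlgebra.on sym_cotangent.

Definition sym_gen (v : V) : sym_cotangent :=
  \sum_(i < n) coord (vbasis {: V}) i v *: ('X_i : {mpoly K[n]}).

(* The Poisson bracket that extends [symplectic_form]: see [sym_pbr_gen]. *)
Definition sym_pbr (f g : sym_cotangent) : sym_cotangent :=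
  mpoly_bracket (fun i j => symplectic_form (e i) (e j)) f g.

Definition diag_act (w : 'End(H)) (v : V) : V := (w v.1, v.2 \o w^-1)%VF.

(* The algebra endomorphism that extends [diag_act w]: see [sym_act_gen]. *)
Definition sym_act (w : 'End(H)) (f : sym_cotangent) : sym_cotangent :=
  f \mPo [tuple (sym_gen (diag_act w (e i)) : {mpoly K[n]}) | i < n].

Lemma symplecticDl c u v x :
  symplectic_form (c *: u + v) x = c * symplectic_form u x + symplectic_form v x.
Proof.
by rewrite /symplectic_form /= linearP /= !lfunE /= !lfunE /= /GRing.scale /=; ring.
Qed.

Lemma symplecticDr c u v x :
  symplectic_form x (c *: u + v) = c * symplectic_form x u + symplectic_form x v.
Proof.
by rewrite /symplectic_form /= linearP /= !lfunE /= !lfunE /= /GRing.scale /=; ring.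
Qed.

Lemma symplecticC u v : symplectic_form u v = - symplectic_form v u.
Proof. by rewrite /symplectic_form opprB. Qed.

Lemma symplectic_sum (I J : finType) (a : I -> K) (b : J -> K) (p : I -> V)
    (q : J -> V) :
  symplectic_form (\sum_i a i *: p i) (\sum_j b j *: q j) =
  \sum_i \sum_j a i * b j * symplectic_form (p i) (q j).
Proof.
have l0 x : symplectic_form 0 x = 0 by rewrite /symplectic_form /= linear0 !lfunE subr0.
have r0 x : symplectic_form x 0 = 0 by rewrite symplecticC l0 oppr0.
elim/big_rec2: _ => [|i y x _ <-]; first by rewrite l0.
rewrite symplecticDl; congr (_ + _).
elim/big_rec2: _ => [|j t z _ <-]; first by rewrite r0 mulr0.
by rewrite symplecticDr mulrDr; congr (_ + _); ring.
Qed.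

Lemma diag_act_symplectic w u v : lker w == 0%VS ->
  symplectic_form (diag_act w u) (diag_act w v) = symplectic_form u v.
Proof. by move=> kw; rewrite /symplectic_form /= !comp_lfunE !lker0_lfunK. Qed.

Lemma diag_actP w c u v : diag_act w (c *: u + v) = c *: diag_act w u + diag_act w v.
Proof.
congr pair; rewrite /= ?linearP //.
by rewrite comp_lfunDl comp_lfunZl.
Qed.

Lemma sym_genP c u v : sym_gen (c *: u + v) = c *: sym_gen u + sym_gen v.
Proof.
rewrite /sym_gen scaler_sumr -big_split /=; apply: eq_bigr => i _.
by rewrite linearP scalerDl scalerA.
Qed.

Lemma sym_gen_basis (i : 'I_n) : sym_gen (e i) = 'X_i :> {mpoly K[n]}.
Proof.
rewrite /sym_gen (bigD1 i) //= coord_free ?(basis_free (vbasisP _)) // eqxx scale1r.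
rewrite big1 ?addr0 // => j ji.
by rewrite coord_free ?(basis_free (vbasisP _)) // eq_sym -val_eqE /= in ji *;
   rewrite (negbTE ji) scale0r.
Qed.


Lemma mpoly_br_sum om (a b : 'I_n -> K) :
  mpoly_bracket om (\sum_i a i *: 'X_i) (\sum_i b i *: 'X_i) =
  (\sum_i \sum_j a i * b j * om i j)%:MP.
Proof.
have l0 x : mpoly_bracket om 0 x = 0.
  have := mpoly_brDl om (-1) 0 0 x.
  by rewrite scaler0 addr0 scaleN1r addNr.
rewrite (big_morph (fun p => mpoly_bracket om p _)
  (fun p q => mpoly_brlD om p q _) (l0 _)) raddf_sum; apply: eq_bigr => i _ /=.
rewrite (big_morph (fun p => mpoly_bracket om _ p)
  (fun p q => mpoly_brD om p q _) (mpoly_br0 om _)) raddf_sum.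
apply: eq_bigr => j _ /=.
have := mpoly_brDl om (a i) 'X_i 0 (b j *: 'X_j); rewrite l0 !addr0 => ->.
have := mpoly_brDr om (b j) 'X_j 0 'X_i; rewrite mpoly_br0 !addr0 => ->.
by rewrite mpoly_brX -!mul_mpolyC -!mpolyCM mulrA.
Qed.

Lemma sym_pbr_gen u v :
  sym_pbr (sym_gen u) (sym_gen v) = (symplectic_form u v)%:A.
Proof.
rewrite /sym_pbr mpoly_br_sum -symplectic_sum alg_mpolyC.
by rewrite -!coord_vbasis ?memvf.
Qed.

Lemma sym_act_gen w v : sym_act w (sym_gen v) = sym_gen (diag_act w v).
Proof.
have g0 : sym_gen 0 = 0.
  by rewrite /sym_gen big1 // => i _; rewrite linear0 scale0r.
have d0 : diag_act w 0 = 0.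
  have := diag_actP w (-1) 0 0.
  by rewrite scaler0 addr0 scaleN1r addNr.
have gd x y : sym_gen (diag_act w (x + y)) =
    sym_gen (diag_act w x) + sym_gen (diag_act w y).
  by rewrite -[x]scale1r diag_actP sym_genP !scale1r.
have gz c x : sym_gen (diag_act w (c *: x)) = c *: sym_gen (diag_act w x).
  by rewrite -[c *: x]addr0 diag_actP sym_genP d0 g0 addr0.
rewrite [in RHS](coord_vbasis (memvf v)).
have gd0 : sym_gen (diag_act w 0) = 0 by rewrite d0 g0.
rewrite (big_morph (fun x => sym_gen (diag_act w x)) gd gd0).
rewrite {1}/sym_gen /sym_act linear_sum /=; apply: eq_bigr => i _.
by rewrite gz comp_mpolyZ comp_mpolyXU -(tnth_nth 0) tnth_mktuple.
Qed.

Lemma sym_actP w : GRing.subalg_closed [pred f | sym_act w f == f].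
Proof.
split; rewrite ?inE.
- by rewrite /sym_act rmorph1.
- move=> c f g; rewrite !inE => /eqP Hf /eqP Hg; apply/eqP.
  by rewrite -[in RHS]Hf -[in RHS]Hg /sym_act linearP.
- move=> f g; rewrite !inE => /eqP Hf /eqP Hg; apply/eqP.
  by rewrite -[in RHS]Hf -[in RHS]Hg /sym_act rmorphM.
Qed.

Lemma sym_act_pbr w f g : lker w == 0%VS ->
  sym_act w (sym_pbr f g) = sym_pbr (sym_act w f) (sym_act w g).
Proof.
move=> kw.
have actD p q : sym_act w (p + q) = sym_act w p + sym_act w q by exact: rmorphD.
have actM p q : sym_act w (p * q) = sym_act w p * sym_act w q by exact: rmorphM.
have actC c : sym_act w c%:MP = c%:MP by exact: comp_mpolyC.
have anti p q : sym_pbr p q = - sym_pbr q p.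
  by apply: mpoly_br_anti => i j; exact: symplecticC.
have brC p c : sym_pbr p c%:MP = 0 by exact: mpoly_brC.
have brCl p c : sym_pbr c%:MP p = 0 by rewrite anti brC oppr0.
have act0 : sym_act w 0 = 0 by rewrite -mpolyC0 actC.
have brD p q r : sym_pbr r (p + q) = sym_pbr r p + sym_pbr r q by exact: mpoly_brD.
have brDl p q r : sym_pbr (p + q) r = sym_pbr p r + sym_pbr q r by exact: mpoly_brlD.
have brM p q r : sym_pbr p (q * r) = sym_pbr p q * r + q * sym_pbr p r.
  exact: mpoly_br_mul.
have brMl p q r : sym_pbr (q * r) p = sym_pbr q p * r + q * sym_pbr r p.
  exact: mpoly_br_mull.
elim/mpoly_gen_ind: f => [c|i|p q Hp Hq|p q Hp Hq].
- by rewrite actC !brCl act0.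
- elim/mpoly_gen_ind: g => [c|j|p q Hp Hq|p q Hp Hq].
  + by rewrite actC !brC act0.
  + rewrite -!sym_gen_basis sym_pbr_gen !sym_act_gen sym_pbr_gen.
    by rewrite diag_act_symplectic // !alg_mpolyC actC.
  + by rewrite actD !brD actD Hp Hq.
  + by rewrite actM !brM actD !actM Hp Hq.
- by rewrite actD !brDl actD Hp Hq.
- by rewrite actM !brMl actD !actM Hp Hq.
Qed.

Definition sym_bracket_Dl c f g x :
    sym_pbr (c *: f + g) x = c *: sym_pbr f x + sym_pbr g x :=
  mpoly_brDl _ c f g x.

Definition sym_bracket_Dr c x f g :
    sym_pbr x (c *: f + g) = c *: sym_pbr x f + sym_pbr x g :=
  mpoly_brDr _ c f g x.

Definition sym_bracket_leibniz f g h :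
    sym_pbr f (g * h) = sym_pbr f g * h + g * sym_pbr f h :=
  mpoly_br_mul _ f g h.

Lemma sym_bracket_xx f : sym_pbr f f = 0.
Proof.
apply: mpoly_br_xx => [i|i j]; last exact: symplecticC.
by rewrite /symplectic_form subrr.
Qed.

Lemma sym_bracket_jacobi f g h :
  sym_pbr f (sym_pbr g h) + sym_pbr g (sym_pbr h f) + sym_pbr h (sym_pbr f g) = 0.
Proof. by apply: mpoly_br_jacobi => i j; exact: symplecticC. Qed.

HB.instance Definition _ := ComAlgebra_isPoisson.Build K sym_cotangent
  sym_bracket_Dl sym_bracket_Dr sym_bracket_xx sym_bracket_jacobi
  sym_bracket_leibniz.

End SymmetricAlgebra.

Record linear_group (K : fieldType) (H : vectType K) := LinearGroup {
  lg_mem :> 'End(H) -> Prop;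
  lg_one : lg_mem \1%VF;
  lg_mul : forall v w, lg_mem v -> lg_mem w -> lg_mem (v \o w)%VF;
  lg_inv : forall w, lg_mem w -> lg_mem (w^-1)%VF;
  lg_inj : forall w, lg_mem w -> lker w == 0%VS
}.

Section Invariants.
Variables (K : fieldType) (H : vectType K) (G : linear_group H).

Definition is_invariant : {pred sym_cotangent H} :=
  [pred f | `[< forall w, G w -> sym_act w f = f >]].

Lemma invariant_subalg : GRing.subalg_closed is_invariant.
Proof.
split; rewrite ?inE.
- by apply/asboolP => w _; rewrite /sym_act rmorph1.
- move=> c f g; rewrite !inE => /asboolP Hf /asboolP Hg; apply/asboolP => w Gw.
  by have [_ /(_ c f g)] := sym_actP w; rewrite !inE !Hf // !Hg // !eqxx => /(_ isT isT)/eqP.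
- move=> f g; rewrite !inE => /asboolP Hf /asboolP Hg; apply/asboolP => w Gw.
  by have [_ _ /(_ f g)] := sym_actP w; rewrite !inE !Hf // !Hg // !eqxx => /(_ isT isT)/eqP.
Qed.

HB.instance Definition _ :=
  GRing.isSubalgClosed.Build K (sym_cotangent H) is_invariant
    (GRing.subalg_closed_semi invariant_subalg).

Record invariant_alg := Invariant {
  invariant_val :> sym_cotangent H;
  _ : invariant_val \in is_invariant
}.

HB.instance Definition _ := [isSub for invariant_val].
HB.instance Definition _ := [Choice of invariant_alg by <:].
HB.instance Definition _ := [SubChoice_isSubAlgebra of invariant_alg by <:].
HB.instance Definition _ := [SubNzRing_isSubComNzRing of invariant_alg by <:].

Lemma invariant_pbr (f g : invariant_alg) : pbr (val f) (val g) \in is_invariant.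
Proof.
apply/asboolP => w Gw; rewrite /pbr /= sym_act_pbr ?(lg_inj Gw) //.
by case: f g => [f /asboolP Hf] [g /asboolP Hg] /=; rewrite Hf // Hg.
Qed.

Definition invariant_bracket (f g : invariant_alg) : invariant_alg :=
  Invariant (invariant_pbr f g).

Local Notation br := invariant_bracket.

Lemma invariant_brDl (c : K) f g x : br (c *: f + g) x = c *: br f x + br g x.
Proof. by apply: val_inj; rewrite /= pbrDl. Qed.

Lemma invariant_brDr (c : K) x f g : br x (c *: f + g) = c *: br x f + br x g.
Proof. by apply: val_inj; rewrite /= pbrDr. Qed.

Lemma invariant_br_xx f : br f f = 0.
Proof. by apply: val_inj; rewrite /= pbr_xx. Qed.

Lemma invariant_br_jacobi f g h :
  br f (br g h) + br g (br h f) + br h (br f g) = 0.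
Proof. by apply: val_inj; rewrite /= pbr_jacobi. Qed.

Lemma invariant_br_leibniz f g h : br f (g * h) = br f g * h + g * br f h.
Proof. by apply: val_inj; rewrite /= pbr_leibniz. Qed.

HB.instance Definition _ := ComAlgebra_isPoisson.Build K invariant_alg
  invariant_brDl invariant_brDr invariant_br_xx invariant_br_jacobi
  invariant_br_leibniz.

End Invariants.

Section LieAlgebras.
Variables (K : fieldType) (g : lieAlgType K).

Definition lie_ideal (I : {vspace g}) : Prop :=
  forall x y : g, y \in I -> lie x y \in I.

Definition simple_lie : Prop :=
  (exists x y : g, lie x y <> 0) /\
  forall I : {vspace g}, lie_ideal I -> I = 0%VS \/ I = fullv.

Definition lie_subalgebra (h : {vspace g}) : Prop :=
  forall x y : g, x \in h -> y \in h -> lie x y \in h.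

Definition lie_span (U V : {vspace g}) : {vspace g} :=
  <<[seq lie x y | x <- vbasis U, y <- vbasis V]>>%VS.

Definition lie_nilpotent (h : {vspace g}) : Prop :=
  exists k : nat, iter k (lie_span h) h = 0%VS.

Definition cartan_subalgebra (h : {vspace g}) : Prop :=
  [/\ lie_subalgebra h, lie_nilpotent h
    & forall x : g, (forall y : g, y \in h -> lie x y \in h) -> x \in h].

Variable h : {vspace g}.
Local Notation H := (subvs_of h).

Definition is_root (a : dual H) : Prop :=
  a != 0 /\
  exists2 y : g, y != 0 & forall x : H, lie (vsval x) y = (a x : K) *: y.

(* For a root system R in the dual of H, the coroot of a root a is the unique c
   in H with a(c) = 2 for which the reflection b |-> b - b(c) a maps R to R. *)
Definition is_coroot (a : dual H) (c : H) : Prop :=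
  a c = 2%:R /\ forall b : dual H, is_root b -> is_root (b - (b c : K) *: a).

Definition is_reflection (s : 'End(H)) : Prop :=
  exists (a : dual H) (c : H),
    [/\ is_root a, is_coroot a c & forall x : H, s x = x - (a x : K) *: c].

Inductive weyl_mem : 'End(H) -> Prop :=
| weyl_reflection s : is_reflection s -> weyl_mem s
| weyl_one : weyl_mem \1%VF
| weyl_mul v w : weyl_mem v -> weyl_mem w -> weyl_mem (v \o w)%VF
| weyl_inv w : weyl_mem w -> weyl_mem (w^-1)%VF.

Lemma weyl_inj w : weyl_mem w -> lker w == 0%VS.
Proof.
elim=> {w} [s [a [c [_ [ac _] sE]]]||v w _ /lker0P iv _ /lker0P iw|w _ kw].
- apply/lker0P => x y sxy; apply/eqP; rewrite -subr_eq0.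
  have e : (x - y) - (a (x - y) : K) *: c = 0 by rewrite -sE linearB /= sxy subrr.
  move: (x - y) e => z e; have az : (a z : K) = 0.
    have := congr1 a e; rewrite linearB linearZ /= ac linear0 /GRing.scale /= => e2.
    by apply/eqP; rewrite -oppr_eq0 -[X in _ == X]e2; apply/eqP; ring.
  by move/eqP: e; rewrite az scale0r subr0.
- by apply/lker0P => x y; rewrite !lfunE.
- by apply/lker0P => x y; rewrite !comp_lfunE => /iv /iw.
- by apply/lker0P; apply: (can_inj (g := w)) => x; apply: lker0_lfunVK.
Qed.

Definition weyl_group : linear_group H :=
  LinearGroup weyl_one weyl_mul weyl_inv weyl_inj.

End LieAlgebras.

Inductive rank2_type := A2 | B2 | G2.

(* The positive roots in coordinates with respect to a base (a, b); in types B2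
   and G2 the root a is the short one. *)
Definition positive_roots (t : rank2_type) : seq (nat * nat) :=
  match t with
  | A2 => [:: (1, 0); (0, 1); (1, 1)]
  | B2 => [:: (1, 0); (0, 1); (1, 1); (2, 1)]
  | G2 => [:: (1, 0); (0, 1); (1, 1); (2, 1); (3, 1); (3, 2)]
  end%N.

(* The root system of g with respect to h is isomorphic to that of type t. *)
Definition has_type (K : fieldType) (g : lieAlgType K) (h : {vspace g})
    (t : rank2_type) : Prop :=
  exists a b : dual (subvs_of h),
    basis_of fullv [:: a; b] /\
    forall r : dual (subvs_of h), is_root r <->
      exists2 p, p \in positive_roots t &
        r = a *+ p.1 + b *+ p.2 \/ r = - (a *+ p.1 + b *+ p.2).

(* Main.v *)
From HB Require Import structures.
Require Import Defs.
From mathcomp Require Import all_boot all_order all_algebra.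
From mathcomp Require Import boolp reals complex mpoly ring zify.

Set Implicit Arguments.
Unset Strict Implicit.
Unset Printing Implicit Defensive.

Import Order.TTheory GRing.Theory Num.Theory.
Local Open Scope ring_scope.

(** The Weyl group [W] preserves the form that sums the squares of the roots and
    contains the product of the two simple reflections, a rotation of order 3, 4 or
    6. In the isotropic basis [u1], [u2] of eigenvectors
    of this rotation, every element of [W] is diagonal or antidiagonal
    ([monomial_isotropic], [weyl_graded]). Let [x1], [x2] be the coordinates given by
    this basis and [y1], [y2] the ones dual to [x2], [x1]. Then [e = x1 x2],
    [f = - y1 y2] and [h = - (x1 y2 + x2 y1)] are invariant and form an sl2-triple.
    Evaluating derivatives at the origin and using the rotation, one sees that there
    are no invariants of degree one and that the triple spans those of degree two
    ([fixed_jetP]). So an invariant can act on any sl2-module through its value at the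
    origin and its quadratic part, which gives a simple Poisson module in each
    dimension ([std_rep_simple]).

    Conversely, in a simple module of finite dimension, let [J] be the invariants
    that vanish at the origin. The key is the Capelli identity ([capelli], [capelli2]):
    an invariant of bidegree [(i, j)] with [i > 1] and [j > 0] is a bracket of [e] with
    an invariant of weight lower by two, plus a multiple of [omega ^+ 2], where
    [omega = x1 y2 - x2 y1] and [omega ^+ 2 = h ^+ 2 + 4 e f] lies in the square of
    [J]. Elements of nonzero weight under [h] act nilpotently, because weights are
    bounded; a derivation preserves the nilradical of a commutative algebra
    ([ad_nilp]), so the identity extends nilpotency to weight zero. First, the whole
    of [J] scales by commuting nilpotent matrices, whose common kernel is a nonzero
    submodule; hence [J] scales by zero ([rl_eps]), and the bracket with an element of
    the square of [J] is zero. Secondly, the same argument, run by descending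
    induction on the degree, shows that invariants of degree at least three have zero
    bracket action ([rd_step], [rd_high]); it starts in large degree, where repeating
    the identity reaches weights that are too negative to act ([rd_large]). So the
    module is a simple module of sl2, and highest weight theory identifies it
    ([sl2_classification]). *)

(** * Commuting nilpotent matrices *)

Lemma root_nat_bounded (K : numFieldType) (p : {poly K}) : p != 0 ->
  exists N : nat, forall k, (N <= k)%N ->
    ~~ root p k%:R /\ ~~ root p (- k%:R).
Proof.
move: {2}(size p) (leqnn (size p)) => s; elim: s p => [|s IH] p sp p0.
  by move: sp; rewrite leqn0 size_poly_eq0 (negbTE p0).
have [noroot|] := pselect (forall k : nat, ~~ root p k%:R /\ ~~ root p (- k%:R)).
  by exists 0%N.
move=> /existsNP[k0 /not_andP rk0].
have [x [rx xk]] : exists x, root p x /\ (x = k0%:R \/ x = - k0%:R).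
  by case: rk0 => /negP; rewrite negbK => r; [exists k0%:R|exists (- k0%:R)];
     split=> //; [left|right].
have /factor_theorem[q pq] := rx.
have q0 : q != 0 by apply: contraNneq p0 => q0; rewrite pq q0 mul0r.
have sq : (size q <= s)%N.
  by rewrite -ltnS; apply: leq_trans sp; rewrite pq size_Mmonic ?monicXsubC //
     size_XsubC addn2.
have [N HN] := IH q sq q0; exists (maxn N k0.+1) => k.
rewrite geq_max => /andP[Nk kk]; have [r1 r2] := HN k Nk.
rewrite pq !rootM !root_XsubC !negb_or r1 r2 /=.
have kk' : (0 < k + k0)%N by rewrite addn_gt0 (leq_ltn_trans _ kk).
have ne : k%:R != k0%:R :> K by rewrite eqr_nat gtn_eqF.
have ne' : k%:R != - k0%:R :> K.
  by rewrite -addr_eq0 -natrD pnatr_eq0 -lt0n.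
by case: xk => ->; rewrite ?eqr_opp // eqr_oppLR.
Qed.

Section Nilpotent.
Variables (K : numFieldType) (n : nat).
Implicit Types (X Y Z T U : 'M[K]_n.+1).

Definition mx_nilp T := exists k, T ^+ k = 0.

Lemma mx_nilp0 : mx_nilp 0.
Proof. by exists 1%N; rewrite expr1. Qed.

Lemma mx_nilp_expr T j k : (j <= k)%N -> T ^+ j = 0 -> T ^+ k = 0.
Proof. by move=> jk Tj; rewrite -(subnK jk) exprD Tj mulr0. Qed.

Lemma mx_nilpM T U : GRing.comm T U -> mx_nilp T -> mx_nilp (T * U).
Proof. by move=> c [k Tk]; exists k; rewrite exprMn_comm // Tk mul0r. Qed.

Lemma mx_nilpZ c T : mx_nilp T -> mx_nilp (c *: T).
Proof. by case=> k Tk; exists k; rewrite exprZn Tk scaler0. Qed.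

Lemma mx_nilpD T U : GRing.comm T U -> mx_nilp T -> mx_nilp U ->
  mx_nilp (T + U).
Proof.
move=> c [j Tj] [k Uk]; exists (j + k)%N; rewrite exprDn_comm // big1 // => i _.
have [ki|ik] := leqP k i.
  by rewrite (mx_nilp_expr ki Uk) mulr0 mul0rn.
by rewrite (@mx_nilp_expr T j) ?mul0r ?mul0rn // -addnBA ?leq_addr // ltnW.
Qed.

(** The numbers [k] and [- k] in question are eigenvalues of the bracket with
    [X], hence roots of one characteristic polynomial. *)
Lemma ad_weight_bounded X : exists N : nat, forall k T, (N <= k)%N ->
  X * T - T * X = k%:R *: T \/ X * T - T * X = - k%:R *: T -> T = 0.
Proof.
pose f : 'M[K]_n.+1 -> 'M[K]_n.+1 := mulmx X \- mulmxr X.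
have [N HN] := root_nat_bounded (monic_neq0 (char_poly_monic (lin_mx f))).
exists N => k T /HN[r1 r2] HT; apply/eqP; apply: contraT => T0.
have ev c : X * T - T * X = c *: T -> root (char_poly (lin_mx f)) c.
  move=> HTc; rewrite -eigenvalue_root_char; apply/eigenvalueP.
  exists (mxvec T); last by rewrite mxvec_eq0.
  by rewrite (mul_vec_lin (mulmx X \- mulmxr X)%R) /= -linearZ /= -HTc.
by case: HT => /ev; [rewrite (negbTE r1)|rewrite (negbTE r2)].
Qed.

(** If [T] has weight [w] then [T ^+ k] has weight [w * k], and large weights do
    not occur. *)
Lemma ad_weight_nilp X T w : (0 < w)%N ->
  X * T - T * X = w%:R *: T \/ X * T - T * X = - w%:R *: T -> mx_nilp T.
Proof.
move=> w0 HT; have [N HN] := ad_weight_bounded X.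
have pw c : X * T - T * X = c *: T ->
    forall k, X * T ^+ k - T ^+ k * X = (c *+ k) *: T ^+ k.
  move=> XT; elim=> [|k IH]; first by rewrite expr0 mulr1 mul1r subrr scale0r.
  rewrite exprS mulrA [X * T](_ : _ = c *: T + T * X); last by rewrite -XT subrK.
  rewrite mulrDl -!mulrA -addrA -mulrBr IH mulrS scalerDl -scalerAr -scalerAl.
  by rewrite addrC addrC.
exists N; apply: (HN (w * N)%N); first by rewrite leq_pmull.
by case: HT => /pw/(_ N) ->; [left|right]; rewrite ?mulNrn -mulrnA natrM.
Qed.

Lemma ad_exprS X Y Z k : Z = X * Y - Y * X -> GRing.comm Y Z ->
  X * Y ^+ k - Y ^+ k * X = (Y ^+ k.-1 * Z) *+ k.
Proof.
move=> ZE c; case: k => [|k] /=; first by rewrite mulr1 mul1r subrr.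
elim: k => [|k IH]; first by rewrite expr1 mul1r ZE.
rewrite exprS mulrA [X * Y](_ : _ = Z + Y * X); last by rewrite ZE subrK.
rewrite mulrDl -!mulrA -addrA -mulrBr IH [Z * _](commrX _ (commr_sym c)).
by rewrite mulrnAr mulrA -exprS -mulrS.
Qed.

(** Over a field of characteristic zero a derivation of a commutative algebra
    preserves the nilradical: applying it repeatedly to [Y ^+ k = 0] trades
    each factor [Y] for two factors [Z]. *)
Lemma ad_nilp X Y Z U : Z = X * Y - Y * X -> U = X * Z - Z * X ->
  GRing.comm Y Z -> GRing.comm Y U -> GRing.comm Z U ->
  mx_nilp Y -> mx_nilp Z.
Proof.
move=> ZE UE YZ YU ZU [k Yk]; exists k.*2.
suff H r : (r <= k)%N -> Y ^+ (k - r) * Z ^+ r.*2 = 0.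
  by rewrite -[LHS]mul1r -(expr0 Y) -{1}(subnn k) H.
elim: r => [|r IH] rk; first by rewrite subn0 Yk mul0r.
have {IH} := IH (ltnW rk); rewrite -(subnSK rk).
set s := (k - r.+1)%N => YZ0.
have := congr1 (fun M => X * M - M * X) YZ0; rewrite mulr0 mul0r subrr.
have -> : X * (Y ^+ s.+1 * Z ^+ r.*2) - Y ^+ s.+1 * Z ^+ r.*2 * X =
   (X * Y ^+ s.+1 - Y ^+ s.+1 * X) * Z ^+ r.*2 +
   Y ^+ s.+1 * (X * Z ^+ r.*2 - Z ^+ r.*2 * X).
  by rewrite mulrBl mulrBr !mulrA addrA subrK.
rewrite (ad_exprS _ ZE YZ) (ad_exprS _ UE ZU) => /(congr1 ( *%R^~ Z)).
rewrite mul0r mulrDl.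
have -> : Y ^+ s.+1 * (Z ^+ r.*2.-1 * U *+ r.*2) * Z =
    (Y ^+ s.+1 * Z ^+ r.*2 * U) *+ r.*2.
  case: (r) => [|r']; first by rewrite !mulr0n mulr0 mul0r.
  by rewrite doubleS /= mulrnAr mulrnAl (exprSr Z (_.+1)) -!mulrA ZU.
rewrite YZ0 mul0r mul0rn addr0 /= mulrnAl mulrnAl => /eqP.
rewrite -scaler_nat scaler_eq0 pnatr_eq0 /= => /eqP <-.
by rewrite doubleS -!mulrA -exprSr -exprS.
Qed.

(** A nonzero subspace of least dimension among those that the family leaves
    stable is killed by it, since the image under a nilpotent member is a
    smaller stable subspace. *)
Lemma common_kernel (F : 'M[K]_n.+1 -> Prop) :
  (forall T, F T -> mx_nilp T) ->
  (forall T U, F T -> F U -> GRing.comm T U) ->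
  exists2 v : 'cV[K]_n.+1, v != 0 & forall T, F T -> T *m v = 0.
Proof.
move=> Fnil Fcomm.
pose st (U : 'M[K]_n.+1) := forall T, F T -> (U *m T^T <= U)%MS.
pose P (r : nat) := `[< exists U : 'M[K]_n.+1, [/\ U != 0, st U &  \rank U = r] >].
have exP : exists r : nat, P r.
  exists (\rank (1%:M : 'M[K]_n.+1)); apply/asboolP; exists 1%:M; split=> //.
    exact: oner_neq0.
  by move=> T _; rewrite submx1.
have [r /asboolP[U [U0 stU rU]] rmin] := @ex_minnP _ exP.
have kill T : F T -> U *m T^T = 0.
  move=> FT; apply/eqP; apply: contraT => UT0.
  have stUT : st (U *m T^T).
    move=> T' FT'; rewrite -mulmxA -trmx_mul [T' *m T]Fcomm // trmx_mul mulmxA.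
    by rewrite submxMr ?stU.
  have rle : (r <= \rank (U *m T^T))%N.
    by apply: rmin; apply/asboolP; exists (U *m T^T).
  have UsT : (U <= U *m T^T)%MS.
    by rewrite -(geq_leqif (mxrank_leqif_sup (stU T FT))) rU.
  have UsTk k : (U <= U *m (T ^+ k)^T)%MS.
    elim: k => [|k IH]; first by rewrite expr0 trmx1 mulmx1.
    apply: (submx_trans UsT); rewrite exprS [(T * _)^T]trmx_mul mulmxA.
    exact: submxMr.
  have [k Tk] := Fnil T FT; move: (UsTk k).
  by rewrite Tk trmx0 mulmx0 submx0 (negbTE U0).
exists (nz_row U)^T; first by rewrite trmx_eq0 nz_row_eq0.
move=> T FT; apply: trmx_inj; rewrite trmx_mul trmxK trmx0.
by apply/eqP; rewrite -submx0 -(kill T FT) submxMr ?nz_row_sub.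
Qed.
End Nilpotent.

(** * Poisson brackets *)

Section PoissonBasics.
Variables (K : fieldType) (S : poissonAlgType K).
Implicit Types a b c x y : S.

Lemma pbrD x a b : pbr x (a + b) = pbr x a + pbr x b.
Proof. by rewrite -[a]scale1r pbrDr !scale1r. Qed.

Lemma pbr0 x : pbr x 0 = 0.
Proof. by have := pbrDr (-1) x 0 0; rewrite scaler0 addr0 scaleN1r addNr. Qed.

Lemma pbrZ k x a : pbr x (k *: a) = k *: pbr x a.
Proof. by rewrite -[k *: a]addr0 pbrDr pbr0 addr0. Qed.

Lemma pbrN x a : pbr x (- a) = - pbr x a.
Proof. by rewrite -scaleN1r pbrZ scaleN1r. Qed.

Lemma pbrB x a b : pbr x (a - b) = pbr x a - pbr x b.
Proof. by rewrite pbrD pbrN. Qed.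

Lemma pbrDleft a b x : pbr (a + b) x = pbr a x + pbr b x.
Proof. by rewrite -[a]scale1r pbrDl !scale1r. Qed.

Lemma pbr_anti a b : pbr a b = - pbr b a.
Proof.
apply/eqP; rewrite -addr_eq0; apply/eqP.
by have := pbr_xx (a + b); rewrite pbrD !pbrDleft !pbr_xx add0r addr0 addrC.
Qed.

Lemma pbrMleft a b x : pbr (a * b) x = a * pbr b x + b * pbr a x.
Proof. by rewrite pbr_anti pbr_leibniz !(pbr_anti x); ring. Qed.

Lemma pbrNleft a x : pbr (- a) x = - pbr a x.
Proof. by rewrite pbr_anti pbrN -pbr_anti. Qed.

Lemma pbrZleft k a x : pbr (k *: a) x = k *: pbr a x.
Proof. by rewrite pbr_anti pbrZ -scalerN -pbr_anti. Qed.

Lemma pbr1 x : pbr x 1 = 0.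
Proof.
have := pbr_leibniz x 1 1; rewrite !mulr1 mul1r => /eqP.
by rewrite -subr_eq0 opprD addrA subrr add0r oppr_eq0 => /eqP.
Qed.

Lemma pbr_alg x k : pbr x k%:A = 0.
Proof. by rewrite pbrZ pbr1 scaler0. Qed.

Lemma pbr_algleft x k : pbr k%:A x = 0.
Proof. by rewrite pbr_anti pbr_alg oppr0. Qed.

Lemma pbr_jac a b c : pbr a (pbr b c) = pbr (pbr a b) c + pbr b (pbr a c).
Proof.
have := pbr_jacobi a b c; rewrite [pbr c (pbr a b)]pbr_anti (pbr_anti c a).
by rewrite pbrN => /eqP; rewrite subr_eq0 subr_eq => /eqP ->.
Qed.

End PoissonBasics.

(** * Poisson algebras graded by a copy of sl2 *)

(** What the classification of the simple modules uses about the algebra of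
    invariants. The elements [sg_e], [sg_f], [sg_h] form an sl2-triple for the
    bracket, [sg_eps] is the value at the origin, and [sg_ce a], [sg_cf a],
    [sg_ch a] are the coefficients of the triple in the quadratic part of [a].
    The predicate [sg_gr i j] is bihomogeneity of bidegree [(i, j)] for a
    bigrading in which the bracket has bidegree [(-1, -1)]; [sg_weight] makes
    [i - j] the weight for [sg_h]. Degree one is zero and degree two is spanned
    by the triple. The last field replaces complete reducibility under sl2: up
    to a multiple of the invariant quadratic element, which lies in the square
    of the augmentation ideal, every element of bidegree [(i, j)] with [i > 1]
    and [j > 0] is a bracket with [sg_e] of an element of lower weight. *)
Record sl2_graded (K : numFieldType) (A : poissonAlgType K) := Sl2Graded {
  sg_e : A; sg_f : A; sg_h : A;
  sg_eps : A -> K;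
  sg_ce : A -> K; sg_cf : A -> K; sg_ch : A -> K;
  sg_gr : nat -> nat -> A -> Prop;
  sg_epsP : forall c a b, sg_eps (c *: a + b) = c * sg_eps a + sg_eps b;
  sg_eps1 : sg_eps 1 = 1;
  sg_epsM : forall a b, sg_eps (a * b) = sg_eps a * sg_eps b;
  sg_eps_pbr : forall a b, sg_eps (pbr a b) = 0;
  sg_ceP : forall c a b, sg_ce (c *: a + b) = c * sg_ce a + sg_ce b;
  sg_cfP : forall c a b, sg_cf (c *: a + b) = c * sg_cf a + sg_cf b;
  sg_chP : forall c a b, sg_ch (c *: a + b) = c * sg_ch a + sg_ch b;
  sg_ceM : forall a b, sg_ce (a * b) = sg_eps a * sg_ce b + sg_eps b * sg_ce a;
  sg_cfM : forall a b, sg_cf (a * b) = sg_eps a * sg_cf b + sg_eps b * sg_cf a;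
  sg_chM : forall a b, sg_ch (a * b) = sg_eps a * sg_ch b + sg_eps b * sg_ch a;
  sg_ce_pbr : forall a b,
    sg_ce (pbr a b) = 2%:R * (sg_ch a * sg_ce b - sg_ce a * sg_ch b);
  sg_cf_pbr : forall a b,
    sg_cf (pbr a b) = 2%:R * (sg_cf a * sg_ch b - sg_ch a * sg_cf b);
  sg_ch_pbr : forall a b,
    sg_ch (pbr a b) = sg_ce a * sg_cf b - sg_cf a * sg_ce b;
  sg_pbr_ef : pbr sg_e sg_f = sg_h;
  sg_gr_e : sg_gr 2 0 sg_e;
  sg_gr_f : sg_gr 0 2 sg_f;
  sg_gr_h : sg_gr 1 1 sg_h;
  sg_coef_e : [/\ sg_ce sg_e = 1, sg_cf sg_e = 0 & sg_ch sg_e = 0];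
  sg_coef_f : [/\ sg_ce sg_f = 0, sg_cf sg_f = 1 & sg_ch sg_f = 0];
  sg_weight : forall i j a, sg_gr i j a -> pbr sg_h a = (i%:R - j%:R) *: a;
  sg_gr_pbr : forall i j k l a b, sg_gr i j a -> sg_gr k l b ->
    pbr a b = 0 \/ exists i' j',
      sg_gr i' j' (pbr a b) /\ (i' + j' + 2 = i + j + k + l)%N;
  sg_ind : forall Phi : A -> Prop, Phi 0 ->
    (forall a b, Phi a -> Phi b -> Phi (a + b)) ->
    (forall i j a, sg_gr i j a -> Phi a) -> forall a, Phi a;
  sg_eps_gr : forall i j a, sg_gr i j a -> (0 < i + j)%N -> sg_eps a = 0;
  sg_coef_gr : forall i j a, sg_gr i j a -> (i + j != 2)%N ->
    [/\ sg_ce a = 0, sg_cf a = 0 & sg_ch a = 0];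
  sg_deg0 : forall a, sg_gr 0 0 a -> a = (sg_eps a)%:A;
  sg_deg1 : forall i j a, sg_gr i j a -> (i + j = 1)%N -> a = 0;
  sg_deg2 : forall i j a, sg_gr i j a -> (i + j = 2)%N ->
    a = sg_ce a *: sg_e + sg_cf a *: sg_f + sg_ch a *: sg_h;
  sg_capelli : forall i j a, sg_gr i.+1 j a ->
    exists q r, sg_gr i j.+1 q /\
      ((i.+1 * j.+1) * (i * j))%:R *: a =
      pbr sg_e q + (sg_h * sg_h + 4%:R * sg_e * sg_f) * r
}.


(** * Symplectic coordinates on a plane and its dual *)

(** The functions on the plane and its dual are treated as an abstract Poisson
    algebra generated by canonical coordinates; [genS] is that generation,
    stated as an induction principle. Concretely [x1], [x2] are isotropic
    coordinates on the plane, and [y1], [y2] are paired with them crosswise, so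
    that [x1], [y1] and [x2], [y2] are eigenvectors of a rotation with inverse
    eigenvalues. *)
Section Coordinates.
Variables (K : numFieldType) (S : poissonAlgType K) (x1 x2 y1 y2 : S).
Hypotheses (x1x2 : pbr x1 x2 = 0) (y1y2 : pbr y1 y2 = 0).
Hypotheses (x1y1 : pbr x1 y1 = 0) (x2y2 : pbr x2 y2 = 0).
Hypotheses (x1y2 : pbr x1 y2 = 1) (x2y1 : pbr x2 y1 = 1).
Hypothesis genS : forall P : S -> Prop,
  (forall k, P k%:A) -> P x1 -> P x2 -> P y1 -> P y2 ->
  (forall a b, P a -> P b -> P (a + b)) ->
  (forall a b, P a -> P b -> P (a * b)) -> forall a, P a.
Implicit Types p q : S.

Lemma y1x1 : pbr y1 x1 = 0. Proof. by rewrite pbr_anti x1y1 oppr0. Qed.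
Lemma y2x2 : pbr y2 x2 = 0. Proof. by rewrite pbr_anti x2y2 oppr0. Qed.
Lemma y2x1 : pbr y2 x1 = -1. Proof. by rewrite pbr_anti x1y2. Qed.
Lemma y1x2 : pbr y1 x2 = -1. Proof. by rewrite pbr_anti x2y1. Qed.
Lemma x2x1 : pbr x2 x1 = 0. Proof. by rewrite pbr_anti x1x2 oppr0. Qed.
Lemma y2y1 : pbr y2 y1 = 0. Proof. by rewrite pbr_anti y1y2 oppr0. Qed.

Definition genbr := (x1x2, y1y2, x1y1, x2y2, x1y2, x2y1,
  (y1x1, y2x2, y2x1, y1x2, x2x1, y2y1, @pbr_xx K S)).

Lemma pbr_swap a b p k : pbr a b = k%:A -> pbr a (pbr b p) = pbr b (pbr a p).
Proof. by move=> ab; rewrite pbr_jac ab pbr_algleft add0r. Qed.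

Lemma swap_x2x1 p : pbr x2 (pbr x1 p) = pbr x1 (pbr x2 p).
Proof. by apply: (pbr_swap _ (k := 0)); rewrite genbr scale0r. Qed.
Lemma swap_y1x1 p : pbr y1 (pbr x1 p) = pbr x1 (pbr y1 p).
Proof. by apply: (pbr_swap _ (k := 0)); rewrite genbr scale0r. Qed.
Lemma swap_y1x2 p : pbr y1 (pbr x2 p) = pbr x2 (pbr y1 p).
Proof. by apply: (pbr_swap _ (k := -1)); rewrite genbr scaleN1r. Qed.
Lemma swap_y2x1 p : pbr y2 (pbr x1 p) = pbr x1 (pbr y2 p).
Proof. by apply: (pbr_swap _ (k := -1)); rewrite genbr scaleN1r. Qed.
Lemma swap_y2x2 p : pbr y2 (pbr x2 p) = pbr x2 (pbr y2 p).
Proof. by apply: (pbr_swap _ (k := 0)); rewrite genbr scale0r. Qed.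
Lemma swap_y2y1 p : pbr y2 (pbr y1 p) = pbr y1 (pbr y2 p).
Proof. by apply: (pbr_swap _ (k := 0)); rewrite genbr scale0r. Qed.

Definition swaps :=
  (swap_x2x1, swap_y1x1, swap_y1x2, swap_y2x1, swap_y2x2, swap_y2y1).

(** Since [pbr y2] and [pbr y1] are minus the derivatives with respect to [x1] and
    [x2], while [pbr x2] and [pbr x1] are the derivatives with respect to [y1] and
    [y2], these are the Euler operators counting the degrees in the two sets of
    variables. *)
Definition Eu p := - (x1 * pbr y2 p + x2 * pbr y1 p).
Definition Ev p := y1 * pbr x2 p + y2 * pbr x1 p.
Definition qe := x1 * x2.
Definition qf := - (y1 * y2).
Definition qh := - (x1 * y2 + x2 * y1).
(** The area form, which every orthogonal map multiplies by its determinant. *)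
Definition omega := x1 * y2 - x2 * y1.
(** Cayley's Omega operator, the determinant of the derivatives. *)
Definition cayley p := pbr x2 (pbr y1 p) - pbr x1 (pbr y2 p).

Definition expand := (pbrD, pbrN, @pbr_leibniz K S, pbrDleft, pbrNleft, pbrMleft).

Lemma omegaE : omega ^+ 2 = qh * qh + 4%:R * qe * qf.
Proof. by rewrite /omega /qh /qe /qf; ring. Qed.

Lemma pbr_ef : pbr qe qf = qh.
Proof. by rewrite /qe /qf /qh !expand !genbr; ring. Qed.

Lemma pbr_hE p : pbr qh p = Eu p - Ev p.
Proof. by rewrite /Eu /Ev /qh !expand; ring. Qed.

Lemma pbr_e_omega : pbr qe omega = 0.
Proof. by rewrite /qe /omega !expand !genbr; ring. Qed.

Lemma pbr_f_omega : pbr qf omega = 0.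
Proof. by rewrite /qf /omega !expand !genbr; ring. Qed.

(** The Capelli identity for two vectors in the plane. *)
Lemma capelli p : pbr qe (pbr qf p) + omega * cayley p = Eu (Ev p) + Eu p.
Proof.
rewrite /qe /qf /omega /cayley /Eu /Ev; rewrite !(expand, genbr, swaps).
by ring.
Qed.

Lemma EuEv p : Eu (Ev p) = Ev (Eu p).
Proof. by rewrite /Eu /Ev !(expand, genbr, swaps); ring. Qed.

(** Both sides are derivations in [p] that agree on the generators. *)
Lemma pbrE p q : pbr p q = pbr x1 p * pbr y2 q + pbr x2 p * pbr y1 q
   - pbr y2 p * pbr x1 q - pbr y1 p * pbr x2 q.
Proof.
elim/genS: p => [k|||||a b Ha Hb|a b Ha Hb].
- by rewrite !pbr_alg pbr_algleft; ring.
- by rewrite !genbr; ring.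
- by rewrite !genbr; ring.
- by rewrite !genbr; ring.
- by rewrite !genbr; ring.
- by rewrite !expand Ha Hb; ring.
- by rewrite !expand Ha Hb; ring.
Qed.

Lemma Eu_pbr p q : Eu (pbr p q) = pbr (Eu p) q + pbr p (Eu q) - pbr p q.
Proof.
rewrite [pbr p q]pbrE [pbr (Eu p) q]pbrE [pbr p (Eu q)]pbrE /Eu.
by rewrite !(expand, genbr, swaps); ring.
Qed.

Lemma Ev_pbr p q : Ev (pbr p q) = pbr (Ev p) q + pbr p (Ev q) - pbr p q.
Proof.
rewrite [pbr p q]pbrE [pbr (Ev p) q]pbrE [pbr p (Ev q)]pbrE /Ev.
by rewrite !(expand, genbr, swaps); ring.
Qed.

Lemma EuM p q : Eu (p * q) = Eu p * q + p * Eu q.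
Proof. by rewrite /Eu !expand; ring. Qed.
Lemma EvM p q : Ev (p * q) = Ev p * q + p * Ev q.
Proof. by rewrite /Ev !expand; ring. Qed.
Lemma EuD p q : Eu (p + q) = Eu p + Eu q.
Proof. by rewrite /Eu !expand; ring. Qed.
Lemma EvD p q : Ev (p + q) = Ev p + Ev q.
Proof. by rewrite /Ev !expand; ring. Qed.
Lemma EuZ k p : Eu (k *: p) = k *: Eu p.
Proof. by rewrite /Eu !pbrZ -!scalerAr -scalerDr scalerN. Qed.
Lemma EvZ k p : Ev (k *: p) = k *: Ev p.
Proof. by rewrite /Ev !pbrZ -!scalerAr -scalerDr. Qed.


Definition Euler p := Eu p + Ev p.

Lemma EulerP k p q : Euler (k *: p + q) = k *: Euler p + Euler q.
Proof. by rewrite /Euler EuD EvD EuZ EvZ addrACA -scalerDr. Qed.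

Lemma EulerM p q : Euler (p * q) = Euler p * q + p * Euler q.
Proof. by rewrite /Euler EuM EvM; ring. Qed.

Lemma Euler_lin a b c d : Euler (a *: x1 + (b *: x2 + (c *: y1 + d *: y2))) =
  a *: x1 + (b *: x2 + (c *: y1 + d *: y2)).
Proof.
have gens : [/\ Euler x1 = x1, Euler x2 = x2, Euler y1 = y1 & Euler y2 = y2].
  by split; rewrite /Euler /Eu /Ev !genbr; ring.
rewrite !EulerP -[d *: y2]addr0 EulerP; have [-> -> -> ->] := gens.
by rewrite /Euler /Eu /Ev !pbr0 !mulr0 !addr0 oppr0 addr0.
Qed.

(** The degrees are scalars because the bracket lowers them, possibly below zero;
    [gr_nat] shows that only natural numbers occur. *)
Definition gr i j p := Eu p = i *: p /\ Ev p = j *: p.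

Lemma gr0 i j : gr i j 0.
Proof. by split; rewrite scaler0 /Eu /Ev !pbr0; ring. Qed.

Lemma grD i j p q : gr i j p -> gr i j q -> gr i j (p + q).
Proof. by move=> [a b] [c d]; split; rewrite ?EuD ?EvD ?a ?b ?c ?d scalerDr. Qed.

Lemma grZ i j k p : gr i j p -> gr i j (k *: p).
Proof. by move=> [a b]; split; rewrite ?EuZ ?EvZ ?a ?b !scalerA mulrC. Qed.

Lemma grM i j k l p q : gr i j p -> gr k l q -> gr (i + k) (j + l) (p * q).
Proof.
move=> [a b] [c d]; split; rewrite ?EuM ?EvM ?a ?b ?c ?d;
by rewrite -scalerAl -scalerAr -scalerDl.
Qed.

Lemma gr_pbr i j k l p q :
  gr i j p -> gr k l q -> gr (i + k - 1) (j + l - 1) (pbr p q).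
Proof.
move=> [a b] [c d]; split; rewrite ?Eu_pbr ?Ev_pbr ?a ?b ?c ?d;
by rewrite pbrZleft pbrZ -scalerDl -scaleN1r -scalerDl.
Qed.

Lemma gr_alg k : gr 0 0 k%:A.
Proof. by split; rewrite scale0r /Eu /Ev !pbr_alg !mulr0 addr0 ?oppr0. Qed.

Lemma gr_x1 : gr 1 0 x1.
Proof. by split; rewrite ?scale0r ?scale1r /Eu /Ev !genbr; ring. Qed.
Lemma gr_x2 : gr 1 0 x2.
Proof. by split; rewrite ?scale0r ?scale1r /Eu /Ev !genbr; ring. Qed.
Lemma gr_y1 : gr 0 1 y1.
Proof. by split; rewrite ?scale0r ?scale1r /Eu /Ev !genbr; ring. Qed.
Lemma gr_y2 : gr 0 1 y2.
Proof. by split; rewrite ?scale0r ?scale1r /Eu /Ev !genbr; ring. Qed.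

Lemma gr_e : gr 2%:R 0 qe.
Proof. by have := grM gr_x1 gr_x2; rewrite addr0. Qed.

Lemma gr_f : gr 0 2%:R qf.
Proof. by have := grZ (-1) (grM gr_y1 gr_y2); rewrite scaleN1r addr0. Qed.

Lemma gr_h : gr 1 1 qh.
Proof.
have := grZ (-1) (grD (grM gr_x1 gr_y2) (grM gr_x2 gr_y1)).
by rewrite scaleN1r addr0 add0r.
Qed.

Lemma gr_lower i j p : gr i j p -> gr (i - 1) (j + 1) (pbr qf p).
Proof.
by move=> /(gr_pbr gr_f); rewrite add0r [2%:R + j](_ : _ = j + 1 + 1) ?addrK //; ring.
Qed.

Lemma gr_weight i j p : gr i j p -> pbr qh p = (i - j) *: p.
Proof. by case=> a b; rewrite pbr_hE a b scalerBl. Qed.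

Lemma gr_raise_lower i j p :
  gr i j p -> gr i j (pbr qe (pbr qf p)).
Proof.
move=> /gr_lower/(gr_pbr gr_e).
rewrite [2%:R + _ - 1](_ : _ = i); last by ring.
by rewrite add0r addrK.
Qed.

(** Applying the Capelli identity twice: on bidegree [(i, j)] it says that
    [i * (j + 1) - ad qe ad qf] is multiplication by [omega] after [cayley],
    and [omega] commutes with [ad qe] and [ad qf]. *)
Lemma capelli2 i j p (c := i * (j + 1)) (c' := (i - 1) * j) : gr i j p ->
  let q := pbr qf ((c + c') *: p - pbr qe (pbr qf p)) in
  gr (i - 1) (j + 1) q /\
  (c * c') *: p = pbr qe q + omega ^+ 2 * cayley (cayley p).
Proof.
move=> grp /=; split.
  apply/gr_lower/grD; first exact: grZ.
  by rewrite -scaleN1r; apply/grZ/gr_raise_lower.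
have cap k l u : gr k l u ->
    omega * cayley u = (k * (l + 1)) *: u - pbr qe (pbr qf u).
  move=> [a b]; apply/eqP; rewrite eq_sym subr_eq [_ + pbr qe _]addrC capelli b EuZ a.
  by rewrite scalerA -scalerDl; apply/eqP; congr (_ *: _); ring.
have grq : gr (i - 1) (j - 1) (cayley p).
  rewrite /cayley -swap_y1x2 -swap_y2x1 -scaleN1r; apply: grD; last apply: grZ.
    have := gr_pbr gr_y1 (gr_pbr gr_x2 grp).
    by rewrite !add0r [1 + i](addrC 1) addrK [1 + _](addrC 1) subrK.
  have := gr_pbr gr_y2 (gr_pbr gr_x1 grp).
  by rewrite !add0r [1 + i](addrC 1) addrK [1 + _](addrC 1) subrK.
have := cap _ _ _ grq; rewrite subrK => cap1.
rewrite expr2 -mulrA cap1 mulrBr -scalerAr.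
have -> : omega * pbr qe (pbr qf (cayley p)) = pbr qe (pbr qf (omega * cayley p)).
  by rewrite !pbr_leibniz pbr_f_omega mul0r add0r pbr_leibniz pbr_e_omega mul0r add0r.
rewrite (cap _ _ _ grp) -/c -/c'; clearbody c c'.
rewrite !(pbrB, pbrZ); set A := pbr qe _; set B := pbr qe (pbr qf A).
rewrite scalerBr scalerA scalerDl [c' * c]mulrC; set C := _ *: p.
move: (c *: A) (c' *: A) => u v.
by rewrite opprB; ring.
Qed.

(** * Splitting into bihomogeneous components *)

Definition subspace (I : S -> Prop) :=
  I 0 /\ forall k p q, I p -> I q -> I (k *: p + q).

Lemma subspaceD I p q : subspace I -> I p -> I q -> I (p + q).
Proof. by move=> [_ H] Ip Iq; rewrite -[p]scale1r; apply: H. Qed.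

Lemma subspaceZ I k p : subspace I -> I p -> I (k *: p).
Proof. by move=> [I0 H] Ip; rewrite -[k *: p]addr0; apply: H. Qed.

Lemma subspaceB I p q : subspace I -> I p -> I q -> I (p - q).
Proof. by move=> HI Ip Iq; rewrite addrC -scaleN1r; case: HI => _; apply. Qed.

Definition linear_op (th : S -> S) :=
  forall k p q, th (k *: p + q) = k *: th p + th q.

Section Eigen.
Variable th : S -> S.
Hypothesis thP : linear_op th.

Lemma linear_op0 : th 0 = 0.
Proof. by have := thP (-1) 0 0; rewrite scaler0 addr0 scaleN1r addNr. Qed.

Lemma linear_opZ k p : th (k *: p) = k *: th p.
Proof. by rewrite -[k *: p]addr0 thP linear_op0 addr0. Qed.

Lemma linear_op_sum n (x : nat -> S) :
  th (\sum_(k < n) x k) = \sum_(k < n) th (x k).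
Proof.
elim: n => [|n IH]; first by rewrite !big_ord0 linear_op0.
by rewrite !big_ord_recr /= -IH -[X in th (X + _)]scale1r thP scale1r.
Qed.

(** The operator [th - n] kills the component of eigenvalue [n] and rescales the
    others by nonzero factors, so induction on the number of components applies. *)
Lemma eigen_split (I : S -> Prop) n (x : nat -> S) :
  subspace I -> (forall p, I p -> I (th p)) ->
  (forall k, th (x k) = k%:R *: x k) ->
  I (\sum_(k < n) x k) -> forall k, (k < n)%N -> I (x k).
Proof.
move=> HI Ith; elim: n x => [|n IH] x thx Ix k; first by [].
have IHk : forall k, (k < n)%N -> I (x k).
  move=> l ln; rewrite -[x l]scale1r -(@mulVf _ (l%:R - n%:R : K)); last first.
    by rewrite subr_eq0 eqr_nat ltn_eqF.
  rewrite -scalerA; apply: subspaceZ => //.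
  apply: (IH (fun m => (m%:R - n%:R) *: x m)) => // [m|].
    by rewrite linear_opZ thx !scalerA mulrC.
  have := subspaceB HI (Ith _ Ix) (subspaceZ (n%:R) HI Ix).
  rewrite linear_op_sum scaler_sumr -sumrB big_ord_recr /= thx subrr addr0.
  by congr I; apply: eq_bigr => m _; rewrite thx -scalerBl.
rewrite ltnS leq_eqVlt => /predU1P[->|]; last exact: IHk.
have := Ix; rewrite big_ord_recr /=.
have : I (\sum_(i < n) x i).
  by apply: big_ind => [|p q Ip Iq|i _]; [case: HI|exact: subspaceD|exact: IHk].
by move=> I1 /(subspaceB HI)/(_ I1); rewrite addrAC subrr add0r.
Qed.

Hypothesis thM : forall p q, th (p * q) = th p * q + p * th q.

(** The components are the coefficients of a polynomial over [S] with value [p] at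
    [1]: such polynomials are stable under sum and product, and the eigenvalue
    condition on the coefficients is multiplicative. *)
Lemma eigen_sum :
  (forall k, th k%:A = 0) ->
  (forall g, g \in [:: x1; x2; y1; y2] -> th g = 0 \/ th g = g) ->
  forall p, exists n (x : nat -> S), p = \sum_(k < n) x k /\
    forall k, th (x k) = k%:R *: x k.
Proof.
move=> thA thg p.
suff [P P1 Pth] : exists2 P : {poly S}, P.[1] = p &
    forall k, th P`_k = k%:R *: P`_k.
  exists (size P), (fun k => P`_k); split=> //.
  rewrite -P1 horner_coef; apply: eq_bigr => i _; by rewrite expr1n mulr1.
have gen g : g \in [:: x1; x2; y1; y2] -> exists2 P : {poly S}, P.[1] = g &
    forall k, th P`_k = k%:R *: P`_k.
  case/thg => tg.
    exists g%:P; first by rewrite hornerC.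
    move=> k; rewrite coefC; case: k => [|k] /=; first by rewrite scale0r.
    by rewrite linear_op0 scaler0.
  exists (g%:P * 'X); first by rewrite hornerMX hornerC mulr1.
  move=> k; rewrite coefMX coefC; case: k => [|[|k]] /=.
  - by rewrite linear_op0 scaler0.
  - by rewrite tg scale1r.
  - by rewrite linear_op0 scaler0.
elim/genS: p => [k|||||p q [P P1 Pth] [Q Q1 Qth]|p q [P P1 Pth] [Q Q1 Qth]].
- exists (k%:A%:P); first by rewrite hornerC.
  move=> l; rewrite coefC; case: l => [|l] /=; first by rewrite scale0r.
  by rewrite linear_op0 scaler0.
- by apply: gen; rewrite !inE eqxx ?orbT.
- by apply: gen; rewrite !inE eqxx ?orbT.
- by apply: gen; rewrite !inE eqxx ?orbT.
- by apply: gen; rewrite !inE eqxx ?orbT.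
- exists (P + Q) => [|k]; first by rewrite hornerD P1 Q1.
  by rewrite coefD scalerDr -Pth -Qth -[P`_k]scale1r thP !scale1r.
exists (P * Q) => [|k]; first by rewrite hornerM P1 Q1.
rewrite coefM (linear_op_sum _ (fun i => P`_i * Q`_(k - i))) scaler_sumr.
apply: eq_bigr => i _; rewrite thM Pth Qth -scalerAl -scalerAr -scalerDl.
by rewrite -natrD subnKC // -ltnS.
Qed.

End Eigen.

Lemma Eu_lin : linear_op Eu. Proof. by move=> k p q; rewrite EuD EuZ. Qed.
Lemma Ev_lin : linear_op Ev. Proof. by move=> k p q; rewrite EvD EvZ. Qed.

(** A subspace stable under both Euler operators contains the bihomogeneous
    components of its elements. *)
Lemma bihomogeneous_ind (I Phi : S -> Prop) :
  subspace I -> (forall p, I p -> I (Eu p)) -> (forall p, I p -> I (Ev p)) ->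
  Phi 0 -> (forall p q, I p -> I q -> Phi p -> Phi q -> Phi (p + q)) ->
  (forall (i j : nat) p, I p -> gr i%:R j%:R p -> Phi p) ->
  forall p, I p -> Phi p.
Proof.
move=> HI IEu IEv Phi0 PhiD Phig p Ip.
have big n (x : nat -> S) : (forall k, (k < n)%N -> I (x k) /\ Phi (x k)) ->
    Phi (\sum_(k < n) x k).
  move=> H; suff [] : I (\sum_(k < n) x k) /\ Phi (\sum_(k < n) x k) by [].
  apply: (big_ind (fun q => I q /\ Phi q)) => [|a b [? ?] [? ?]|i _]; first by case: HI.
    by split; [apply: subspaceD|apply: PhiD].
  exact: H.
have [|g gin|n [x [pE xE]]] := eigen_sum Eu_lin EuM _ _ p.
- by move=> k; have [-> _] := gr_alg k; rewrite scale0r.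
- have := gin; rewrite !inE => /or4P[] /eqP ->.
  + by right; have [-> _] := gr_x1; rewrite scale1r.
  + by right; have [-> _] := gr_x2; rewrite scale1r.
  + by left; have [-> _] := gr_y1; rewrite scale0r.
  + by left; have [-> _] := gr_y2; rewrite scale0r.
have Ix : forall k, (k < n)%N -> I (x k).
  by apply: (eigen_split Eu_lin) => //; rewrite -pE.
rewrite pE; apply: (big n x) => i in_; split; first exact: Ix.
have [|g gin|m [z [xiE zE]]] := eigen_sum Ev_lin EvM _ _ (x i).
- by move=> k; have [_ ->] := gr_alg k; rewrite scale0r.
- have := gin; rewrite !inE => /or4P[] /eqP ->.
  + by left; have [_ ->] := gr_x1; rewrite scale0r.
  + by left; have [_ ->] := gr_x2; rewrite scale0r.
  + by right; have [_ ->] := gr_y1; rewrite scale1r.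
  + by right; have [_ ->] := gr_y2; rewrite scale1r.
pose J q := I q /\ Eu q = i%:R *: q.
have HJ : subspace J.
  split; first by split; [case: HI|rewrite scaler0 (linear_op0 Eu_lin)].
  move=> k a b [Ia Ea] [Ib Eb]; split; first by case: HI => _; apply.
  by rewrite EuD EuZ Ea Eb scalerDr !scalerA mulrC.
have Jz : forall k, (k < m)%N -> J (z k).
  apply: (eigen_split Ev_lin) => //.
    move=> q [Iq Eq]; split; first exact: IEv.
    by rewrite EuEv Eq EvZ.
  by rewrite -xiE; split; [exact: Ix|exact: xE].
rewrite xiE; apply: (big m z) => k km; have [Iz Ez] := Jz k km.
by split=> //; apply: (Phig i k).
Qed.

Lemma gr_nat i j p : gr i j p -> p != 0 ->
  exists i' j' : nat, i = i'%:R /\ j = j'%:R.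
Proof.
move: p; apply: (bihomogeneous_ind (I := gr i j)).
- by split; [exact: gr0|move=> k p q ? ?; apply: grD => //; apply: grZ].
- by move=> p [a b]; rewrite a; apply: grZ.
- by move=> p [a b]; rewrite b; apply: grZ.
- by rewrite eqxx.
- move=> p q _ _ Hp Hq pq; have [p0|] := eqVneq p 0; last exact: Hp.
  by apply: Hq; rewrite p0 add0r in pq.
move=> i' j' p [a b] [a' b'] p0; exists i', j'.
have inj (k l : K) : k *: p = l *: p -> k = l.
  move/eqP; rewrite -subr_eq0 -scalerBl scaler_eq0 (negbTE p0) orbF subr_eq0.
  by move/eqP.
by split; apply: inj; rewrite -?a -?b.
Qed.

(** * Derivatives at the origin *)

Variable eps : S -> K.
Hypothesis epsP : forall k p q, eps (k *: p + q) = k * eps p + eps q.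
Hypothesis epsM : forall p q, eps (p * q) = eps p * eps q.
Hypothesis eps_alg : forall k, eps k%:A = k.
Hypotheses (eps_x1 : eps x1 = 0) (eps_x2 : eps x2 = 0).
Hypotheses (eps_y1 : eps y1 = 0) (eps_y2 : eps y2 = 0).
Hypothesis euler0 : forall p, Euler p = 0 -> p = (eps p)%:A.

Lemma epsD p q : eps (p + q) = eps p + eps q.
Proof. by rewrite -[p]scale1r epsP mul1r scale1r. Qed.
Lemma eps0 : eps 0 = 0.
Proof. by rewrite -(scale0r 1) eps_alg. Qed.
Lemma eps1 : eps 1 = 1.
Proof. by rewrite -[1]scale1r eps_alg. Qed.
Lemma epsZ k p : eps (k *: p) = k * eps p.
Proof. by rewrite -[k *: p]addr0 epsP eps0 addr0. Qed.
Lemma epsN p : eps (- p) = - eps p.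
Proof. by rewrite -scaleN1r epsZ mulN1r. Qed.

Definition epsE := (epsD, epsN, epsM, epsZ, eps_x1, eps_x2, eps_y1, eps_y2).

Lemma eps_Eu p : eps (Eu p) = 0.
Proof. by rewrite /Eu !epsE; ring. Qed.
Lemma eps_Ev p : eps (Ev p) = 0.
Proof. by rewrite /Ev !epsE; ring. Qed.

Lemma eps_gr i j p : gr i j p -> i != 0 \/ j != 0 -> eps p = 0.
Proof.
move=> [a b] [] ne; apply/eqP.
- by have := eps_Eu p; rewrite a epsZ => /eqP; rewrite mulf_eq0 (negbTE ne).
- by have := eps_Ev p; rewrite b epsZ => /eqP; rewrite mulf_eq0 (negbTE ne).
Qed.

Lemma gr00 p : gr 0 0 p -> p = (eps p)%:A.
Proof. by move=> [a b]; apply: euler0; rewrite /Euler a b !scale0r addr0. Qed.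

(** The coefficients of [qe], [qf], [qh] in the quadratic part of an element with
    [fixed_jet]. *)
Definition coef_e p := eps (pbr y1 (pbr y2 p)).
Definition coef_f p := - eps (pbr x1 (pbr x2 p)).
Definition coef_h p := eps (pbr x1 (pbr y2 p)).

(** The conditions on the derivatives at the origin that say that the terms of
    degree at most two are a combination of [1], [qe], [qf] and [qh]. *)
Definition fixed_jet p :=
  [/\ (forall g, g \in [:: x1; x2; y1; y2] -> eps (pbr g p) = 0),
      [/\ eps (pbr x1 (pbr x1 p)) = 0, eps (pbr x1 (pbr y1 p)) = 0 &
          eps (pbr y1 (pbr y1 p)) = 0],
      [/\ eps (pbr x2 (pbr x2 p)) = 0, eps (pbr x2 (pbr y2 p)) = 0 &
          eps (pbr y2 (pbr y2 p)) = 0] &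
      eps (pbr x2 (pbr y1 p)) = eps (pbr x1 (pbr y2 p))].

Lemma fixed_jet1 p : fixed_jet p -> (eps (pbr x1 p) = 0) * (eps (pbr x2 p) = 0) *
  (eps (pbr y1 p) = 0) * (eps (pbr y2 p) = 0).
Proof. by case=> H _ _ _; rewrite !H ?inE ?eqxx ?orbT. Qed.

Lemma eps_pbr p q : fixed_jet p -> fixed_jet q -> eps (pbr p q) = 0.
Proof.
move=> /fixed_jet1 Jp /fixed_jet1 Jq; rewrite pbrE !epsE !Jp !Jq; ring.
Qed.

Lemma coef_eM p q : fixed_jet p -> fixed_jet q ->
  coef_e (p * q) = eps p * coef_e q + eps q * coef_e p.
Proof.
move=> /fixed_jet1 Jp /fixed_jet1 Jq; rewrite /coef_e !expand !epsE !Jp !Jq; ring.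
Qed.
Lemma coef_fM p q : fixed_jet p -> fixed_jet q ->
  coef_f (p * q) = eps p * coef_f q + eps q * coef_f p.
Proof.
move=> /fixed_jet1 Jp /fixed_jet1 Jq; rewrite /coef_f !expand !epsE !Jp !Jq; ring.
Qed.
Lemma coef_hM p q : fixed_jet p -> fixed_jet q ->
  coef_h (p * q) = eps p * coef_h q + eps q * coef_h p.
Proof.
move=> /fixed_jet1 Jp /fixed_jet1 Jq; rewrite /coef_h !expand !epsE !Jp !Jq; ring.
Qed.

(** The third derivatives produced by the Leibniz rule are multiplied by first
    derivatives, which vanish at the origin. *)
Lemma coef_e_pbr p q : fixed_jet p -> fixed_jet q ->
  coef_e (pbr p q) = 2%:R * (coef_h p * coef_e q - coef_e p * coef_h q).
Proof.
move=> Jp Jq; have Jp1 := fixed_jet1 Jp; have Jq1 := fixed_jet1 Jq.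
case: Jp => _ [p1 p2 p3] [p4 p5 p6] p7; case: Jq => _ [q1 q2 q3] [q4 q5 q6] q7.
rewrite /coef_e /coef_h (pbrE p q) !(expand, swaps, epsE).
by rewrite !(p1,p2,p3,p4,p5,p6,p7,q1,q2,q3,q4,q5,q6,q7,Jp1,Jq1); ring.
Qed.

Lemma coef_f_pbr p q : fixed_jet p -> fixed_jet q ->
  coef_f (pbr p q) = 2%:R * (coef_f p * coef_h q - coef_h p * coef_f q).
Proof.
move=> Jp Jq; have Jp1 := fixed_jet1 Jp; have Jq1 := fixed_jet1 Jq.
case: Jp => _ [p1 p2 p3] [p4 p5 p6] p7; case: Jq => _ [q1 q2 q3] [q4 q5 q6] q7.
rewrite /coef_f /coef_h (pbrE p q) !(expand, swaps, epsE).
by rewrite !(p1,p2,p3,p4,p5,p6,p7,q1,q2,q3,q4,q5,q6,q7,Jp1,Jq1); ring.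
Qed.

Lemma coef_h_pbr p q : fixed_jet p -> fixed_jet q ->
  coef_h (pbr p q) = coef_e p * coef_f q - coef_f p * coef_e q.
Proof.
move=> Jp Jq; have Jp1 := fixed_jet1 Jp; have Jq1 := fixed_jet1 Jq.
case: Jp => _ [p1 p2 p3] [p4 p5 p6] p7; case: Jq => _ [q1 q2 q3] [q4 q5 q6] q7.
rewrite /coef_e /coef_f /coef_h (pbrE p q) !(expand, swaps, epsE).
by rewrite !(p1,p2,p3,p4,p5,p6,p7,q1,q2,q3,q4,q5,q6,q7,Jp1,Jq1); ring.
Qed.

Lemma gr_dx1 i j p : gr i j p -> gr i (j - 1) (pbr x1 p).
Proof. by move=> /(gr_pbr gr_x1); rewrite add0r (addrC 1) addrK. Qed.
Lemma gr_dx2 i j p : gr i j p -> gr i (j - 1) (pbr x2 p).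
Proof. by move=> /(gr_pbr gr_x2); rewrite add0r (addrC 1) addrK. Qed.
Lemma gr_dy1 i j p : gr i j p -> gr (i - 1) j (pbr y1 p).
Proof. by move=> /(gr_pbr gr_y1); rewrite add0r (addrC 1) addrK. Qed.
Lemma gr_dy2 i j p : gr i j p -> gr (i - 1) j (pbr y2 p).
Proof. by move=> /(gr_pbr gr_y2); rewrite add0r (addrC 1) addrK. Qed.

Lemma fixed_jet_deg1 (i j : nat) p : fixed_jet p -> gr i%:R j%:R p ->
  (i + j = 1)%N -> p = 0.
Proof.
move=> /fixed_jet1 Jp G; case: i j G => [|[|i]] [|[|j]] //= G _.
- have := gr_dx1 G; have := gr_dx2 G; rewrite subrr.
  move=> /gr00 + /gr00; rewrite !Jp scale0r => X2 X1.
  by case: G => _; rewrite scale1r /Ev X1 X2 !mulr0 addr0.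
- have := gr_dy1 G; have := gr_dy2 G; rewrite subrr.
  move=> /gr00 + /gr00; rewrite !Jp scale0r => X2 X1.
  by case: G => + _; rewrite scale1r /Eu X1 X2 !mulr0 addr0 oppr0.
Qed.

Lemma coef_e_gr i j p : gr i j p -> i != 2%:R \/ j != 0 -> coef_e p = 0.
Proof.
move=> /gr_dy2/gr_dy1/eps_gr + ij; apply.
by case: ij => [i2|]; [left|right]; rewrite // -addrA -opprD subr_eq0.
Qed.

Lemma coef_f_gr i j p : gr i j p -> i != 0 \/ j != 2%:R -> coef_f p = 0.
Proof.
move=> /gr_dx2/gr_dx1/eps_gr + ij; rewrite /coef_f => ->; first by rewrite oppr0.
by case: ij => [i2|]; [left|right]; rewrite // -addrA -opprD subr_eq0.
Qed.

Lemma coef_h_gr i j p : gr i j p -> i != 1 \/ j != 1 -> coef_h p = 0.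
Proof.
move=> /gr_dy2/gr_dx1/eps_gr + ij; apply.
by case: ij => [i2|]; [left|right]; rewrite // subr_eq0.
Qed.

(** Euler's formula expresses [p] through its second derivatives, which are
    constants. *)
Lemma fixed_jet_deg2 (i j : nat) p : fixed_jet p -> gr i%:R j%:R p ->
  (i + j = 2)%N -> p = coef_e p *: qe + coef_f p *: qf + coef_h p *: qh.
Proof.
move=> Jp G ij; have Jp1 := fixed_jet1 Jp.
case: Jp => _ [p1 p2 p3] [p4 p5 p6] p7.
have E0 (k l : K) q : gr k l q -> k = 0 -> l = 0 -> q = (eps q)%:A.
  by move=> + k0 l0; rewrite k0 l0; apply: gr00.
have two0 : 2%:R != 0 :> K by rewrite pnatr_eq0.
have n20 : 1 != 2%:R :> K by rewrite (eqr_nat K 1 2).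
have n01 : 0 != 1 :> K by rewrite eq_sym oner_neq0.
have half q q' : 2%:R *: q = 2%:R *: q' -> q = q'.
  by move/(congr1 (fun t => 2%:R^-1 *: t)); rewrite !scalerA mulVf // !scale1r.
have {ij} : (i = 2 /\ j = 0 \/ i = 0 /\ j = 2 \/ i = 1 /\ j = 1)%N.
  by case: i j ij {G} => [|[|[|i]]] [|[|[|j]]] //= _; auto.
case=> [[iE jE]|[[iE jE]|[iE jE]]]; move: G; rewrite {}iE {}jE => G.
- rewrite (coef_f_gr G) ?(coef_h_gr G) ?(eq_sym _ 1) ?n20; try by [left|right].
  rewrite !scale0r !addr0; apply: half; case: (G) => <- _.
  have g2 := gr_dy2 G; have g1 := gr_dy1 G.
  have one : 2%:R - 1 = 1 :> K by rewrite -[1 in LHS]/(1%:R) -natrB.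
  move: g1 g2; rewrite one => g1 g2.
  have Y11 : pbr y1 (pbr y1 p) = 0.
    by rewrite (E0 _ _ _ (gr_dy1 g1)) ?subrr // p3 scale0r.
  have Y22 : pbr y2 (pbr y2 p) = 0.
    by rewrite (E0 _ _ _ (gr_dy2 g2)) ?subrr // p6 scale0r.
  have Y12 : pbr y1 (pbr y2 p) = (coef_e p)%:A.
    by rewrite (E0 _ _ _ (gr_dy1 g2)) ?subrr.
  case: g1 => + _; case: g2 => + _; rewrite !scale1r /Eu swap_y2y1 Y11 Y22 Y12.
  rewrite !mulr0 add0r addr0 => <- <-; rewrite /qe scaler_nat mulr2n -[coef_e p *: (_ * _)]mulr_algl.
  by move: (coef_e p)%:A => c; ring.
- rewrite (coef_e_gr G) ?(coef_h_gr G); try by [left|right].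
  rewrite !scale0r add0r !addr0; apply: half; case: (G) => _ <-.
  have g2 := gr_dx2 G; have g1 := gr_dx1 G.
  have one : 2%:R - 1 = 1 :> K by rewrite -[1 in LHS]/(1%:R) -natrB.
  move: g1 g2; rewrite one => g1 g2.
  have Y11 : pbr x1 (pbr x1 p) = 0.
    by rewrite (E0 _ _ _ (gr_dx1 g1)) ?subrr // p1 scale0r.
  have Y22 : pbr x2 (pbr x2 p) = 0.
    by rewrite (E0 _ _ _ (gr_dx2 g2)) ?subrr // p4 scale0r.
  have Y12 : pbr x1 (pbr x2 p) = - (coef_f p)%:A.
    by rewrite (E0 _ _ _ (gr_dx1 g2)) ?subrr // -scaleNr /coef_f opprK.
  case: g1 => _ +; case: g2 => _ +; rewrite !scale1r /Ev swap_x2x1 Y11 Y22 Y12.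
  rewrite !mulr0 add0r addr0 => <- <-; rewrite /qf scaler_nat mulr2n -[coef_f p *: (- _)]mulr_algl.
  by move: (coef_f p)%:A => c; ring.
- rewrite (coef_e_gr G) ?(coef_f_gr G); try by [left; rewrite ?oner_neq0|right; rewrite ?oner_neq0].
  rewrite !scale0r !add0r; case: (G) => + _; rewrite scale1r.
  have g2 := gr_dy2 G; have g1 := gr_dy1 G; move: g1 g2; rewrite subrr => g1 g2.
  have X1Y1 : pbr x1 (pbr y1 p) = 0.
    by rewrite (E0 _ _ _ (gr_dx1 g1)) ?subrr // p2 scale0r.
  have X2Y2 : pbr x2 (pbr y2 p) = 0.
    by rewrite (E0 _ _ _ (gr_dx2 g2)) ?subrr // p5 scale0r.
  have X1Y2 : pbr x1 (pbr y2 p) = (coef_h p)%:A.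
    by rewrite (E0 _ _ _ (gr_dx1 g2)) ?subrr.
  have X2Y1 : pbr x2 (pbr y1 p) = (coef_h p)%:A.
    by rewrite (E0 _ _ _ (gr_dx2 g1)) ?subrr // p7.
  case: g1 => _ +; case: g2 => _ +; rewrite !scale1r /Ev X1Y1 X2Y2 X1Y2 X2Y1.
  rewrite !mulr0 add0r addr0 => Y2 Y1 {1}<-.
  rewrite /Eu -Y1 -Y2 /qh -[coef_h p *: (- _)]mulr_algl.
  by move: (coef_h p)%:A => c; ring.
Qed.

(** * Monomial automorphisms *)

Definition poisson_endo (act : S -> S) :=
  [/\ linear_op act, (forall p q, act (p * q) = act p * act q) &
      (forall p q, act (pbr p q) = pbr (act p) (act q))].

(** In isotropic coordinates the rotations are diagonal and the reflections are
    antidiagonal. *)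
Definition acts_diag (act : S -> S) (a : K) :=
  [/\ act x1 = a *: x1, act x2 = a^-1 *: x2,
      act y1 = a *: y1 & act y2 = a^-1 *: y2].

Definition acts_swap (act : S -> S) (a : K) :=
  [/\ act x1 = a *: x2, act x2 = a^-1 *: x1,
      act y1 = a *: y2 & act y2 = a^-1 *: y1].

Section Endo.
Variables (act : S -> S) (a : K).
Hypotheses (endo : poisson_endo act) (a0 : a != 0).
Hypothesis monomial : acts_diag act a \/ acts_swap act a.

Lemma endoD p q : act (p + q) = act p + act q.
Proof. by case: endo => H _ _; rewrite -[p]scale1r H !scale1r. Qed.
Lemma endoN p : act (- p) = - act p.
Proof. by case: endo => H _ _; rewrite -scaleN1r (linear_opZ H) scaleN1r. Qed.
Lemma endoM p q : act (p * q) = act p * act q.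
Proof. by case: endo. Qed.
Lemma endo_pbr p q : act (pbr p q) = pbr (act p) (act q).
Proof. by case: endo. Qed.

Lemma scaleKM p q : a *: p * (a^-1 *: q) = p * q.
Proof. by rewrite -scalerAl -scalerAr scalerA mulfV // scale1r. Qed.
Lemma scaleKMV p q : a^-1 *: p * (a *: q) = p * q.
Proof. by rewrite -scalerAl -scalerAr scalerA mulVf // scale1r. Qed.

Definition endoE := (endoN, endoD, endoM, endo_pbr).

Lemma endo_efh : [/\ act qe = qe, act qf = qf & act qh = qh].
Proof.
rewrite /qe /qf /qh; case: monomial => -[X1 X2 Y1 Y2].
  by rewrite !endoE X1 X2 Y1 Y2 !(scaleKM, scaleKMV).
rewrite !endoE X1 X2 Y1 Y2 !(scaleKM, scaleKMV).
by split; rewrite ?[_ + x1 * y2]addrC // mulrC.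
Qed.

(** [omega] itself is only fixed up to sign; its square is a polynomial in the
    fixed elements [qe], [qf], [qh]. *)
Lemma endo_omega2 : act (omega ^+ 2) = omega ^+ 2.
Proof.
have [ae af ah] := endo_efh.
have -> : omega ^+ 2 = qh * qh + (qe * qf + qe * qf + (qe * qf + qe * qf)).
  by rewrite omegaE; ring.
by rewrite !endoD (endoM qh qh) (endoM qe qf) ae af ah.
Qed.

Lemma endo_Eu p : act (Eu p) = Eu (act p).
Proof.
rewrite /Eu; case: monomial => -[X1 X2 Y1 Y2];
rewrite !endoE X1 X2 Y1 Y2 !pbrZleft !(scaleKM, scaleKMV) //.
by rewrite addrC.
Qed.

Lemma endo_Ev p : act (Ev p) = Ev (act p).
Proof.
rewrite /Ev; case: monomial => -[X1 X2 Y1 Y2];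
rewrite !endoE X1 X2 Y1 Y2 !pbrZleft !(scaleKM, scaleKMV) //.
by rewrite addrC.
Qed.

End Endo.

Lemma omega_neq0 : omega != 0.
Proof.
apply: contraTneq (oner_neq0 S) => om0.
have : pbr x1 (pbr y2 omega) = -1.
  by rewrite /omega !(expand, genbr, pbr0, pbr1); ring.
rewrite om0 !pbr0 => /esym/eqP; rewrite oppr_eq0 => /eqP ->.
by rewrite eqxx.
Qed.

(** Evaluation at the origin is invariant, so a derivative of a fixed element along
    eigenvectors of [rot] vanishes there unless the eigenvalues multiply to [1].
    This leaves the mixed second derivatives, which [s] identifies in pairs. *)
Lemma fixed_jetP (rot s : S -> S) (zeta : K) p :
  poisson_endo rot -> poisson_endo s ->
  (forall q, eps (rot q) = eps q) -> (forall q, eps (s q) = eps q) ->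
  acts_diag rot zeta -> acts_swap s 1 -> zeta != 0 -> zeta ^+ 2 != 1 ->
  rot p = p -> s p = p -> fixed_jet p.
Proof.
move=> [_ _ rotp] [_ _ sp] erot es [X1 X2 Y1 Y2] [sX1 sX2 sY1 sY2] z0 z2 rp sp'.
have z1 : zeta != 1 by apply: contra z2 => /eqP ->; rewrite expr1n.
have eig1 g k : rot g = k *: g -> k != 1 -> eps (pbr g p) = 0.
  move=> gk k1; have := erot (pbr g p); rewrite rotp rp gk pbrZleft epsZ => /eqP.
  by rewrite -subr_eq0 -{2}[eps _]mul1r -mulrBl mulf_eq0 subr_eq0 (negbTE k1) => /eqP.
have eig2 g g' k : rot g = k *: g -> rot g' = k *: g' -> k ^+ 2 != 1 ->
    eps (pbr g (pbr g' p)) = 0.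
  move=> gk gk' k1; have := erot (pbr g (pbr g' p)).
  rewrite !rotp rp gk gk' !pbrZleft pbrZ !epsZ mulrA -expr2 => /eqP.
  by rewrite -subr_eq0 -{2}[eps _]mul1r -mulrBl mulf_eq0 subr_eq0 (negbTE k1) => /eqP.
have zv1 : zeta^-1 != 1 by rewrite invr_eq1.
have zv2 : zeta^-1 ^+ 2 != 1 by rewrite exprVn invr_eq1.
split; last first.
- by rewrite -(es (pbr x2 _)) !sp sp' sX2 sY1 invr1 !scale1r.
- by split; apply: (eig2 _ _ zeta^-1).
- by split; apply: (eig2 _ _ zeta).
move=> g; rewrite !inE => /or4P[] /eqP ->.
- exact: eig1 X1 z1.
- exact: eig1 X2 zv1.
- exact: eig1 Y1 z1.
- exact: eig1 Y2 zv1.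
Qed.

(** * Passage to a Poisson subalgebra *)

Variables (A : poissonAlgType K) (io : A -> S).
Hypothesis ioP : forall k a b, io (k *: a + b) = k *: io a + io b.
Hypothesis io1 : io 1 = 1.
Hypothesis ioM : forall a b, io (a * b) = io a * io b.
Hypothesis io_pbr : forall a b, io (pbr a b) = pbr (io a) (io b).
Hypothesis io_inj : injective io.
Hypothesis io_jet : forall a, fixed_jet (io a).
Hypothesis io_Eu : forall a, exists b, io b = Eu (io a).
Hypothesis io_Ev : forall a, exists b, io b = Ev (io a).
Variables (eA fA hA : A).
Hypotheses (io_e : io eA = qe) (io_f : io fA = qf) (io_h : io hA = qh).
Hypothesis io_div : forall a t, io a = omega ^+ 2 * t -> exists b, io b = t.

Lemma ioD a b : io (a + b) = io a + io b.
Proof. by rewrite -[a]scale1r ioP !scale1r. Qed.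
Lemma io0 : io 0 = 0.
Proof. by have := ioP (-1) 0 0; rewrite scaler0 addr0 scaleN1r addNr. Qed.
Lemma ioZ k a : io (k *: a) = k *: io a.
Proof. by rewrite -[k *: a]addr0 ioP io0 addr0. Qed.
Lemma ioB a b : io (a - b) = io a - io b.
Proof. by rewrite ioD -scaleN1r ioZ scaleN1r. Qed.

Lemma sub_ind (Phi : A -> Prop) : Phi 0 ->
  (forall a b, Phi a -> Phi b -> Phi (a + b)) ->
  (forall (i j : nat) a, gr i%:R j%:R (io a) -> Phi a) -> forall a, Phi a.
Proof.
move=> Phi0 PhiD Phig a.
have im p : (exists b, io b = p) -> (exists2 b, io b = p & Phi b).
  apply: (@bihomogeneous_ind (fun p => exists b, io b = p)
    (fun p => exists2 b, io b = p & Phi b)).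
  - split; first by exists 0; exact: io0.
    by move=> k _ _ [b <-] [c <-]; exists (k *: b + c).
  - by move=> _ [b <-]; apply: io_Eu.
  - by move=> _ [b <-]; apply: io_Ev.
  - by exists 0; first exact: io0.
  - move=> _ _ _ _ [b <- Pb] [c <- Pc]; exists (b + c); first exact: ioD.
    exact: PhiD.
  - by move=> i j _ [b <-] g; exists b => //; apply: Phig g.
by have [|b /io_inj <-] := im (io a); first by exists a.
Qed.

Lemma sub_gr_pbr (i j k l : nat) a b :
  gr i%:R j%:R (io a) -> gr k%:R l%:R (io b) ->
  pbr a b = 0 \/ exists i' j' : nat,
    gr i'%:R j'%:R (io (pbr a b)) /\ (i' + j' + 2 = i + j + k + l)%N.
Proof.
move=> ga gb; have := gr_pbr ga gb; rewrite -io_pbr => g.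
have [p0|p0] := eqVneq (io (pbr a b)) 0.
  by left; apply: io_inj; rewrite p0 io0.
right; have [i' [j' [iE jE]]] := gr_nat g p0; rewrite iE jE in g.
exists i', j'; split=> //; apply/eqP; rewrite -(eqr_nat K) !natrD -iE -jE.
by apply/eqP; ring.
Qed.

(** The remainder in [capelli2] is [omega ^+ 2] times an element that [io_div]
    places in the subalgebra. *)
Lemma sub_capelli (i j : nat) a : gr i.+1%:R j%:R (io a) ->
  exists q r : A, gr i%:R j.+1%:R (io q) /\
    ((i.+1 * j.+1) * (i * j))%:R *: a =
    pbr eA q + (hA * hA + 4%:R * eA * fA) * r.
Proof.
move=> g; have := capelli2 g; set c := _ * _; set c' := _ * _.
have cE : c * c' = ((i.+1 * j.+1) * (i * j))%:R.
  by rewrite /c /c' !natrM -[i.+1%:R]natr1 addrK -[j.+1%:R]natr1.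
pose q := pbr fA ((c + c') *: a - pbr eA (pbr fA a)).
have qE : io q = pbr qf ((c + c') *: io a - pbr qe (pbr qf (io a))).
  by rewrite /q !(io_pbr, ioB, ioZ) io_e io_f.
rewrite -qE cE -[i.+1%:R]natr1 addrK natr1 => -[gq E].
have [r rE] : exists r, io r = cayley (cayley (io a)).
  apply: (io_div (a := ((i.+1 * j.+1) * (i * j))%:R *: a - pbr eA q)).
  by rewrite ioB ioZ io_pbr io_e E addrC addKr.
exists q, r; split=> //; apply: io_inj.
have io4 : io 4%:R = 4%:R by rewrite !mulrSr !ioD io0 io1.
by rewrite ioD !ioM ioD !ioM io_pbr io_h io_e io_f rE io4 -omegaE ioZ.
Qed.

Lemma sub_graded : sl2_graded A.
Proof.
have jet := io_jet.
unshelve eapply (@Sl2Graded K A eA fA hA (fun a => eps (io a))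
  (fun a => coef_e (io a)) (fun a => coef_f (io a))
  (fun a => coef_h (io a)) (fun i j a => gr i%:R j%:R (io a))).
- by move=> c a b; rewrite ioP epsP.
- by rewrite io1 eps1.
- by move=> a b; rewrite ioM epsM.
- by move=> a b; rewrite io_pbr; apply: eps_pbr.
- by move=> c a b; rewrite ioP /coef_e !pbrDr epsP.
- by move=> c a b; rewrite ioP /coef_f !pbrDr epsP; ring.
- by move=> c a b; rewrite ioP /coef_h !pbrDr epsP.
- by move=> a b; rewrite ioM; apply: coef_eM.
- by move=> a b; rewrite ioM; apply: coef_fM.
- by move=> a b; rewrite ioM; apply: coef_hM.
- by move=> a b; rewrite io_pbr; apply: coef_e_pbr.
- by move=> a b; rewrite io_pbr; apply: coef_f_pbr.
- by move=> a b; rewrite io_pbr; apply: coef_h_pbr.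
- by apply: io_inj; rewrite io_pbr io_e io_f io_h; apply: pbr_ef.
- by rewrite io_e; apply: gr_e.
- by rewrite io_f; apply: gr_f.
- by rewrite io_h; apply: gr_h.
- rewrite io_e /coef_e /coef_f /coef_h /qe !(expand, genbr, pbr0, pbr1, epsE, eps0, eps1).
  by split; ring.
- rewrite io_f /coef_e /coef_f /coef_h /qf !(expand, genbr, pbr0, pbr1, epsE, eps0, eps1).
  by split; ring.
- by move=> i j a g; apply: io_inj; rewrite io_pbr io_h ioZ; apply: gr_weight.
- exact: sub_gr_pbr.
- exact: sub_ind.
- move=> i j a g ij; apply: (eps_gr g); rewrite !pnatr_eq0 -!lt0n; apply/orP.
  by rewrite -addn_gt0.
- move=> i j a g ij; split.
  + apply: (coef_e_gr g); rewrite -[0]/(0%:R) !eqr_nat; apply/orP; lia.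
  + apply: (coef_f_gr g); rewrite -[0]/(0%:R) !eqr_nat; apply/orP; lia.
  + apply: (coef_h_gr g); rewrite -[1]/(1%:R) !eqr_nat; apply/orP; lia.
- move=> a g; apply: io_inj; rewrite ioZ io1; exact: gr00.
- move=> i j a g ij; apply: io_inj; rewrite io0.
  exact: fixed_jet_deg1 (jet a) g ij.
- move=> i j a g ij; apply: io_inj; rewrite !ioD !ioZ io_e io_f io_h.
  exact: fixed_jet_deg2 (jet a) g ij.
- exact: sub_capelli.
Qed.

End Coordinates.

(** * Matrix representations of Poisson modules *)

(** A Poisson module structure on the space of columns: [rl a] is the action of [a]
    by scaling and [rd a] its action by the bracket. *)
Record mx_poisson_rep (K : fieldType) (A : poissonAlgType K) (n : nat) :=
  MxPoissonRep {
  rl : A -> 'M[K]_n.+1;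
  rd : A -> 'M[K]_n.+1;
  rlP : forall (c : K) a b, rl (c *: a + b) = c *: rl a + rl b;
  rl1 : rl 1 = 1;
  rlM : forall a b, rl (a * b) = rl a * rl b;
  rdP : forall (c : K) a b, rd (c *: a + b) = c *: rd a + rd b;
  rd_pbr : forall a b, rd (pbr a b) = rd a * rd b - rd b * rd a;
  rd_rl : forall a b, rd a * rl b = rl (pbr a b) + rl b * rd a;
  rdM : forall a b, rd (a * b) = rl a * rd b + rl b * rd a
}.

Section RepModule.
Variables (K : fieldType) (A : poissonAlgType K) (n : nat).
Variable r : mx_poisson_rep A n.

Lemma rlD a b : rl r (a + b) = rl r a + rl r b.
Proof. by rewrite -[a]scale1r rlP !scale1r. Qed.
Lemma rl0 : rl r 0 = 0.
Proof. by have := rlP r (-1) 0 0; rewrite scaler0 addr0 scaleN1r addNr. Qed.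
Lemma rlZ c a : rl r (c *: a) = c *: rl r a.
Proof. by rewrite -[c *: a]addr0 rlP rl0 addr0. Qed.
Lemma rdD a b : rd r (a + b) = rd r a + rd r b.
Proof. by rewrite -[a]scale1r rdP !scale1r. Qed.
Lemma rd0 : rd r 0 = 0.
Proof. by have := rdP r (-1) 0 0; rewrite scaler0 addr0 scaleN1r addNr. Qed.
Lemma rdZ c a : rd r (c *: a) = c *: rd r a.
Proof. by rewrite -[c *: a]addr0 rdP rd0 addr0. Qed.

(** An alias of the space of columns, indexed by the representation so that it
    determines the module structure. *)
Definition rep_module (_ : mx_poisson_rep A n) : Type := 'cV[K]_n.+1.

Local Notation M := (rep_module r).
HB.instance Definition _ := GRing.Zmodule.on M.

Definition rep_scale (a : A) (m : M) : M := rl r a *m m.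
Definition rep_pmod (a : A) (m : M) : M := rd r a *m m.

Fact rep_scaleA a b m : rep_scale a (rep_scale b m) = rep_scale (a * b) m.
Proof. by rewrite /rep_scale rlM mulmxA. Qed.
Fact rep_scale1 : left_id 1 rep_scale.
Proof. by move=> m; rewrite /rep_scale rl1 mul1mx. Qed.
Fact rep_scaleDr : right_distributive rep_scale +%R.
Proof. by move=> a m m'; rewrite /rep_scale mulmxDr. Qed.
Fact rep_scaleDl m : {morph rep_scale^~ m : a b / a + b}.
Proof. by move=> a b; rewrite /rep_scale rlD mulmxDl. Qed.

HB.instance Definition _ := GRing.Zmodule_isLmodule.Build A M
  rep_scaleA rep_scale1 rep_scaleDr rep_scaleDl.

Lemma rep_scaleE a (m : M) : a *: m = rl r a *m m :> 'cV[K]_n.+1.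
Proof. by []. Qed.

Lemma rep_alg c (m : M) : (c%:A : A) *: m = (c *: (m : 'cV[K]_n.+1)).
Proof. by rewrite rep_scaleE rlZ rl1 -scalemxAl mul1mx. Qed.

Fact rep_pmodDl (c : K) a b m :
  rep_pmod (c *: a + b) m = (c%:A : A) *: rep_pmod a m + rep_pmod b m.
Proof. by rewrite /rep_pmod rdP mulmxDl rep_alg scalemxAl. Qed.
Fact rep_pmodDr (c : K) a (m m' : M) :
  rep_pmod a ((c%:A : A) *: m + m') = (c%:A : A) *: rep_pmod a m + rep_pmod a m'.
Proof. by rewrite /rep_pmod mulmxDr !rep_alg scalemxAr. Qed.
Fact rep_pmod_pbr a b (m : M) :
  rep_pmod (pbr a b) m = rep_pmod a (rep_pmod b m) - rep_pmod b (rep_pmod a m).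
Proof. by rewrite /rep_pmod rd_pbr mulmxBl !mulmxA. Qed.
Fact rep_pmod_scale a b (m : M) :
  rep_pmod a (b *: m) = pbr a b *: m + b *: rep_pmod a m.
Proof.
by rewrite /rep_pmod [LHS]mulmxA [_ *m rl r b]rd_rl mulmxDl -[in LHS]mulmxA.
Qed.
Fact rep_pmod_mul a b (m : M) :
  rep_pmod (a * b) m = a *: rep_pmod b m + b *: rep_pmod a m.
Proof. by rewrite /rep_pmod rdM mulmxDl -2!mulmxA. Qed.

HB.instance Definition _ := Lmodule_isPoissonModule.Build K A M
  rep_pmodDl rep_pmodDr rep_pmod_pbr rep_pmod_scale rep_pmod_mul.

Lemma rep_pmodE a (m : M) : pmod a m = rd r a *m m :> 'cV[K]_n.+1.
Proof. by []. Qed.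

Lemma rep_module_dim : has_dim (rep_module r : poissonModType A) n.+1.
Proof.
exists (fun i => delta_mx i 0 : 'cV[K]_n.+1) => m.
have sumE (c : {ffun 'I_n.+1 -> K}) :
    \sum_(i < n.+1) ((c i)%:A : A) *: (delta_mx i 0 : M) =
    \col_i c i :> 'cV[K]_n.+1.
  apply/colP => k; rewrite mxE.
  transitivity ((\sum_(i < n.+1) c i *: (delta_mx i 0 : 'cV[K]_n.+1)) k 0).
    by congr (fun_of_matrix _ _ _); apply: eq_bigr => i _; rewrite rep_alg.
  rewrite summxE (bigD1 k) //= big1 => [|i ik].
    by rewrite !mxE !eqxx mulr1 addr0.
  by rewrite !mxE eq_sym (negbTE ik) mulr0.
exists [ffun i => (m : 'cV[K]_n.+1) i 0]; split.
  by rewrite sumE; apply/colP => i; rewrite !mxE ffunE.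
by move=> c' ->; rewrite sumE; apply/ffunP => i; rewrite ffunE mxE.
Qed.

End RepModule.

Section Iso.
Variables (K : fieldType) (A : poissonAlgType K).

Lemma poisson_module_iso_sym (M N : poissonModType A) :
  poisson_module_iso M N -> poisson_module_iso N M.
Proof.
case=> f [[g fK gK] fp].
have glin : linear g.
  by move=> a u v; apply: (can_inj fK); rewrite gK linearP /= !gK.
pose gl := GRing.isLinear.Build A N M *:%R g glin.
pose G : {linear N -> M} := HB.pack g gl.
exists G; split; first by exists f.
by move=> a m; apply: (can_inj fK); rewrite gK fp gK.
Qed.

Lemma poisson_module_iso_trans (L M N : poissonModType A) :
  poisson_module_iso L M -> poisson_module_iso M N -> poisson_module_iso L N.
Proof.
case=> f [fb fp] [g [gb gp]]; exists (g \o f); split; first exact: bij_comp.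
by move=> a m /=; rewrite fp gp.
Qed.

Lemma simple_iso (M N : poissonModType A) :
  poisson_module_iso M N -> simple_poisson_module M -> simple_poisson_module N.
Proof.
case=> f [[g fK gK] fp] [[m m0] sM]; split.
  by exists (f m) => fm; apply: m0; rewrite -[m]fK fm -(linear0 f) fK.
move=> P [P0 PD PZ Pp]; have [] := sM (fun m => P (f m)).
- split; first by rewrite linear0.
  + by move=> u v Pu Pv; rewrite linearD; apply: PD.
  + by move=> a u Pu; rewrite linearZ; apply: PZ.
  + by move=> a u Pu; rewrite fp; apply: Pp.
- move=> H; left=> u; rewrite -[u]gK H; split=> [->|gu].
    by rewrite linear0.
  by rewrite -[g u]fK gu -(linear0 f) fK.
- by move=> H; right=> u; rewrite -[u]gK.
Qed.

Lemma mulmx_ext n (X Y : 'M[K]_n) :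
  (forall v : 'cV[K]_n, X *m v = Y *m v) -> X = Y.
Proof.
move=> XY; apply/matrixP => i j; have := XY (delta_mx j 0).
by rewrite -!colE => /colP/(_ i); rewrite !mxE.
Qed.

Lemma has_dim_rep (N : poissonModType A) n : has_dim N n.+1 ->
  exists r : mx_poisson_rep A n, poisson_module_iso N (rep_module r).
Proof.
case=> b bP.
pose phi (v : 'cV[K]_n.+1) : N := \sum_(i < n.+1) ((v i 0)%:A : A) *: b i.
pose psi (m : N) : 'cV[K]_n.+1 := \col_i projT1 (cid (bP m)) i.
have psiK m : phi (psi m) = m.
  rewrite [RHS](projT2 (cid (bP m))).1; apply: eq_bigr => i _.
  by rewrite mxE.
have phiK v : psi (phi v) = v.
  apply/colP => i; rewrite mxE.
  have /(_ [ffun i => v i 0]) := (projT2 (cid (bP (phi v)))).2.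
  by move=> ->; rewrite ?ffunE //; apply: eq_bigr => j _; rewrite ffunE.
have phiP c u v : phi (c *: u + v) = (c%:A : A) *: phi u + phi v.
  rewrite scaler_sumr -big_split; apply: eq_bigr => i _ /=.
  by rewrite !mxE !scalerDl scalerA -scalerAl mul1r scalerA.
have psiP c m m' : psi ((c%:A : A) *: m + m') = c *: psi m + psi m'.
  by rewrite -[m in LHS]psiK -[m' in LHS]psiK -phiP phiK.
have psiD m m' : psi (m + m') = psi m + psi m'.
  by have := psiP 1 m m'; rewrite !scale1r.
pose klin (g : N -> N) :=
  forall c m m', g ((c%:A : A) *: m + m') = (c%:A : A) *: g m + g m'.
pose mxof (g : N -> N) : 'M[K]_n.+1 := \matrix_(i, j) psi (g (b j)) i 0.
have mxofE g : klin g -> forall m, mxof g *m psi m = psi (g m).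
  move=> gP m; rewrite -[m in RHS]psiK.
  have g0 : g 0 = 0.
    by have := gP (-1) 0 0; rewrite !scaleN1r oppr0 addr0 addNr.
  have psi0 : psi 0 = 0.
    by have := psiP (-1) 0 0; rewrite !scaleN1r oppr0 addr0 addNr.
  have big s : psi (g (\sum_(i <- s) ((psi m i 0)%:A : A) *: b i)) =
      \sum_(i <- s) psi m i 0 *: psi (g (b i)).
    elim: s => [|i s IH]; first by rewrite !big_nil g0 psi0.
    by rewrite !big_cons gP psiP IH.
  rewrite big; apply/colP => i; rewrite mxE summxE.
  by apply: eq_bigr => j _; rewrite !mxE mulrC.
have klin_l a : klin ( *:%R a).
  by move=> c m m'; rewrite scalerDr !scalerA mulrC.
have klin_d a : klin (pmod a).
  by move=> c m m'; rewrite pmodDr.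
have ext (X Y : 'M[K]_n.+1) : (forall m, X *m psi m = Y *m psi m) -> X = Y.
  by move=> XY; apply: mulmx_ext => v; rewrite -[v]phiK.
pose l a := mxof ( *:%R a); pose d a := mxof (pmod a).
have lE a m : l a *m psi m = psi (a *: m) by apply: mxofE.
have dE a m : d a *m psi m = psi (pmod a m) by apply: mxofE.
have psiZ c m : c *: psi m = psi ((c%:A : A) *: m).
  by have := psiP c m 0; rewrite addr0 => ->; have := psiP (-1) 0 0;
     rewrite scaler0 addr0 !scaleN1r addNr => ->; rewrite addr0.
have psiB m m' : psi (m - m') = psi m - psi m'.
  by apply/eqP; rewrite eq_sym subr_eq -psiD subrK.
have rP : { r : mx_poisson_rep A n | rl r =1 l /\ rd r =1 d }.
  unshelve eexists (@MxPoissonRep K A n l d _ _ _ _ _ _ _); last by [].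
  - by move=> c a a'; apply: ext => m; rewrite mulmxDl -scalemxAl !lE psiZ -psiD
      scalerDl scalerA mulr_algl.
  - by apply: ext => m; rewrite lE scale1r mul1mx.
  - by move=> a a'; apply: ext => m; rewrite -mulmxA !lE scalerA.
  - by move=> c a a'; apply: ext => m; rewrite mulmxDl -scalemxAl !dE psiZ -psiD
      pmodDl.
  - move=> a a'; apply: ext => m.
    by rewrite mulmxBl -!mulmxA !dE -psiB pmod_pbr.
  - move=> a a'; apply: ext => m.
    by rewrite mulmxDl -!mulmxA !(lE, dE) -psiD pmod_scale.
  - move=> a a'; apply: ext => m.
    by rewrite mulmxDl -!mulmxA !(lE, dE) -psiD pmod_mul.
case: rP => {}r [rlE rdE]; exists r.
have flin : linear (psi : N -> rep_module r).
  by move=> a m m'; rewrite psiD rep_scaleE rlE lE.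
pose gl := GRing.isLinear.Build A N (rep_module r) *:%R psi flin.
pose G : {linear N -> rep_module r} := HB.pack psi gl.
exists G; split; first by exists phi.
by move=> a m; rewrite rep_pmodE rdE dE.
Qed.

End Iso.

(** * The action on a simple module *)

Section Uniqueness.
Variables (K : numClosedFieldType) (A : poissonAlgType K) (sg : sl2_graded A).
Variables (n : nat) (r : mx_poisson_rep A n).
Hypothesis r_simple : simple_poisson_module (rep_module r : poissonModType A).
Implicit Types a b : A.

Local Notation e := (sg_e sg).
Local Notation f := (sg_f sg).
Local Notation h := (sg_h sg).
Local Notation eps := (sg_eps sg).
Local Notation gr := (sg_gr sg).
Local Notation l := (rl r).
Local Notation d := (rd r).
Local Notation casimir := (h * h + 4%:R * e * f).

Lemma rl_comm a b : GRing.comm (l a) (l b).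
Proof. by rewrite /GRing.comm -!rlM mulrC. Qed.

Lemma ad_rl a b : d a * l b - l b * d a = l (pbr a b).
Proof. by rewrite rd_rl addrK. Qed.

Lemma weight_cases i j a : gr i j a -> i <> j ->
  exists2 w, (0 < w)%N & pbr h a = w%:R *: a \/ pbr h a = - w%:R *: a.
Proof.
move=> /sg_weight ha ij; have [lt|le] := ltnP i j.
  exists (j - i)%N; first by lia.
  by right; rewrite ha natrB ?opprB // ltnW.
exists (i - j)%N; first by lia.
by left; rewrite ha natrB.
Qed.

Lemma rl_weight_nilp i j a : gr i j a -> i <> j -> mx_nilp (l a).
Proof.
move=> g ij; have [w w0 H] := weight_cases g ij.
apply: (@ad_weight_nilp _ _ (d h) _ w) => //.
by rewrite ad_rl; case: H => ->; rewrite rlZ; [left|right].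
Qed.

(** The matrices [rl r a] commute, and bracket with [rd r a] is a derivation of the
    algebra that they generate. *)
Lemma rl_ad_nilp a b : mx_nilp (l b) -> mx_nilp (l (pbr a b)).
Proof.
apply: (@ad_nilp _ _ (d a) _ _ (l (pbr a (pbr a b)))); rewrite ?ad_rl //;
exact: rl_comm.
Qed.

Lemma rl_h_nilp : mx_nilp (l h).
Proof.
rewrite -(sg_pbr_ef sg); apply: rl_ad_nilp.
by apply: rl_weight_nilp (sg_gr_f sg) _.
Qed.

Lemma rl_casimir_nilp : mx_nilp (l casimir).
Proof.
have e_nil : mx_nilp (l e) by apply: rl_weight_nilp (sg_gr_e sg) _.
rewrite rlD !rlM; apply: mx_nilpD.
- by rewrite -!rlM; apply: rl_comm.
- by apply: mx_nilpM => //; exact: rl_h_nilp.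
- rewrite -mulrA; rewrite -(rlM r e) -rlM mulrC rlM; apply: mx_nilpM.
    exact: rl_comm.
  by rewrite rlM; apply: mx_nilpM => //; apply: rl_comm.
Qed.

(** Elements of nonzero weight act nilpotently because weights are bounded. In
    weight zero the Capelli identity writes the element as a bracket of [e] with an
    element of weight [-2], up to a multiple of the casimir. *)
Lemma rl_gr_nilp i j a : gr i j a -> (0 < i + j)%N -> mx_nilp (l a).
Proof.
move=> g ij0; have [ij|/eqP ij] := eqVneq i j; last exact: rl_weight_nilp g ij.
subst j; case: i g ij0 => [|[|i]] // g _.
- rewrite (sg_deg2 g erefl) !rlD !rlZ -!rlZ.
  by repeat apply: mx_nilpD; try (rewrite -?rlD; apply: rl_comm);
     rewrite rlZ; apply: mx_nilpZ; try exact: rl_h_nilp;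
     [apply: rl_weight_nilp (sg_gr_e sg) _|apply: rl_weight_nilp (sg_gr_f sg) _].
- have [q [t [gq E]]] := sg_capelli g.
  set c := _%:R in E; have c0 : c != 0 by rewrite /c pnatr_eq0 !muln_eq0.
  rewrite -[a]scale1r -(mulVf c0) -scalerA E rlZ; apply: mx_nilpZ.
  rewrite rlD rlM; apply: mx_nilpD; first by rewrite -rlM; apply: rl_comm.
    by apply: rl_ad_nilp; apply: rl_weight_nilp gq _; lia.
  by apply: mx_nilpM rl_casimir_nilp; apply: rl_comm.
Qed.

(** The form in which simplicity is used: a submodule is a predicate on columns. *)
Lemma full_submodule (N : 'cV[K]_n.+1 -> Prop) (v : 'cV[K]_n.+1) :
  v != 0 -> N v -> N 0 -> (forall u w, N u -> N w -> N (u + w)) ->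
  (forall a u, N u -> N (l a *m u)) -> (forall a u, N u -> N (d a *m u)) ->
  forall u, N u.
Proof.
move=> v0 Nv N0 ND Nl Nd; case: r_simple => _ /(_ N) [//|H|//].
by move/H: Nv v0 => ->; rewrite eqxx.
Qed.

Lemma sg_epsD a b : eps (a + b) = eps a + eps b.
Proof. by rewrite -[a]scale1r sg_epsP mul1r scale1r. Qed.
Lemma sg_eps0 : eps 0 = 0.
Proof. by have := sg_epsP sg (-1) 0 0; rewrite scaler0 addr0 mulN1r addNr. Qed.

(** The elements vanishing at the origin act by commuting nilpotent matrices. The
    columns that they all kill form a nonzero submodule, because a bracket vanishes
    at the origin. *)
Lemma rl_eps a : l a = (eps a)%:A.
Proof.
pose F T := exists i j a, [/\ gr i j a, (0 < i + j)%N & T = l a].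
have [||v v0 vF] := @common_kernel _ _ F.
- by move=> T [i [j [b [g ij ->]]]]; apply: rl_gr_nilp g ij.
- move=> T U [i [j [b [_ _ ->]]]] [i' [j' [b' [_ _ ->]]]]; exact: rl_comm.
suff H : forall u : 'cV[K]_n.+1, forall b, l b *m u = eps b *: u.
  apply: mulmx_ext => u; rewrite H -scalemxAl; congr (_ *: _).
  by rewrite [1 *m u]mul1mx.
apply: (full_submodule v0).
- apply: (sg_ind (s := sg)) => [|b c Hb Hc|i j b g].
  + by rewrite rl0 mul0mx sg_eps0 scale0r.
  + by rewrite rlD mulmxDl Hb Hc sg_epsD scalerDl.
  + have [ij|] := posnP (i + j).
      have [i0 j0] : i = 0%N /\ j = 0%N by lia.
      subst i j; have bE := sg_deg0 g; rewrite [in l b]bE rlZ rl1 -scalemxAl.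
      by rewrite [1 *m v]mul1mx.
    move=> ij; rewrite vF; last by exists i, j, b.
    by rewrite (sg_eps_gr g ij) scale0r.
- by move=> b; rewrite mulmx0 scaler0.
- by move=> u w Hu Hw b; rewrite mulmxDr Hu Hw scalerDr.
- by move=> b u Hu c; rewrite [l b *m u]Hu -scalemxAr Hu !scalerA mulrC.
- move=> b u Hu c; rewrite mulmxA.
  have -> : l c *m d b = d b *m l c - l (pbr b c).
    by have := ad_rl b c => <-; rewrite opprB addrC subrK.
  rewrite mulmxBl -mulmxA !Hu sg_eps_pbr scale0r subr0.
  by rewrite -scalemxAr.
Qed.

Lemma rl_pos a : eps a = 0 -> l a = 0.
Proof. by move=> a0; rewrite rl_eps a0 scale0r. Qed.

Lemma rl_e : l e = 0. Proof. exact: rl_pos (sg_eps_gr (sg_gr_e sg) _). Qed.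
Lemma rl_f : l f = 0. Proof. exact: rl_pos (sg_eps_gr (sg_gr_f sg) _). Qed.
Lemma rl_h : l h = 0. Proof. exact: rl_pos (sg_eps_gr (sg_gr_h sg) _). Qed.

(** As elements vanishing at the origin scale by zero, the Leibniz rule makes the
    bracket action of their products zero. *)
Lemma rd_casimirM a : d (casimir * a) = 0.
Proof.
rewrite rdM rlD rdD !rlM !rdM !rlM rl_h rl_f rl_e.
by rewrite !(mul0r, mulr0, addr0, add0r).
Qed.

Lemma ad_rd a b : d a * d b - d b * d a = d (pbr a b).
Proof. by rewrite rd_pbr. Qed.

Lemma rd_capelli i j a q t :
  ((i.+1 * j.+1) * (i * j))%:R *: a = pbr e q + casimir * t ->
  (0 < i)%N -> (0 < j)%N ->
  exists c, d a = c *: d (pbr e q).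
Proof.
set c := _%:R => E i0 j0; exists c^-1.
have c0 : c != 0 by rewrite /c pnatr_eq0 -lt0n !muln_gt0 i0 j0.
rewrite -[a]scale1r -(mulVf c0) -scalerA E rdZ rdD rd_casimirM addr0.
by [].
Qed.

(** Modulo the square of the augmentation ideal, [rd_capelli] replaces bidegree
    [(i, j)] by [(i - 1, j + 1)]. In large degree this can be repeated until the
    weight is too negative to act. *)
Lemma rd_large : exists N, forall i j a, gr i j a -> (N <= i + j)%N -> d a = 0.
Proof.
have [W HW] := ad_weight_bounded (d h).
have wt i j a : gr i j a -> (W + j <= i)%N \/ (W + i <= j)%N -> d a = 0.
  move=> g [Wij|Wij].
    apply: (HW (i - j)%N); first by lia.
    by left; rewrite ad_rd (sg_weight g) rdZ natrB //; lia.
  apply: (HW (j - i)%N); first by lia.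
  by right; rewrite ad_rd (sg_weight g) rdZ natrB ?opprB //; lia.
exists (W + 4)%N; elim=> [|i IH] j a g Wij; first by apply: (wt _ _ _ g); lia.
have [Wj|jW] := leqP (W + j) i.+1; first by apply: (wt _ _ _ g); lia.
have [Wi|iW] := leqP (W + i.+1) j; first by apply: (wt _ _ _ g); lia.
have [q [t [gq E]]] := sg_capelli g.
have [||c ->] := rd_capelli E; try lia.
by rewrite rd_pbr (IH _ _ gq) ?mulr0 ?mul0r ?subr0 ?scaler0 //; lia.
Qed.

(** As brackets of two elements of degree [k] have degree [2 * k - 2 > k], they act
    by zero, so the elements of degree [k] act by commuting matrices. These are
    nilpotent for the same reason as in [rl_gr_nilp], and the columns that they all
    kill form a submodule. *)
Lemma rd_step k : (2 < k)%N ->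
  (forall i j a, gr i j a -> (k < i + j)%N -> d a = 0) ->
  forall i j a, gr i j a -> (i + j = k)%N -> d a = 0.
Proof.
move=> k2 Hk.
pose G a := a = 0 \/ exists i j, gr i j a /\ (i + j = k)%N.
have G_pbr i j a b : gr i j a -> (i + j = 2)%N -> G b -> G (pbr a b).
  move=> ga ij [->|[i' [j' [gb ij']]]]; first by left; rewrite pbr0.
  have [->|[i'' [j'' [g ij'']]]] := sg_gr_pbr ga gb; first by left.
  by right; exists i'', j''; split=> //; lia.
have high i j a b : gr i j a -> (2 < i + j)%N -> G b -> d (pbr a b) = 0.
  move=> ga ij [->|[i' [j' [gb ij']]]]; first by rewrite pbr0 rd0.
  have [->|[i'' [j'' [g ij'']]]] := sg_gr_pbr ga gb; first by rewrite rd0.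
  by apply: Hk g _; lia.
have Gcomm a b : G a -> G b -> GRing.comm (d a) (d b).
  move=> [->|[i [j [ga ij]]]] Gb.
    by rewrite rd0; apply: commr_sym; apply: commr0.
  by apply/eqP; rewrite -subr_eq0 ad_rd (high i j) //; lia.
have Gnilp a : G a -> mx_nilp (d a).
  move=> [->|[i [j [g ij]]]]; first by rewrite rd0; apply: mx_nilp0.
  have wt i' j' b : gr i' j' b -> i' <> j' -> mx_nilp (d b).
    move=> gb ij'; have [w w0 H] := weight_cases gb ij'.
    apply: (@ad_weight_nilp _ _ (d h) _ w) => //.
    by rewrite ad_rd; case: H => ->; rewrite rdZ; [left|right].
  have [ij'|/eqP ij'] := eqVneq i j; last exact: wt g ij'.
  subst j; case: i g ij => [|i] g ij; first by lia.
  have [q [t [gq E]]] := sg_capelli g.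
  have [||c ->] := rd_capelli E; try lia.
  have Gq : G q by right; exists i, i.+2; split=> //; lia.
  have Gz : G (pbr e q) by apply: G_pbr (sg_gr_e sg) _ _.
  have Gu : G (pbr e (pbr e q)) by apply: G_pbr (sg_gr_e sg) _ _.
  apply/mx_nilpZ/(@ad_nilp _ _ (d e) (d q) _ (d (pbr e (pbr e q)))).
  - by rewrite ad_rd.
  - by rewrite ad_rd.
  - exact: Gcomm.
  - exact: Gcomm.
  - exact: Gcomm.
  - by apply: wt gq _; lia.
have [||v v0 vF] := @common_kernel _ _ (fun T => exists2 a, G a & T = d a).
- by move=> T [a Ga ->]; apply: Gnilp.
- by move=> T U [a Ga ->] [b Gb ->]; apply: Gcomm.
suff H : forall u : 'cV[K]_n.+1, forall a, G a -> d a *m u = 0.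
  move=> i j a g ij; apply: mulmx_ext => u; rewrite mul0mx H //.
  by right; exists i, j.
apply: (full_submodule v0).
- by move=> a Ga; apply: vF; exists a.
- by move=> a Ga; rewrite mulmx0.
- by move=> u w Hu Hw a Ga; rewrite mulmxDr Hu // Hw // addr0.
- move=> b u Hu a Ga; rewrite rl_eps -scalemxAl [1 *m u]mul1mx.
  by rewrite -scalemxAr Hu // scaler0.
move=> b u Hu a Ga; rewrite mulmxA.
have -> : d a *m d b = d b *m d a - d (pbr b a).
  by rewrite rd_pbr opprB addrC subrK.
rewrite mulmxBl -mulmxA Hu // mulmx0 sub0r; apply/eqP; rewrite oppr_eq0.
apply/eqP; move: b; apply: (sg_ind (s := sg)) => [|b c Hb Hc|i j b g].
- by rewrite pbr_anti pbr0 oppr0 rd0 mul0mx.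
- by rewrite pbrDleft rdD mulmxDl Hb Hc addr0.
case: (ltngtP (i + j) 2) => ij.
- have [ij1|ij0] : (i + j = 1 \/ (i = 0 /\ j = 0))%N by lia.
    by rewrite (sg_deg1 g ij1) pbr_anti pbr0 oppr0 rd0 mul0mx.
  move: g; rewrite ij0.1 ij0.2 => /sg_deg0 ->.
  by rewrite pbr_algleft rd0 mul0mx.
- by rewrite (high _ _ _ _ g) ?mul0mx.
- by apply: Hu; apply: G_pbr g ij Ga.
Qed.

Lemma rd_high i j a : gr i j a -> (2 < i + j)%N -> d a = 0.
Proof.
have [N HN] := rd_large.
suff H m : forall i j a, gr i j a -> (2 < i + j)%N -> (N <= m + (i + j))%N ->
    d a = 0 by move=> g ij; apply: (H N _ _ _ g ij); apply: leq_addr.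
elim: m => [|m IH] {}i {}j {}a g ij Nij; first exact: HN g Nij.
apply: (rd_step ij _ g erefl) => i' j' b g' ij'.
by apply: (IH _ _ _ g'); lia.
Qed.

(** Only the quadratic part of an element acts, so the module is one of sl2. *)
Lemma rd_coef a : d a = sg_ce sg a *: d e + sg_cf sg a *: d f + sg_ch sg a *: d h.
Proof.
have D (c : A -> K) : (forall k x y, c (k *: x + y) = k * c x + c y) ->
    (c 0 = 0) * (forall x y, c (x + y) = c x + c y).
  move=> cP; split; last by move=> x y; rewrite -[x]scale1r cP mul1r scale1r.
  by have := cP (-1) 0 0; rewrite scaler0 addr0 mulN1r addNr.
have De := D _ (sg_ceP sg); have Df := D _ (sg_cfP sg); have Dh := D _ (sg_chP sg).
move: a; apply: (sg_ind (s := sg)) => [|a b Ha Hb|i j a g].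
- by rewrite De Df Dh rd0 !scale0r !addr0.
- rewrite rdD Ha Hb De Df Dh !scalerDl addrACA; congr (_ + _).
  exact: addrACA.
case: (ltngtP (i + j) 2) => ij; last first.
- by rewrite [in LHS](sg_deg2 g ij) !rdD !rdZ.
- have [|-> -> ->] := sg_coef_gr g; first by lia.
  by rewrite (rd_high g ij) !scale0r !addr0.
have [|-> -> ->] := sg_coef_gr g; first by lia.
rewrite !scale0r !addr0.
have [ij1|ij0] : (i + j = 1 \/ (i = 0 /\ j = 0))%N by lia.
  by rewrite (sg_deg1 g ij1) rd0.
move: g; rewrite ij0.1 ij0.2 => /sg_deg0 ->; rewrite rdZ.
have := rdM r 1 1; rewrite mulr1 rl1 mul1r => /eqP.
by rewrite -subr_eq0 opprD addrA subrr add0r oppr_eq0 => /eqP ->; rewrite scaler0.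
Qed.

End Uniqueness.

(** * The standard representations *)

Section StandardSl2.
Variables (K : numFieldType) (n : nat).
Implicit Types u w : 'cV[K]_n.+1.

(** Coordinates extended by zero to all natural indices, so that the relations below
    need no boundary cases at the top. *)
Definition coord_at u (k : nat) : K :=
  if insub k is Some i then u i 0 else 0.

Lemma coord_at_ord u (i : 'I_n.+1) : coord_at u i = u i 0.
Proof. by rewrite /coord_at valK. Qed.

Lemma coord_at_out u k : (n < k)%N -> coord_at u k = 0.
Proof. by move=> nk; rewrite /coord_at insubF // ltnNge nk. Qed.

Lemma coord_atP u w : (forall k, (k <= n)%N -> coord_at u k = coord_at w k) -> u = w.
Proof.
move=> uw; apply/colP => i; rewrite -!coord_at_ord uw //.
by rewrite -ltnS.
Qed.

Lemma coord_atD u w k : coord_at (u + w) k = coord_at u k + coord_at w k.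
Proof. by rewrite /coord_at; case: insub => [i|]; rewrite ?mxE ?addr0. Qed.

Lemma coord_atZ c u k : coord_at (c *: u) k = c * coord_at u k.
Proof. by rewrite /coord_at; case: insub => [i|]; rewrite ?mxE ?mulr0. Qed.

Lemma coord_atN u k : coord_at (- u) k = - coord_at u k.
Proof. by rewrite -scaleN1r coord_atZ mulN1r. Qed.

(** The irreducible representation of dimension [n + 1], in the basis of the images
    of a highest weight vector under the powers of the lowering operator. *)
Definition sl2_e : 'M[K]_n.+1 :=
  \matrix_(i, j) if (j == i.+1 :> nat) then i.+1%:R * (n%:R - i%:R) else 0.
Definition sl2_f : 'M[K]_n.+1 := \matrix_(i, j) (i == j.+1 :> nat)%:R.
Definition sl2_h : 'M[K]_n.+1 :=
  \matrix_(i, j) if i == j then n%:R - (i.*2)%:R else 0.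

Lemma sl2_eE u k : coord_at (sl2_e *m u) k =
  k.+1%:R * (n%:R - k%:R) * coord_at u k.+1.
Proof.
have [nk|kn] := ltnP n k; first by rewrite !coord_at_out ?mulr0 // ltnW.
rewrite -ltnS in kn; rewrite -[k in LHS]/(val (Ordinal kn)) coord_at_ord mxE.
have [kn1|nk1] := ltnP k.+1 n.+1.
  rewrite (bigD1 (Ordinal kn1)) //= big1 ?addr0 => [|j jk].
    by rewrite mxE eqxx -coord_at_ord.
  by rewrite mxE; case: eqP => [E|]; rewrite ?mul0r //; case/eqP: jk; apply/val_inj.
rewrite [coord_at u _]coord_at_out ?mulr0 // big1 // => j _.
by rewrite mxE /= ifF ?mul0r //; apply/eqP; have := ltn_ord j; lia.
Qed.

Lemma sl2_fE u k : (k <= n)%N ->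
  coord_at (sl2_f *m u) k = if k is k'.+1 then coord_at u k' else 0.
Proof.
move=> kn; rewrite -ltnS in kn.
rewrite -[k in LHS]/(val (Ordinal kn)) coord_at_ord mxE.
case: k kn => [|k] kn; first by rewrite big1 // => j _; rewrite mxE mul0r.
rewrite (bigD1 (Ordinal (ltnW kn))) //= big1 ?addr0 => [|j jk].
  by rewrite mxE eqxx mul1r -coord_at_ord.
rewrite mxE /=; case: eqP => [[E]|]; rewrite ?mul0r //.
by case/eqP: jk; apply/val_inj.
Qed.

Lemma sl2_hE u k : coord_at (sl2_h *m u) k = (n%:R - (k.*2)%:R) * coord_at u k.
Proof.
have [nk|kn] := ltnP n k; first by rewrite !coord_at_out ?mulr0.
rewrite -ltnS in kn.
rewrite -[k in LHS]/(val (Ordinal kn)) coord_at_ord mxE.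
rewrite (bigD1 (Ordinal kn)) //= big1 ?addr0 => [|j jk].
  by rewrite mxE eqxx -coord_at_ord.
by rewrite mxE eq_sym (negbTE jk) mul0r.
Qed.

Lemma sl2_ef : sl2_e * sl2_f - sl2_f * sl2_e = sl2_h.
Proof.
apply: mulmx_ext => u; apply: coord_atP => k kn.
rewrite mulmxBl -!mulmxA coord_atD coord_atN sl2_hE sl2_fE // sl2_eE.
have -> : k.+1%:R * (n%:R - k%:R) * coord_at (sl2_f *m u) k.+1 =
    k.+1%:R * (n%:R - k%:R) * coord_at u k.
  move: kn; rewrite leq_eqVlt => /predU1P[->|kn]; last by rewrite sl2_fE.
  by rewrite subrr !(mulr0, mul0r).
case: k kn => [|k] kn; first by rewrite -muln2 natrM; ring.
by rewrite sl2_eE -muln2 natrM; ring.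
Qed.

Lemma sl2_he : sl2_h * sl2_e - sl2_e * sl2_h = 2%:R *: sl2_e.
Proof.
apply: mulmx_ext => u; apply: coord_atP => k kn.
rewrite mulmxBl -scalemxAl -!mulmxA coord_atD coord_atN coord_atZ.
by rewrite !(sl2_hE, sl2_eE) -!muln2 !natrM; ring.
Qed.

Lemma sl2_hf : sl2_h * sl2_f - sl2_f * sl2_h = - (2%:R *: sl2_f).
Proof.
apply: mulmx_ext => u; apply: coord_atP => k kn.
rewrite mulmxBl mulNmx -scalemxAl -!mulmxA coord_atD !coord_atN coord_atZ.
rewrite sl2_hE !sl2_fE //; case: k kn => [|k] kn; first by ring.
by rewrite !sl2_hE -!muln2 !natrM; ring.
Qed.

End StandardSl2.

Section StandardRep.
Variables (K : numFieldType) (A : poissonAlgType K) (sg : sl2_graded A) (n : nat).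

Local Notation E := (sl2_e K n).
Local Notation F := (sl2_f K n).
Local Notation H := (sl2_h K n).
Local Notation eps := (sg_eps sg).
Local Notation ce := (sg_ce sg).
Local Notation cf := (sg_cf sg).
Local Notation ch := (sg_ch sg).

Definition std_l (a : A) : 'M[K]_n.+1 := (eps a)%:A.
Definition std_d (a : A) : 'M[K]_n.+1 := ce a *: E + cf a *: F + ch a *: H.

Fact std_lP (c : K) a b : std_l (c *: a + b) = c *: std_l a + std_l b.
Proof. by rewrite /std_l sg_epsP scalerDl scalerA. Qed.
Fact std_l1 : std_l 1 = 1.
Proof. by rewrite /std_l sg_eps1 scale1r. Qed.
Fact std_lM a b : std_l (a * b) = std_l a * std_l b.
Proof. by rewrite /std_l sg_epsM -scalerAl mul1r scalerA. Qed.
Fact std_dP (c : K) a b : std_d (c *: a + b) = c *: std_d a + std_d b.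
Proof.
rewrite /std_d sg_ceP sg_cfP sg_chP.
by apply/matrixP => i j; rewrite !mxE; ring.
Qed.
Fact std_d_pbr a b : std_d (pbr a b) = std_d a * std_d b - std_d b * std_d a.
Proof.
rewrite /std_d sg_ce_pbr sg_cf_pbr sg_ch_pbr.
rewrite !(mulrDl, mulrDr) -!(scalerAl, scalerAr) !scalerA.
have -> : E * F = F * E + H by rewrite -sl2_ef addrC subrK.
have -> : H * E = E * H + 2%:R *: E by rewrite -sl2_he addrC subrK.
have -> : H * F = F * H - 2%:R *: F by rewrite -sl2_hf addrC subrK.
move: (E * E) (F * E) (E * H) (F * F) (F * H) (H * H) E F H.
move=> x1 x2 x3 x4 x5 x6 x7 x8 x9.
by apply/matrixP => i j; rewrite !mxE; ring.
Qed.
Fact std_d_l a b : std_d a * std_l b = std_l (pbr a b) + std_l b * std_d a.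
Proof.
rewrite /std_l sg_eps_pbr scale0r add0r -scalerAl -scalerAr mulr1 mul1r.
by [].
Qed.
Fact std_dM a b : std_d (a * b) = std_l a * std_d b + std_l b * std_d a.
Proof.
rewrite /std_d /std_l sg_ceM sg_cfM sg_chM -!scalerAl !mul1r.
by apply/matrixP => i j; rewrite !mxE; ring.
Qed.

Definition std_rep : mx_poisson_rep A n :=
  MxPoissonRep std_lP std_l1 std_lM std_dP std_d_pbr std_d_l std_dM.

Lemma std_rep_e : rd std_rep (sg_e sg) = E.
Proof.
by rewrite /= /std_d; have [-> -> ->] := sg_coef_e sg; rewrite scale1r !scale0r !addr0.
Qed.
Lemma std_rep_f : rd std_rep (sg_f sg) = F.
Proof.
by rewrite /= /std_d; have [-> -> ->] := sg_coef_f sg; rewrite scale1r !scale0r addr0 add0r.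
Qed.

(** Raising a nonzero vector as often as possible gives a multiple of the highest
    weight vector, and lowering that one gives the whole basis. *)
Lemma std_rep_simple :
  simple_poisson_module (rep_module std_rep : poissonModType A).
Proof.
split.
  exists (delta_mx 0 0 : 'cV[K]_n.+1) => /matrixP/(_ 0 0); rewrite !mxE !eqxx.
  by move/eqP; rewrite oner_eq0.
move=> N [N0 ND Nl Nd].
have NZ (c : K) (u : 'cV[K]_n.+1) : N u -> N (c *: u).
  move=> /(Nl c%:A); rewrite rep_scaleE /= /std_l.
  have -> : eps c%:A = c.
    have e0 : eps 0 = 0 by have := sg_epsP sg (-1) 0 0; rewrite scaler0 addr0 mulN1r addNr.
    by rewrite -[c%:A]addr0 sg_epsP sg_eps1 e0 mulr1 addr0.
  by rewrite -scalemxAl [1 *m u]mul1mx.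
have NE (u : 'cV[K]_n.+1) : N u -> N (E *m u).
  by move=> /(Nd (sg_e sg)); rewrite rep_pmodE std_rep_e.
have NF (u : 'cV[K]_n.+1) : N u -> N (F *m u).
  by move=> /(Nd (sg_f sg)); rewrite rep_pmodE std_rep_f.
have [[u [Nu u0]]|none] := pselect (exists u, N u /\ u <> 0); last first.
  left=> m; split=> [Nm|->//]; apply: contrapT => m0; apply: none; by exists m.
right.
pose ek k : 'cV[K]_n.+1 := \col_(i < n.+1) (i == k :> nat)%:R.
have ekE k j : (j <= n)%N -> coord_at (ek k) j = (j == k)%:R.
  by rewrite -ltnS => jn; rewrite -[j in LHS]/(val (Ordinal jn)) coord_at_ord mxE.
have Ne0 : N (ek 0%N).
  have top k : forall w : 'cV[K]_n.+1, N w -> coord_at w k != 0 ->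
      (forall j, (k < j)%N -> coord_at w j = 0) -> N (ek 0%N).
    elim: k => [|k IH] w Nw wk whigh.
      suff -> : ek 0%N = (coord_at w 0)^-1 *: w by apply: NZ.
      apply: coord_atP => j jn; rewrite ekE // coord_atZ.
      case: j jn => [|j] jn; first by rewrite eqxx mulVf.
      by rewrite (whigh j.+1) // mulr0.
    apply: (IH (E *m w)); first exact: NE.
      rewrite sl2_eE; apply: mulf_neq0 => //.
      apply: mulf_neq0; rewrite ?pnatr_eq0 // subr_eq0 eqr_nat.
      apply: contra wk => /eqP nk; rewrite coord_at_out //; lia.
    by move=> j kj; rewrite sl2_eE whigh ?mulr0.
  have [k uk kmax] : exists2 k, coord_at u k != 0 &
      forall j, (k < j)%N -> coord_at u j = 0.
    have exk : exists k, coord_at u k != 0.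
      apply: contrapT => /forallNP H0; apply: u0; apply: coord_atP => k kn.
      have := H0 k; move=> /negP; rewrite negbK => /eqP ->.
      by rewrite -(scale0r (ek 0%N)) coord_atZ mul0r.
    have bnd k : coord_at u k != 0 -> (k <= n)%N.
      by rewrite leqNgt; apply: contra => nk; rewrite coord_at_out.
    have [k uk kmax] := ex_maxnP exk bnd; exists k => // j kj.
    by apply/eqP; apply: contraTT kj => /kmax; rewrite leqNgt.
  exact: top k u Nu uk kmax.
have Nek k : (k <= n)%N -> N (ek k).
  elim: k => // k IH kn; suff -> : ek k.+1 = F *m ek k by apply/NF/IH/ltnW.
  apply: coord_atP => j jn; rewrite ekE // sl2_fE //.
  by case: j jn => [|j] jn //; rewrite ekE // ltnW.
move=> m.
have -> : m = \sum_(k < n.+1) coord_at m k *: ek k :> 'cV[K]_n.+1.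
  apply/colP => i; rewrite summxE (bigD1 i) //= big1 ?addr0 => [|j ji].
    by rewrite !mxE eqxx mulr1 coord_at_ord.
  by rewrite !mxE eq_sym -val_eqE /= in ji *; rewrite (negbTE ji) mulr0.
apply: (big_ind (N : 'cV[K]_n.+1 -> Prop)) => //.
by move=> i _; apply/NZ/Nek; rewrite -ltnS.
Qed.

End StandardRep.

(** * Highest weight vectors *)

Section HighestWeight.
Variables (K : numClosedFieldType) (A : poissonAlgType K) (sg : sl2_graded A).
Variables (n : nat) (r : mx_poisson_rep A n).
Hypothesis r_simple : simple_poisson_module (rep_module r : poissonModType A).

Local Notation E := (rd r (sg_e sg)).
Local Notation F := (rd r (sg_f sg)).
Local Notation H := (rd r (sg_h sg)).

Lemma rd_ef : E * F - F * E = H.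
Proof. by rewrite ad_rd sg_pbr_ef. Qed.

Lemma rd_he : H * E - E * H = 2%:R *: E.
Proof. by rewrite ad_rd (sg_weight (sg_gr_e sg)) subr0 rdZ. Qed.

Lemma rd_hf : H * F - F * H = - 2%:R *: F.
Proof. by rewrite ad_rd (sg_weight (sg_gr_f sg)) sub0r rdZ. Qed.

(** Apply the nilpotent raising operator to an eigenvector of [H] until just before
    it vanishes. *)
Lemma highest_weight : exists (v : 'cV[K]_n.+1) (mu : K),
  [/\ v != 0, E *m v = 0 & H *m v = mu *: v].
Proof.
have [mu] := eigenvalue_closed H^T (ltn0Sn n).
case/eigenvalueP=> w wH w0.
have {wH} Hw : H *m w^T = mu *: w^T.
  by apply: trmx_inj; rewrite trmx_mul trmxK wH linearZ /= trmxK.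
have HEw k : H *m (E ^+ k *m w^T) = (mu + (k.*2)%:R) *: (E ^+ k *m w^T).
  elim: k => [|k IH]; first by rewrite expr0 addr0 [1 *m _]mul1mx.
  have HE : H *m E = E *m H + 2%:R *: E.
    by rewrite -[2%:R *: E]rd_he addrC subrK.
  rewrite exprS -mulmxA [LHS]mulmxA HE mulmxDl -mulmxA IH.
  rewrite -scalemxAr -scalemxAl -scalerDl doubleS.
  by congr (_ *: _); rewrite -[k.*2.+2]addn2 (natrD _ _ 2) [RHS]addrA.
have [N EN] : mx_nilp E.
  by apply: (@ad_weight_nilp _ _ H _ 2) => //; left; rewrite rd_he.
have exk : exists k, E ^+ k *m w^T == 0 by exists N; rewrite EN mul0mx.
have [[|k] /eqP Ek kmin] := ex_minnP exk.
  by move: w0; rewrite -trmx_eq0 -[w^T]mul1mx Ek eqxx.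
exists (E ^+ k *m w^T), (mu + (k.*2)%:R); split=> //.
  by apply/negP => /kmin; rewrite ltnn.
by rewrite mulmxA -[E *m _]exprS.
Qed.

(** The nonzero vectors among [F ^+ k *m v0] are independent, since a power of [F]
    isolates the lowest coefficient of a relation, and span a submodule; so there
    are [n + 1] of them. The relation [E *m v n.+1 = 0] then forces the highest weight
    to be [n]. *)
Lemma sl2_classification : exists2 P : 'M[K]_n.+1, P \in unitmx &
  [/\ E *m P = P *m sl2_e K n, F *m P = P *m sl2_f K n & H *m P = P *m sl2_h K n].
Proof.
have [v0 [mu [v00 Ev0 Hv0]]] := highest_weight.
pose v k : 'cV[K]_n.+1 := F ^+ k *m v0.
have Fv k : F *m v k = v k.+1 by rewrite /v mulmxA -[F *m _]exprS.
have Fkv j k : F ^+ j *m v k = v (j + k)%N by rewrite /v exprD -mulmxA.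
have Hv k : H *m v k = (mu - (k.*2)%:R) *: v k.
  elim: k => [|k IH]; first by rewrite /v expr0 subr0 [1 *m _]mul1mx.
  have HF : H *m F = F *m H - 2%:R *: F.
    by rewrite -scaleNr -[_ *: F]rd_hf addrC subrK.
  rewrite -Fv mulmxA HF mulmxBl -mulmxA IH -scalemxAr -scalemxAl -scalerBl.
  by congr (_ *: _); rewrite doubleS -[k.*2.+2]addn2 (natrD _ _ 2) [in RHS]opprD [RHS]addrA.
have Ev k : E *m v k.+1 = (k.+1%:R * (mu - k%:R)) *: v k.
  have EF : E *m F = F *m E + H by rewrite -rd_ef addrC subrK.
  elim: k => [|k IH].
    rewrite -Fv mulmxA EF mulmxDl -mulmxA Hv /v expr0 [1 *m _]mul1mx Ev0 mulmx0.
    by rewrite add0r mul1r.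
  rewrite -Fv mulmxA EF mulmxDl -mulmxA IH Hv -scalemxAr Fv -scalerDl.
  by congr (_ *: _); rewrite -muln2 !natrM; ring.
have [N FN] : mx_nilp F.
  by apply: (@ad_weight_nilp _ _ H _ 2) => //; right; rewrite rd_hf.
have exk : exists k, v k == 0 by exists N; rewrite /v FN mul0mx.
have [s /eqP vs smin] := ex_minnP exk.
have vge k : (s <= k)%N -> v k = 0.
  by move=> sk; rewrite /v -(subnK sk) exprD -mulmxA [F ^+ s *m v0]vs mulmx0.
have vlt k : (k < s)%N -> v k != 0.
  by rewrite ltnNge; apply: contra => /smin.
case: s vs {smin exk} vge vlt => [|s] vs vge vlt.
  by have := vge 0%N (leqnn 0); rewrite /v expr0 [1 *m _]mul1mx => v0E; rewrite v0E eqxx in v00.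
pose Q : 'M[K]_(s.+1, n.+1) := \matrix_i (v i)^T.
have free : row_free Q.
  apply/inj_row_free => c cQ.
  have sum0 : \sum_(i < s.+1) c 0 i *: v i = 0.
    apply: trmx_inj; rewrite trmx0 -cQ mulmx_sum_row linear_sum /=.
    by apply: eq_bigr => i _; rewrite linearZ /= rowK.
  have c0 k : forall i : 'I_s.+1, (i < k)%N -> c 0 i = 0.
    elim: k => [|k IH] i //; rewrite ltnS leq_eqVlt => /predU1P[ik|]; last exact: IH.
    have := congr1 (mulmx (F ^+ (s - k))) sum0.
    rewrite mulmx0 mulmx_sumr (bigD1 i) //= big1 => [|j ji].
      rewrite addr0 -scalemxAr Fkv ik subnK; last by rewrite -ik -ltnS.
      by move/eqP; rewrite scaler_eq0 (negbTE (vlt s _)) // orbF => /eqP.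
    rewrite -scalemxAr; have [jk|] := ltnP j k; first by rewrite IH ?scale0r.
    rewrite leq_eqVlt => /predU1P[kj|kj].
      by case/eqP: ji; apply/val_inj; rewrite /= -kj ik.
    by rewrite Fkv vge ?scaler0 //; have := ltn_ord i; lia.
  by apply/rowP => i; rewrite mxE (c0 s.+1).
have Qv k : ((v k)^T <= Q)%MS.
  have [sk|ks] := leqP s.+1 k; first by rewrite vge // trmx0 sub0mx.
  by rewrite -[k]/(val (Ordinal ks)) -(rowK (fun i : 'I_s.+1 => (v i)^T)) row_sub.
have Qst (M : 'M[K]_n.+1) : (forall k, ((M *m v k)^T <= Q)%MS) ->
    forall u : 'cV[K]_n.+1, (u^T <= Q)%MS -> ((M *m u)^T <= Q)%MS.
  move=> Mv u /submxP[c uc]; rewrite trmx_mul uc -mulmxA.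
  apply/(submx_trans (submxMl _ _))/row_subP => i.
  by rewrite row_mul rowK -trmx_mul.
have QE : forall u : 'cV[K]_n.+1, (u^T <= Q)%MS -> ((E *m u)^T <= Q)%MS.
  apply: Qst => -[|k]; last by rewrite Ev linearZ /= scalemx_sub.
  by rewrite /v expr0 [1 *m _]mul1mx Ev0 trmx0 sub0mx.
have QF : forall u : 'cV[K]_n.+1, (u^T <= Q)%MS -> ((F *m u)^T <= Q)%MS.
  by apply: Qst => k; rewrite Fv.
have QH : forall u : 'cV[K]_n.+1, (u^T <= Q)%MS -> ((H *m u)^T <= Q)%MS.
  by apply: Qst => k; rewrite Hv linearZ /= scalemx_sub.
have full : row_full Q.
  rewrite -sub1mx; apply/row_subP => i; rewrite -[row i _]trmxK.
  apply: (full_submodule r_simple v00 (N := fun u => (u^T <= Q)%MS)).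
  - by have := Qv 0%N; rewrite /v expr0 [1 *m _]mul1mx.
  - by rewrite trmx0 sub0mx.
  - by move=> u w Qu Qw; rewrite linearD /= addmx_sub.
  - move=> a u Qu; rewrite (rl_eps sg r_simple) -scalemxAl [1 *m u]mul1mx.
    by rewrite linearZ /= scalemx_sub.
  - move=> a u Qu; rewrite (rd_coef sg r_simple) !mulmxDl -!scalemxAl !linearD /=.
    by rewrite !addmx_sub // linearZ /= scalemx_sub // ?QE ?QF ?QH.
have sn : s = n.
  by apply: succn_inj; move: free full => /eqP fr /eqP fl; rewrite -[LHS]fr -[RHS]fl.
subst s; have muE : mu = n%:R.
  have := Ev n; rewrite vs mulmx0 => /esym/eqP.
  rewrite scaler_eq0 (negbTE (vlt n _)) // orbF mulf_eq0 pnatr_eq0 /=.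
  by rewrite subr_eq0 => /eqP.
have PE u : Q^T *m u = \sum_(k < n.+1) coord_at u k *: v k.
  rewrite -[Q^T *m u]trmxK trmx_mul trmxK mulmx_sum_row linear_sum /=.
  by apply: eq_bigr => i _; rewrite linearZ /= rowK trmxK mxE coord_at_ord.
exists Q^T; first by rewrite unitmx_tr -row_free_unit.
split; apply: mulmx_ext => u; rewrite -!mulmxA !PE.
- rewrite mulmx_sumr big_ord_recl /= -scalemxAr {1}/v expr0 [1 *m _]mul1mx Ev0.
  rewrite scaler0 add0r [RHS]big_ord_recr /= sl2_eE subrr mulr0 mul0r scale0r addr0.
  apply: eq_bigr => i _; rewrite -scalemxAr Ev scalerA sl2_eE muE.
  by congr (_ *: _); rewrite mulrC.
- rewrite mulmx_sumr [RHS]big_ord_recl /= sl2_fE // scale0r add0r.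
  rewrite big_ord_recr /= -scalemxAr Fv vs scaler0 addr0.
  by apply: eq_bigr => i _; rewrite -scalemxAr Fv sl2_fE.
- rewrite mulmx_sumr; apply: eq_bigr => i _.
  by rewrite -scalemxAr Hv scalerA sl2_hE muE mulrC.
Qed.

Lemma rep_std_iso : poisson_module_iso (rep_module r : poissonModType A)
  (rep_module (std_rep sg n)).
Proof.
have [P Pu [EP FP HP]] := sl2_classification.
apply: poisson_module_iso_sym.
pose g (u : rep_module (std_rep sg n)) : rep_module r := P *m (u : 'cV[K]_n.+1).
have glin : linear g.
  move=> a u w; rewrite /g mulmxDr !rep_scaleE (rl_eps sg r_simple) /= /std_l.
  by rewrite -!scalemxAl -scalemxAr [1 *m _ in LHS]mul1mx [1 *m _]mul1mx.
pose gl := GRing.isLinear.Build A _ _ *:%R g glin.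
pose G : {linear rep_module (std_rep sg n) -> rep_module r} := HB.pack g gl.
exists G; split.
  exists (fun u => invmx P *m (u : 'cV[K]_n.+1)) => u; first exact: mulKmx.
  exact: mulKVmx.
move=> a u; suff: P *m (rd (std_rep sg n) a *m u) = rd r a *m (P *m u) by [].
rewrite (rd_coef sg r_simple) /= /std_d !mulmxA; congr (_ *m _).
by rewrite mulmxDr !mulmxDl mulmxDr -!scalemxAr -!scalemxAl EP FP HP.
Qed.

End HighestWeight.

(** Both halves of the classification: the standard representation exists and is the
    only simple module of its dimension. *)
Lemma sl2_graded_homogeneous (K : numClosedFieldType) (A : poissonAlgType K) :
  sl2_graded A -> one_homogeneous A.
Proof.
move=> sg [//|n] _; exists (rep_module (std_rep sg n)); split.
- exact: std_rep_simple.
- exact: rep_module_dim.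
- move=> N sN /has_dim_rep[r Nr].
  have sr := simple_iso Nr sN.
  exact: poisson_module_iso_trans Nr (rep_std_iso sg sr).
Qed.

(** * Invariants of a monomial group *)

(** A derivation fixing the variables multiplies each monomial by its degree. *)
Lemma euler_mcoeff (K : fieldType) n (th : {mpoly K[n]} -> {mpoly K[n]}) :
  (forall k p q, th (k *: p + q) = k *: th p + th q) ->
  (forall p q, th (p * q) = th p * q + p * th q) ->
  (forall i, th 'X_i = 'X_i) ->
  forall p m, (th p)@_m = (mdeg m)%:R * p@_m.
Proof.
move=> thP thM thX.
have th0 : th 0 = 0 by have := thP (-1) 0 0; rewrite scaler0 addr0 scaleN1r addNr.
have th1 : th 1 = 0.
  have := thM 1 1; rewrite !mulr1 mul1r => /eqP.
  by rewrite -subr_eq0 opprD addrA subrr add0r oppr_eq0 => /eqP.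
have thXn i k : th ('X_i ^+ k) = k%:R *: 'X_i ^+ k.
  elim: k => [|k IH]; first by rewrite expr0 th1 scale0r.
  by rewrite exprS thM thX IH -scalerAr -[X in X + _]scale1r -scalerDl -natr1 addrC.
have thXm m : th 'X_[m] = (mdeg m)%:R *: 'X_[m].
  rewrite mpolyXE_id mdegE; elim/big_rec2: _ => [|i k q _ IH].
    by rewrite th1 scale0r.
  by rewrite thM thXn IH natrD scalerDl -scalerAl -scalerAr.
move=> p m; rewrite {1}(mpolyE p) [in RHS](mpolyE p).
elim: (msupp p) => [|m' s IH]; first by rewrite !big_nil th0 mcoeff0 mulr0.
rewrite !big_cons thP !mcoeffD !mcoeffZ mulrDr IH thXm mcoeffZ mcoeffX.
by case: eqP => [->|_]; rewrite ?mulr0 ?mulr1 // mulrC.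
Qed.

Lemma euler_const (K : numFieldType) n (th : {mpoly K[n]} -> {mpoly K[n]}) p :
  (forall k p q, th (k *: p + q) = k *: th p + th q) ->
  (forall p q, th (p * q) = th p * q + p * th q) ->
  (forall i, th 'X_i = 'X_i) ->
  th p = 0 -> p = (p@_0%MM)%:A.
Proof.
move=> thP thM thX thp; apply/mpolyP => m; rewrite alg_mpolyC mcoeffC.
have [-> /=|m0] := eqVneq m 0%MM; first by rewrite mulr1.
have := euler_mcoeff thP thM thX p m; rewrite thp mcoeff0 mulr0 => /esym/eqP.
by rewrite mulf_eq0 pnatr_eq0 mdeg_eq0 (negbTE m0) => /eqP.
Qed.

Section Dihedral.
Variables (K : numFieldType) (H : vectType K) (G : linear_group H).
Variables (u1 u2 : H) (z1 z2 : dual H).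
Hypotheses (z1u1 : z1 u1 = 1 :> K) (z1u2 : z1 u2 = 0 :> K).
Hypotheses (z2u1 : z2 u1 = 0 :> K) (z2u2 : z2 u2 = 1 :> K).
Hypothesis zspan : forall x : H, x = (z1 x : K) *: u1 + (z2 x : K) *: u2.

(** The shape of the matrix, in an isotropic basis, of a map preserving a
    nondegenerate symmetric form on a plane. *)
Definition monomial (w : 'End(H)) := exists2 a : K, a != 0 &
  (w u1 = a *: u1 /\ w u2 = a^-1 *: u2) \/ (w u1 = a *: u2 /\ w u2 = a^-1 *: u1).
Hypothesis G_monomial : forall w, G w -> monomial w.
Variables (rot s : 'End(H)) (zeta : K).
Hypotheses (Grot : G rot) (Gs : G s).
Hypotheses (rot1 : rot u1 = zeta *: u1) (rot2 : rot u2 = zeta^-1 *: u2).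
Hypotheses (s1 : s u1 = u2) (s2 : s u2 = u1).
Hypothesis zeta2 : zeta ^+ 2 != 1.

Local Notation S := (sym_cotangent H).
Local Notation V := (H * dual H)%type.

Definition x1 : S := sym_gen (u1, 0).
Definition x2 : S := sym_gen (u2, 0).
(** [y1] and [y2] are numbered crosswise, since [z2] scales like [u1]. *)
Definition y1 : S := sym_gen (0, z2).
Definition y2 : S := sym_gen (0, z1).

Lemma bracket_gen u v : pbr (sym_gen u : S) (sym_gen v) = (symplectic_form u v)%:A.
Proof. exact: sym_pbr_gen. Qed.

Lemma dualE (x y : dual H) : (x u1 : K) = y u1 -> (x u2 : K) = y u2 -> x = y.
Proof.
move=> e1 e2; apply/lfunP => u; rewrite (zspan u) !linearP !linearZ /=.
by rewrite e1 e2.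
Qed.

Lemma gen_span v : exists a b c d : K,
  sym_gen v = a *: x1 + (b *: x2 + (c *: y1 + d *: y2)).
Proof.
exists (z1 v.1), (z2 v.1), (v.2 u2), (v.2 u1).
have g0 : sym_gen (0 : V) = 0.
  by have := sym_genP (-1) 0 (0 : V); rewrite scaler0 addr0 scaleN1r addNr.
rewrite -[_ *: y2]addr0 -g0 -!sym_genP; congr sym_gen.
case: v => x xi; rewrite /= !addr0; congr pair; rewrite /= ?scaler0 ?add0r ?addr0.
  exact: zspan.
apply: dualE; rewrite !lfunE /= !lfunE /= ?z1u1 ?z1u2 ?z2u1 ?z2u2.
  by rewrite scaler0 add0r [RHS]mulr1.
by rewrite scaler0 addr0 [RHS]mulr1.
Qed.

Lemma sym_gen_ind (P : S -> Prop) :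
  (forall k, P k%:A) -> P x1 -> P x2 -> P y1 -> P y2 ->
  (forall a b, P a -> P b -> P (a + b)) ->
  (forall a b, P a -> P b -> P (a * b)) -> forall a, P a.
Proof.
move=> PA P1 P2 P3 P4 PD PM; apply: mpoly_gen_ind => //.
  by move=> c; rewrite -alg_mpolyC; apply: PA.
move=> i; rewrite -sym_gen_basis; have [a [b [c [d ->]]]] := gen_span (vbasis {: V})`_i.
have PZ k p : P p -> P (k *: p) by move=> Pp; rewrite -mulr_algl; apply: PM.
by apply: PD (PZ a _ P1) (PD _ _ (PZ b _ P2) (PD _ _ (PZ c _ P3) (PZ d _ P4))).
Qed.

Lemma bx1x2 : pbr x1 x2 = 0.
Proof. by rewrite bracket_gen /symplectic_form /= !lfunE subrr scale0r. Qed.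
Lemma by1y2 : pbr y1 y2 = 0.
Proof.
have z0 (z : dual H) : z 0 = 0 :> K by rewrite linear0.
by rewrite bracket_gen /symplectic_form /= !z0 subrr scale0r.
Qed.
Lemma bx1y1 : pbr x1 y1 = 0.
Proof. by rewrite bracket_gen /symplectic_form /= z2u1 lfunE subrr scale0r. Qed.
Lemma bx2y2 : pbr x2 y2 = 0.
Proof. by rewrite bracket_gen /symplectic_form /= z1u2 lfunE subrr scale0r. Qed.
Lemma bx1y2 : pbr x1 y2 = 1.
Proof. by rewrite bracket_gen /symplectic_form /= z1u1 lfunE subr0 scale1r. Qed.
Lemma bx2y1 : pbr x2 y1 = 1.
Proof. by rewrite bracket_gen /symplectic_form /= z2u2 lfunE subr0 scale1r. Qed.

Definition sym_eps (p : S) : K := (p : {mpoly K[\dim {: V}]})@_0%MM.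

Lemma sym_epsP k p q : sym_eps (k *: p + q) = k * sym_eps p + sym_eps q.
Proof. by rewrite /sym_eps mcoeffD mcoeffZ. Qed.
Lemma sym_epsM p q : sym_eps (p * q) = sym_eps p * sym_eps q.
Proof. by have [] := mcoeff0_is_multiplicative (\dim {: V}) K. Qed.
Lemma sym_eps_alg k : sym_eps k%:A = k.
Proof. by rewrite /sym_eps mcoeffZ mcoeff1 eqxx mulr1. Qed.
Lemma sym_eps_gen v : sym_eps (sym_gen v) = 0.
Proof.
rewrite /sym_eps /sym_gen raddf_sum big1 // => i _.
by rewrite [LHS]mcoeffZ mcoeffX mnm1_eq0 mulr0.
Qed.

Lemma sym_euler0 p : Euler x1 x2 y1 y2 p = 0 -> p = (sym_eps p)%:A.
Proof.
apply: (@euler_const K _ (Euler x1 x2 y1 y2)).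
- move=> k q q'; exact: (EulerP x1 x2 y1 y2 k).
- move=> q q'; exact: (EulerM x1 x2 y1 y2).
- move=> i; rewrite -sym_gen_basis.
  have [a [b [c [d ->]]]] := gen_span (vbasis {: V})`_i.
  exact: Euler_lin bx1x2 by1y2 bx1y1 bx2y2 bx1y2 bx2y1 a b c d.
Qed.

Implicit Types w : 'End(H).

Lemma act_gen w (v : V) : sym_act w (sym_gen v) = sym_gen (diag_act w v).
Proof. exact: sym_act_gen. Qed.
Lemma actM w (p q : S) : sym_act w (p * q) = sym_act w p * sym_act w q.
Proof. exact: rmorphM. Qed.
Lemma actP w k (p q : S) : sym_act w (k *: p + q) = k *: sym_act w p + sym_act w q.
Proof. exact: linearP. Qed.
Lemma actD w (p q : S) : sym_act w (p + q) = sym_act w p + sym_act w q.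
Proof. exact: rmorphD. Qed.
Lemma act_pbr w (p q : S) : G w ->
  sym_act w (pbr p q) = pbr (sym_act w p) (sym_act w q).
Proof. by move=> Gw; apply: sym_act_pbr; apply: lg_inj Gw. Qed.
Lemma act_alg w k : sym_act w (k%:A : S) = k%:A.
Proof. by rewrite /sym_act alg_mpolyC; apply: comp_mpolyC. Qed.

Lemma sym_genZ k (v : V) : sym_gen (k *: v) = k *: sym_gen v.
Proof.
have g0 : sym_gen (0 : V) = 0.
  by have := sym_genP (-1) 0 (0 : V); rewrite scaler0 addr0 scaleN1r addNr.
by rewrite -[k *: v]addr0 sym_genP g0 addr0.
Qed.

Lemma act_x w (u u' : H) k : w u = k *: u' ->
  sym_act w (sym_gen (u, 0)) = k *: sym_gen (u', 0).
Proof.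
move=> wu; rewrite act_gen -sym_genZ; congr sym_gen.
by congr pair; rewrite /= ?wu // comp_lfun0l scaler0.
Qed.

Lemma act_y w (z z' : dual H) k : (z \o w^-1)%VF = k *: z' ->
  sym_act w (sym_gen (0, z)) = k *: sym_gen (0, z').
Proof.
move=> wz; rewrite act_gen -sym_genZ; congr sym_gen.
by congr pair; rewrite /= ?wz // linear0 scaler0.
Qed.

Lemma inv_eigen w (u u' : H) k : G w -> k != 0 -> w u = k *: u' ->
  (w^-1)%VF u' = k^-1 *: u.
Proof.
move=> Gw k0 wu; rewrite -[u'](scalerK k0) -wu linearZ /=.
by rewrite lker0_lfunK // (lg_inj Gw).
Qed.

Lemma act_diag w a : G w -> a != 0 -> w u1 = a *: u1 -> w u2 = a^-1 *: u2 ->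
  [/\ sym_act w x1 = a *: x1, sym_act w x2 = a^-1 *: x2,
      sym_act w y1 = a *: y1 & sym_act w y2 = a^-1 *: y2].
Proof.
move=> Gw a0 w1 w2; have a'0 : a^-1 != 0 by rewrite invr_eq0.
have i1 := inv_eigen Gw a0 w1; have i2 := inv_eigen Gw a'0 w2.
rewrite invrK in i2; split; try exact: act_x.
- apply: act_y; apply: dualE; rewrite comp_lfunE !lfunE /= ?i1 ?i2 linearZ /=.
    by rewrite z2u1 scaler0 [RHS]mulr0.
  by rewrite z2u2.
- apply: act_y; apply: dualE; rewrite comp_lfunE !lfunE /= ?i1 ?i2 linearZ /=.
    by rewrite z1u1.
  by rewrite z1u2 scaler0 [RHS]mulr0.
Qed.

Lemma act_swap w a : G w -> a != 0 -> w u1 = a *: u2 -> w u2 = a^-1 *: u1 ->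
  [/\ sym_act w x1 = a *: x2, sym_act w x2 = a^-1 *: x1,
      sym_act w y1 = a *: y2 & sym_act w y2 = a^-1 *: y1].
Proof.
move=> Gw a0 w1 w2; have a'0 : a^-1 != 0 by rewrite invr_eq0.
have i1 := inv_eigen Gw a0 w1; have i2 := inv_eigen Gw a'0 w2.
rewrite invrK in i2; split; try exact: act_x.
- apply: act_y; apply: dualE; rewrite comp_lfunE !lfunE /= ?i1 ?i2 linearZ /=.
    by rewrite z2u2 z1u1.
  by rewrite z2u1 z1u2 scaler0 [RHS]mulr0.
- apply: act_y; apply: dualE; rewrite comp_lfunE !lfunE /= ?i1 ?i2 linearZ /=.
    by rewrite z1u2 z2u1 scaler0 [RHS]mulr0.
  by rewrite z1u1 z2u2.
Qed.

Lemma act_endo w : G w -> poisson_endo (@sym_act K H w).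
Proof.
move=> Gw; split; [exact: actP|exact: actM|].
by move=> p q; apply: act_pbr.
Qed.

Lemma act_monomial w : G w -> exists2 a, a != 0 &
  acts_diag x1 x2 y1 y2 (@sym_act K H w) a \/
  acts_swap x1 x2 y1 y2 (@sym_act K H w) a.
Proof.
move=> Gw; have [a a0 [[w1 w2]|[w1 w2]]] := G_monomial Gw; exists a => //.
  by left; apply: act_diag.
by right; apply: act_swap.
Qed.

Lemma eps_act w (p : S) : sym_eps (sym_act w p) = sym_eps p.
Proof.
elim/sym_gen_ind: p => [k|||||p q Hp Hq|p q Hp Hq].
- by rewrite act_alg.
- by rewrite act_gen !sym_eps_gen.
- by rewrite act_gen !sym_eps_gen.
- by rewrite act_gen !sym_eps_gen.
- by rewrite act_gen !sym_eps_gen.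
- have epsD a b : sym_eps (a + b) = sym_eps a + sym_eps b by apply: mcoeffD.
  by rewrite actD !epsD Hp Hq.
- by rewrite actM !sym_epsM Hp Hq.
Qed.

Local Notation A := (invariant_alg G).

Lemma invariantP (p : S) : (forall w, G w -> sym_act w p = p) ->
  exists a : A, invariant_val a = p.
Proof.
move=> Hp; have Ip : p \in is_invariant G by apply/asboolP.
by exists (Invariant Ip).
Qed.

Lemma invariant_act (a : A) w : G w -> sym_act w (invariant_val a) = invariant_val a.
Proof. by case: a => p /= /asboolP; apply. Qed.

Lemma invariant_jet (a : A) : fixed_jet x1 x2 y1 y2 sym_eps (invariant_val a).
Proof.
have [zeta_eq0|z0] := eqVneq zeta 0.
  have u10 : u1 = 0.
    by apply: (elimT lker0P (lg_inj Grot)); rewrite rot1 zeta_eq0 scale0r linear0.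
  by move: z1u1 => /eqP; rewrite u10 linear0 eq_sym oner_eq0.
apply: (@fixed_jetP K (sym_cotangent H) x1 x2 y1 y2 sym_eps sym_epsP sym_eps_alg
  (@sym_act K H rot) (@sym_act K H s) zeta) => //.
- exact: act_endo.
- exact: act_endo.
- exact: eps_act.
- exact: eps_act.
- exact: act_diag.
- by apply: act_swap; rewrite ?invr1 ?scale1r ?oner_neq0.
- exact: invariant_act.
- exact: invariant_act.
Qed.

(** The only point that is not linear algebra is that division by [omega ^+ 2]
    preserves invariance: [S] is an integral domain and [omega ^+ 2] is invariant. *)
Lemma invariant_graded : sl2_graded A.
Proof.
have ex3 : exists t : A * A * A, [/\ invariant_val t.1.1 = qe x1 x2,
    invariant_val t.1.2 = qf y1 y2 & invariant_val t.2 = qh x1 x2 y1 y2].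
  have efh w : G w -> _ := fun Gw =>
    let: ex_intro2 a a0 m := act_monomial Gw in endo_efh (act_endo Gw) a0 m.
  have [|E Ee] := @invariantP (qe x1 x2); first by move=> w /efh[].
  have [|F Ff] := @invariantP (qf y1 y2); first by move=> w /efh[].
  have [|T Th] := @invariantP (qh x1 x2 y1 y2); first by move=> w /efh[].
  by exists (E, F, T).
have [[[E F] T] /= [Ee Ff Th]] := cid ex3.
apply: (@sub_graded K (sym_cotangent H) x1 x2 y1 y2 bx1x2 by1y2 bx1y1 bx2y2
  bx1y2 bx2y1 sym_gen_ind sym_eps sym_epsP sym_epsM sym_eps_alg
  (sym_eps_gen _) (sym_eps_gen _) (sym_eps_gen _) (sym_eps_gen _) sym_euler0
  A (@invariant_val K H G) _ _ _ _ _ invariant_jet _ _ E F T Ee Ff Th).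
- by [].
- by [].
- by [].
- by [].
- exact: val_inj.
- move=> a; apply: invariantP => w Gw; have [k k0 m] := act_monomial Gw.
  by rewrite (endo_Eu (act_endo Gw) k0 m) invariant_act.
- move=> a; apply: invariantP => w Gw; have [k k0 m] := act_monomial Gw.
  by rewrite (endo_Ev (act_endo Gw) k0 m) invariant_act.
move=> a t at_; apply: invariantP => w Gw; have [k k0 m] := act_monomial Gw.
have om0 := omega_neq0 bx1x2 by1y2 bx1y1 bx2y2 bx1y2.
have om20 : omega x1 x2 y1 y2 ^+ 2 != 0 :> {mpoly K[\dim {: V}]}.
  exact: expf_neq0.
apply: (mulfI om20).
have := invariant_act a Gw; rewrite at_ => H1; rewrite -[RHS]H1.
by rewrite actM (endo_omega2 (act_endo Gw) k0 m).
Qed.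

End Dihedral.

(** * Rank two root systems *)

Lemma lfun_reflection (K : fieldType) (H : vectType K) (a : dual H) (c : H) :
  exists s : 'End(H), forall x, s x = x - (a x : K) *: c.
Proof.
pose f (x : H) := x - (a x : K) *: c.
have flin : linear f.
  move=> k x y; rewrite /f linearP /= scalerDl scalerBr scalerA opprD addrACA.
  by [].
pose fl : {linear H -> H} := HB.pack f (GRing.isLinear.Build K H H *:%R f flin).
by exists (linfun fl) => x; rewrite lfunE.
Qed.

(** The dual has a basis of two elements, so the space is a plane and evaluation at
    the basis is a bijection onto pairs of scalars. *)
Lemma dual_basis_surj (K : fieldType) (H : vectType K) (a b : dual H) :
  basis_of fullv [:: a; b] ->
  (forall x y, (a x : K) = a y -> (b x : K) = b y -> x = y) /\
  forall k l : K, exists x, (a x : K) = k /\ (b x : K) = l.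
Proof.
move=> bas.
have dimH : \dim {: H} = 2%N.
  have := vector.size_basis bas; rewrite /= dimvf => /eqP; rewrite /dim /=.
  by rewrite muln1 dimvf => /eqP.
have sep x : (a x : K) = 0 -> (b x : K) = 0 -> x = 0.
  move=> ax bx; rewrite (coord_vbasis (memvf x)) big1 // => i _.
  pose z : dual H := linfun (coord (vbasis {: H}) i : H -> K^o).
  have -> : coord (vbasis {: H}) i x = z x by rewrite lfunE.
  have : z \in <<[:: a; b]>>%VS by rewrite (span_basis bas) memvf.
  rewrite span_cons span_seq1 => /memv_addP[_ /vlineP[k ->] [_ /vlineP[l ->] ->]].
  by rewrite !lfunE /= !lfunE /= ax bx !scaler0 addr0 scale0r.
split=> [x y ax bx|k l].
  by apply/eqP; rewrite -subr_eq0; apply/eqP/sep; rewrite linearB /= ?ax ?bx subrr.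
pose f (x : H) : (K^o * K^o)%type := (a x, b x).
have flin : linear f by move=> c x y; rewrite /f !linearP.
pose fl : {linear H -> (K^o * K^o)%type} :=
  HB.pack f (GRing.isLinear.Build K H _ *:%R f flin).
have ker0 : lker (linfun fl) == 0%VS.
  apply/lker0P => x y; rewrite !lfunE /= => -[ax bx].
  by apply/eqP; rewrite -subr_eq0; apply/eqP/sep; rewrite linearB /= ?ax ?bx subrr.
have full : limg (linfun fl) = fullv.
  apply/eqP; rewrite eqEdim subvf limg_dim_eq; last by rewrite (eqP ker0) capv0.
  by rewrite dimH dimvf.
have : ((k, l) : (K^o * K^o)%type) \in limg (linfun fl) by rewrite full memvf.
by case/memv_imgP => x _; rewrite lfunE /= => -[-> ->]; exists x.
Qed.

Section RootSystem.
Variables (K : numClosedFieldType) (g : lieAlgType K) (h : {vspace g}).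
Variable t : rank2_type.
Local Notation H := (subvs_of h).
Variables a b : dual H.
Hypothesis ab_basis : basis_of fullv [:: a; b].
Hypothesis rootsE : forall r : dual H, is_root r <->
  exists2 p, p \in positive_roots t &
    r = a *+ p.1 + b *+ p.2 \/ r = - (a *+ p.1 + b *+ p.2).

Definition int_roots : seq (int * int) :=
  [seq (p.1%:Z, p.2%:Z) | p <- positive_roots t] ++
  [seq (- p.1%:Z, - p.2%:Z) | p <- positive_roots t].

Definition root_of (p : int * int) : dual H := a *~ p.1 + b *~ p.2.

Lemma int_rootsP r : is_root r <-> exists2 p, p \in int_roots & r = root_of p.
Proof.
split=> [/rootsE[p pt rE]|[p]].
  case: rE => ->.
    by exists (p.1%:Z, p.2%:Z) => //; rewrite mem_cat map_f.
  exists (- p.1%:Z, - p.2%:Z).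
    by rewrite mem_cat; apply/orP; right; apply/mapP; exists p.
  by rewrite /root_of /= !mulrNz opprD.
rewrite mem_cat => /orP[] /mapP[q qt ->] ->; apply/rootsE; exists q => //.
  by left.
by right; rewrite /root_of /= !mulrNz opprD.
Qed.

(** The coroots [ca], [cb] of the base satisfy [b ca = - cartan] and [a cb = -1]. *)
Definition cartan : nat := match t with A2 => 1 | B2 => 2 | G2 => 3 end.

(** The reflections in [a] and [b], in coordinates with respect to the base. *)
Lemma reflect_a : all (fun p : int * int => (cartan%:Z * p.2 - p.1, p.2) \in int_roots)
  int_roots.
Proof. by rewrite /int_roots /cartan; case: t. Qed.

Lemma reflect_b : all (fun p : int * int => (p.1, p.1 - p.2) \in int_roots)
  int_roots.
Proof. by rewrite /int_roots; case: t. Qed.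

Lemma root_ofE p x : (root_of p x : K) = p.1%:~R * (a x : K) + p.2%:~R * (b x : K).
Proof.
rewrite /root_of lfunE /=.
have mz (z : dual H) k : ((z *~ k) x : K) = k%:~R * (z x : K).
  by rewrite -scaler_int lfunE /= /GRing.scale /=.
by rewrite !mz.
Qed.

Lemma a_root : is_root a.
Proof.
apply/int_rootsP; exists (1, 0); first by rewrite /int_roots; case: t.
by rewrite /root_of mulr1z mulr0z addr0.
Qed.

Lemma b_root : is_root b.
Proof.
apply/int_rootsP; exists (0, 1); first by rewrite /int_roots; case: t.
by rewrite /root_of mulr1z mulr0z add0r.
Qed.

Lemma coroot_a c : (a c : K) = 2%:R -> (b c : K) = - cartan%:R -> is_coroot a c.
Proof.
move=> ac bc; split=> // r /int_rootsP[p pt ->]; apply/int_rootsP.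
exists (cartan%:Z * p.2 - p.1, p.2); first exact: (allP reflect_a).
rewrite root_ofE ac bc; apply/lfunP => x; rewrite add_lfunE opp_lfunE scale_lfunE !root_ofE /= /GRing.scale /=.
by rewrite !(rmorphB, rmorphM) /=; ring.
Qed.

Lemma coroot_b c : (b c : K) = 2%:R -> (a c : K) = -1 -> is_coroot b c.
Proof.
move=> bc ac; split=> // r /int_rootsP[p pt ->]; apply/int_rootsP.
exists (p.1, p.1 - p.2); first exact: (allP reflect_b).
rewrite root_ofE ac bc; apply/lfunP => x; rewrite add_lfunE opp_lfunE scale_lfunE !root_ofE /= /GRing.scale /=.
by rewrite !(rmorphB, rmorphM) /=; ring.
Qed.

(** * The invariant form *)

Definition roots : seq (dual H) := undup [seq root_of p | p <- int_roots].

Lemma mem_roots r : (r \in roots) <-> is_root r.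
Proof.
rewrite mem_undup; split=> [/mapP[p pt ->]|/int_rootsP[p pt ->]].
  by apply/int_rootsP; exists p.
exact: map_f.
Qed.

(** The sum of the squares of the roots; over the complex numbers it can have
    isotropic vectors. *)
Definition form (x y : H) : K := \sum_(r <- roots) (r x : K) * (r y : K).

Lemma formC x y : form x y = form y x.
Proof. by apply: eq_bigr => r _; rewrite mulrC. Qed.

Lemma formP k x y z : form (k *: x + y) z = k * form x z + form y z.
Proof.
rewrite /form mulr_sumr -big_split /=; apply: eq_bigr => r _.
by rewrite linearP /= mulrDl -mulrA.
Qed.

Lemma formZ k x y : form (k *: x) y = k * form x y.
Proof.
have f0 z : form 0 z = 0 by rewrite /form big1 // => r _; rewrite linear0 mul0r.
by rewrite -[k *: x]addr0 formP f0 addr0.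
Qed.

Definition preserves_form (w : 'End(H)) := forall x y, form (w x) (w y) = form x y.

(** Composition with a reflection permutes the roots, by the definition of a coroot. *)
Lemma reflection_form s : is_reflection s -> preserves_form s.
Proof.
move=> sr; have ks : lker s == 0%VS by apply/weyl_inj/weyl_reflection.
case: sr => z [c [zr [zc cr] sE]] x y.
have rsE (r : dual H) : (r \o s)%VF = r - (r c : K) *: z.
  apply/lfunP => u; rewrite comp_lfunE add_lfunE opp_lfunE scale_lfunE sE.
  by rewrite linearB linearZ /= /GRing.scale /= mulrC.
pose rs (r : dual H) : dual H := (r \o s)%VF.
have rs_inj : injective rs.
  move=> r r' rr; apply/lfunP => u.
  have := congr1 (fun q : dual H => q ((s^-1)%VF u)) rr.
  by rewrite /rs !comp_lfunE !lker0_lfunVK.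
have rs_sub : {subset map rs roots <= roots}.
  move=> _ /mapP[r /mem_roots rr ->]; apply/mem_roots; rewrite /rs rsE.
  exact: cr.
have rs_uniq : uniq (map rs roots) by rewrite map_inj_uniq // undup_uniq.
have rs_eq : map rs roots =i roots.
  by have [|_] := uniq_min_size rs_uniq rs_sub; rewrite ?size_map.
have rs_perm : perm_eq (map rs roots) roots.
  by apply: uniq_perm => //; exact: undup_uniq.
rewrite [RHS]/form -(perm_big _ rs_perm) big_map; apply: eq_bigr => r _.
by rewrite /rs !comp_lfunE.
Qed.

Lemma weyl_form w : weyl_mem w -> preserves_form w.
Proof.
elim=> {w} [s /reflection_form //||v w _ fv _ fw|w ww fw] x y.
- by rewrite !lfunE.
- by rewrite !comp_lfunE fv fw.
- by rewrite -fw !lker0_lfunVK // weyl_inj.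
Qed.

(** At a vector where the roots take integral values, one of them being [1], the
    form is a sum of squares of integers. *)
Lemma form_nonzero : exists x, form x x != 0.
Proof.
have [_ surj] := dual_basis_surj ab_basis; have [x [ax bx]] := surj 1 0.
exists x; rewrite /form (bigD1_seq a) ?undup_uniq //=; last first.
  by apply/mem_roots/a_root.
rewrite gt_eqF // ltr_pwDl //; first by rewrite ax mulr1.
rewrite big_seq_cond sumr_ge0 // => r /andP[/mem_roots/int_rootsP[p _ ->] _].
rewrite root_ofE ax bx mulr1 mulr0 addr0 -rmorphM /= ler0z.
by rewrite -expr2 sqr_ge0.
Qed.

(** * A basis of isotropic vectors *)

(** The vectors [u1] and [u2] span the only two isotropic lines, which [w] fixes or
    exchanges; the value of the form on them relates the two scalars. *)
Lemma monomial_isotropic (u1 u2 : H) (z1 z2 : dual H) (w : 'End(H)) :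
  (forall x : H, x = (z1 x : K) *: u1 + (z2 x : K) *: u2) ->
  form u1 u1 = 0 -> form u2 u2 = 0 -> preserves_form w -> monomial u1 u2 w.
Proof.
move=> zspan f1 f2 fw; set k := form u1 u2.
have fE a1 b1 a2 b2 : form (a1 *: u1 + b1 *: u2) (a2 *: u1 + b2 *: u2) =
    (a1 * b2 + b1 * a2) * k.
  rewrite formP formZ !(formC _ (_ + _)) !formP !formZ.
  by rewrite f1 f2 (formC u2 u1) -/k; ring.
have k0 : k != 0.
  have [x] := form_nonzero; rewrite (zspan x) fE mulf_eq0 negb_or.
  by case/andP.
have := fw u1 u1; have := fw u2 u2; have := fw u1 u2.
rewrite f1 f2 -/k (zspan (w u1)) (zspan (w u2)) !fE.
set p := z1 (w u1); set q := z2 (w u1); set p' := z1 (w u2); set q' := z2 (w u2).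
have K2 (x y : K) : (x * y + y * x) * k = 0 -> x = 0 \/ y = 0.
  move/eqP; rewrite mulf_eq0 (negbTE k0) orbF [y * x]mulrC -mulr2n mulrn_eq0 /=.
  by rewrite mulf_eq0 => /orP[] /eqP; [left|right].
move=> E12 /K2 E22 /K2 E11.
have {}E12 : p * q' + q * p' = 1.
  by apply: (mulIf k0); rewrite E12 mul1r.
rewrite /monomial; have := zspan (w u1); have := zspan (w u2).
rewrite -/p -/q -/p' -/q'; case: E11 => E.
  rewrite E mul0r add0r scale0r add0r in E12 *.
  have q0 : q != 0 by apply: contraTneq (oner_neq0 K) => q0; rewrite -E12 q0 mul0r eqxx.
  have p'E : p' = q^-1 by apply: (mulfI q0); rewrite E12 mulfV.
  case: E22 => E'; first by move: p'E; rewrite E' => /esym/eqP; rewrite invr_eq0 (negbTE q0).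
  rewrite E' p'E scale0r addr0 => w2 w1; exists q => //; right; split=> //.
rewrite E mul0r addr0 scale0r addr0 in E12 *.
have p0 : p != 0 by apply: contraTneq (oner_neq0 K) => p0; rewrite -E12 p0 mul0r eqxx.
have q'E : q' = p^-1 by apply: (mulfI p0); rewrite E12 mulfV.
case: E22 => E'; last by move: q'E; rewrite E' => /esym/eqP; rewrite invr_eq0 (negbTE p0).
by rewrite E' q'E scale0r add0r => w2 w1; exists p => //; left.
Qed.

(** The product of the reflections in [b] and [a] has determinant [1] and trace
    [cartan - 2], so its eigenvalues are [zeta] and [zeta^-1] with [zeta] of order
    3, 4 or 6. As [zeta ^+ 2 != 1], its eigenvectors are isotropic for the invariant
    form, and the reflection in [a] exchanges them. *)
Lemma weyl_graded : sl2_graded (invariant_alg (weyl_group h)).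
Proof.
have [sep surj] := dual_basis_surj ab_basis.
have [ca [aca bca]] := cid (surj 2%:R (- cartan%:R)).
have [cb [acb bcb]] := cid (surj (-1) 2%:R).
have [sa saE] := cid (lfun_reflection a ca).
have [sb sbE] := cid (lfun_reflection b cb).
have Wsa : weyl_mem sa.
  by apply: weyl_reflection; exists a, ca; split=> //; [exact: a_root|exact: coroot_a].
have Wsb : weyl_mem sb.
  by apply: weyl_reflection; exists b, cb; split=> //; [exact: b_root|exact: coroot_b].
pose m : K := cartan%:R - 2%:R.
have cE : cartan%:R = m + 2%:R by rewrite /m subrK.
have m2 : m ^+ 2 != 4%:R.
  have [->|[->|->]] : m = -1 \/ m = 0 \/ m = 1.
  - by rewrite /m /cartan; case: (t); [left|right; left|right; right]; ring.
  - by rewrite sqrrN expr1n (eqr_nat K 1 4).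
  - by rewrite expr0n (eqr_nat K 0 4).
  - by rewrite expr1n (eqr_nat K 1 4).
clearbody m.
pose zeta : K := (m + sqrtC (m ^+ 2 - 4%:R)) / 2%:R.
have zetaE : zeta ^+ 2 = m * zeta - 1.
  have := sqrtCK (m ^+ 2 - 4%:R); rewrite /zeta; move: (sqrtC _) => q qE.
  have -> : ((m + q) / 2%:R) ^+ 2 = (m ^+ 2 + 2%:R * m * q + q ^+ 2) / 4%:R.
    by field.
  by rewrite qE; field.
clearbody zeta.
have zeta0 : zeta != 0.
  apply: contra_eq_neq zetaE => ->; rewrite expr0n mulr0 sub0r eq_sym oppr_eq0.
  exact: oner_neq0.
have zeta2 : zeta ^+ 2 != 1.
  apply: contra m2 => /eqP z2; have mz : m * zeta = 2%:R.
    by move: zetaE; rewrite z2 => /esym/eqP; rewrite subr_eq => /eqP ->; ring.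
  have : m ^+ 2 * zeta ^+ 2 = 4%:R by rewrite -exprMn mz; ring.
  by rewrite z2 mulr1 => ->.
have zetaV : zeta^-1 = m - zeta.
  by apply: (mulfI zeta0); rewrite mulfV // mulrBr -expr2 zetaE; ring.
(* The eigenvectors, computed in the basis of coroots. *)
pose u1 := ca + (1 + zeta) *: cb; pose u2 := zeta *: ca + (1 + zeta) *: cb.
have aD (z : dual H) x y : (z (x + y) : K) = (z x : K) + (z y : K) by rewrite linearD.
have aZ (z : dual H) k x : (z (k *: x) : K) = k * (z x : K) by rewrite linearZ.
have au1 : (a u1 : K) = 1 - zeta by rewrite aD aZ aca acb; ring.
have bu1 : (b u1 : K) = 2%:R * zeta - m by rewrite aD aZ bca bcb cE; ring.
have au2 : (a u2 : K) = zeta - 1 by rewrite aD !aZ aca acb; ring.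
have bu2 : (b u2 : K) = 2%:R - m * zeta by rewrite aD !aZ bca bcb cE; ring.
have asa x : (a (sa x) : K) = - (a x : K).
  by rewrite saE -scaleNr aD aZ aca; ring.
have bsa x : (b (sa x) : K) = (b x : K) + (m + 2%:R) * (a x : K).
  by rewrite saE -scaleNr aD aZ bca cE; ring.
have asb x : (a (sb x) : K) = (a x : K) + (b x : K).
  by rewrite sbE -scaleNr aD aZ acb; ring.
have bsb x : (b (sb x) : K) = - (b x : K).
  by rewrite sbE -scaleNr aD aZ bcb; ring.
have sa1 : sa u1 = u2 by apply: sep; rewrite ?asa ?bsa au1 ?bu1 ?au2 ?bu2; ring.
have sa2 : sa u2 = u1 by apply: sep; rewrite ?asa ?bsa au2 ?bu2 ?au1 ?bu1; ring.
have comb (x y c : K) : x - y = c * (zeta ^+ 2 - (m * zeta - 1)) -> x = y.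
  by move=> xy; apply/eqP; rewrite -subr_eq0 xy zetaE subrr mulr0.
have sb2 : sb u2 = zeta *: u1.
  apply: sep; rewrite ?asb ?bsb aZ ?au1 ?bu1 ?au2 ?bu2.
    by apply: (comb _ _ 1); ring.
  by apply: (comb _ _ (-2%:R)); ring.
have sb1 : sb u1 = zeta^-1 *: u2.
  apply: sep; rewrite ?asb ?bsb aZ ?au1 ?bu1 ?au2 ?bu2 zetaV.
    by apply: (comb _ _ 1); ring.
  by apply: (comb _ _ (- m)); ring.
(* The determinant of the values of [a] and [b] at [u1] and [u2]. *)
pose D := (1 - zeta ^+ 2) * (2%:R - m).
have D0 : D != 0.
  rewrite mulf_neq0 // subr_eq0 eq_sym //; apply: contra m2 => /eqP ->.
  by apply/eqP; ring.
pose z1 : dual H := ((2%:R - m * zeta) / D) *: a + ((1 - zeta) / D) *: b.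
pose z2 : dual H := ((m - 2%:R * zeta) / D) *: a + ((1 - zeta) / D) *: b.
have z1E x : (z1 x : K) = (2%:R - m * zeta) / D * (a x : K) + (1 - zeta) / D * (b x : K).
  by rewrite /z1 add_lfunE !scale_lfunE.
have z2E x : (z2 x : K) = (m - 2%:R * zeta) / D * (a x : K) + (1 - zeta) / D * (b x : K).
  by rewrite /z2 add_lfunE !scale_lfunE.
have DD (k : K) : k = (1 - zeta ^+ 2) * (2%:R - m) / D * k.
  by rewrite -/D mulfV // mul1r.
have zspan x : x = (z1 x : K) *: u1 + (z2 x : K) *: u2.
  apply: sep; rewrite aD !aZ z1E z2E ?au1 ?au2 ?bu1 ?bu2.
    by rewrite [LHS]DD; clearbody D; field.
  by rewrite [LHS]DD; clearbody D; field.
have iso1 : form u1 u1 = 0.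
  have := weyl_form Wsb (sa u1) (sa u1); rewrite (weyl_form Wsa) sa1 sb2.
  rewrite formZ formC formZ mulrA -expr2 => /eqP.
  by rewrite -subr_eq0 -{2}[form _ _]mul1r -mulrBl mulf_eq0 subr_eq0 (negbTE zeta2) => /eqP.
have iso2 : form u2 u2 = 0 by rewrite -sa1 (weyl_form Wsa).
apply: (@invariant_graded K H (weyl_group h) u1 u2 z1 z2 _ _ _ _ zspan _
  (sb \o sa)%VF sa zeta) => //.
- by rewrite z1E au1 bu1 [RHS]DD; clearbody D; field.
- by rewrite z1E au2 bu2; ring.
- by rewrite z2E au1 bu1; ring.
- by rewrite z2E au2 bu2 [RHS]DD; clearbody D; field.
- by move=> w Ww; apply: monomial_isotropic zspan iso1 iso2 (weyl_form Ww).
- exact: weyl_mul.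
- by rewrite comp_lfunE sa1 sb2.
- by rewrite comp_lfunE sa2 sb1.
Qed.

End RootSystem.

Theorem mainTheorem2 (R : realType) (g : lieAlgType R[i]) (h : {vspace g})
    (t : rank2_type)
    (simple_g : simple_lie g)
    (cartan_h : cartan_subalgebra h)
    (type_g : has_type h t) :
  one_homogeneous (invariant_alg (weyl_group h)).
Proof.
have [a [b [ab_basis rootsE]]] := type_g.
exact: sl2_graded_homogeneous (weyl_graded ab_basis rootsE).
Qed.
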